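(* Let $\mu=\mu(F,\theta)>0$, $k=k(F,\theta)>0$ and let $U_{\mu,k}=(\xi,v,\theta)^T$, $\xi=(F,\zeta,w)$, be a strong solution, with initial data $U^0_{\mu,k}$ and defined on a maximal domain $Q_{T^*}=\mathbb{T}^3\times[0,T^* )$, of the augmented thermoviscoelasticity system $$\partial_t\xi^B-\partial_\alpha\Big(\tfrac{\partial\Phi^B}{\partial F_{i\alpha}}(F)v_i\Big)=0,\qquad \partial_t v_i-\partial_\alpha\Big(\tfrac{\partial\hat\psi}{\partial\xi^B}(\xi,\theta)\tfrac{\partial\Phi^B}{\partial F_{i\alpha}}(F)\Big)=\partial_\alpha(\mu\,\partial_\alpha v_i),$$ $$\partial_t\Big(\tfrac12|v|^2+\hat e(\xi,\theta)\Big)-\partial_\alpha\Big(\tfrac{\partial\hat\psi}{\partial\xi^B}(\xi,\theta)\tfrac{\partial\Phi^B}{\partial F_{i\alpha}}(F)v_i\Big)=\partial_\alpha(\mu\, v_i\partial_\alpha v_i)+\partial_\alpha(k\,\partial_\alpha\theta),$$ $$\partial_\alpha F_{i\beta}-\partial_\beta F_{i\alpha}=0,$$ satisfying $$\partial_t\hat\eta(\xi,\theta)-\partial_\alpha\Big(k\tfrac{\partial_\alpha\theta}{\theta}\Big)=k\tfrac{|\nabla\theta|^2}{\theta^2}+\mu\tfrac{|\nabla v|^2}{\theta}.$$ Let $\bar U=(\bar\xi,\bar v,\bar\theta)^T$, $\bar\xi=(\bar F,\bar\zeta,\bar w)$, be a smooth solution defined on $\bar Q_T$, $Q_T=\mathbb{T}^3\times[0,T)$,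 $0<T<T^*$, with initial data $\bar U^0$, of the augmented adiabatic thermoelasticity system (with zero heat supply) $$\partial_t\bar\xi^B-\partial_\alpha\Big(\tfrac{\partial\Phi^B}{\partial F_{i\alpha}}(\bar F)\bar v_i\Big)=0,\qquad \partial_t\bar v_i-\partial_\alpha\Big(\tfrac{\partial\hat\psi}{\partial\xi^B}(\bar\xi,\bar\theta)\tfrac{\partial\Phi^B}{\partial F_{i\alpha}}(\bar F)\Big)=0,$$ $$\partial_t\Big(\tfrac12|\bar v|^2+\hat e(\bar\xi,\bar\theta)\Big)-\partial_\alpha\Big(\tfrac{\partial\hat\psi}{\partial\xi^B}(\bar\xi,\bar\theta)\tfrac{\partial\Phi^B}{\partial F_{i\alpha}}(\bar F)\bar v_i\Big)=0,\qquad \partial_\alpha\bar F_{i\beta}-\partial_\beta\bar F_{i\alpha}=0,$$ together with $\partial_t\hat\eta(\bar\xi,\bar\theta)=0$. Suppose that $\nabla^2_\xi\hat\psi(\xi,\theta)>0$ and $\hat\eta_\theta(\xi,\theta)>0$ and that the growth conditions (G1), (G2), (G3) stated in the context hold true. If $\bar U\in\Gamma_{M,\delta}$ for some $M,\delta>0$, then there exists a constant $C=C(T)$ such that for $t\in[0,T]$ $$\int I(U_{\mu,k}(t)|\bar U(t))\,dx\le C\left(\int I(U^0_{\mu,k}|\bar U^0)\,dx+\int_0^T\!\!\int\Big(\mu\,\theta(s)\frac{|\nabla\bar v(s)|^2}{\bar\theta(s)}+k\frac{|\nabla\bar\theta(s)|^2}{\bar\theta(s)}\Big)dx\,ds\right).$$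 Moreover, if $$|\mu(\xi,\theta)\,\theta|\le C\mu_0|\hat e(\xi,\theta)|\quad\text{and}\quad|k(\xi,\theta)|\le Ck_0|\hat e(\xi,\theta)|$$ for some positive constants $\mu_0,k_0$ (the amplitude parameters described in the context), then whenever the data satisfy $$\lim_{k_0,\mu_0\to0}\int I(U^0_{\mu,k}|\bar U^0)\,dx=0,$$ we have $$\sup_{t\in[0,T)}\int I(U_{\mu,k}(t)|\bar U(t))\,dx\to0\quad\text{as }k_0,\mu_0\to0^+.$$
   Context: Notation. Space dimension is $3$, $\mathbb{T}^3$ is the torus (periodic domain) and spatial integrals are over $\mathbb{T}^3$; indices $i,\alpha,\beta$ run over $1,2,3$; $B$ runs over $1,\dots,19$; repeated indices are summed. $\mathbb{M}^{3\times3}$ denotes real $3\times3$ matrices. $\Phi(F)=(F,\operatorname{cof}F,\det F)\in\mathbb{M}^{3\times3}\times\mathbb{M}^{3\times3}\times\mathbb{R}\simeq\mathbb{R}^{19}$ with components $\Phi^B(F)$, where $\operatorname{cof}F$ is the cofactor matrix. $\xi=(F,\zeta,w)\in\mathbb{M}^{3\times3}\times\mathbb{M}^{3\times3}\times\mathbb{R}\simeq\mathbb{R}^{19}$ with components $\xi^B$; $v\in\mathbb{R}^3$ is the velocity and $\theta\in\mathbb{R}^+$ the (positive) temperature. In the system, $F$ is the first component of $\xi$. Constitutive functions. $\hat\psi=\hat\psi(\xi,\theta)$ is a given $C^3$ function on $\mathbb{R}^{19}\times\mathbb{R}^+$; the free energy is $\psi(F,\theta)=\hat\psi(\Phi(F),\theta)$,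 and $$\hat\eta(\xi,\theta)=-\frac{\partial\hat\psi}{\partial\theta}(\xi,\theta),\qquad \hat e(\xi,\theta)=\hat\psi(\xi,\theta)-\theta\frac{\partial\hat\psi}{\partial\theta}(\xi,\theta).$$ The viscosity and heat conductivity are written $\mu(\xi,\theta)=\mu(F,\theta)$, $k(\xi,\theta)=k(F,\theta)$. They depend on parameters measuring their amplitudes, $\mu=\mu(F,\theta;\mu_0)$ and $k=k(F,\theta;k_0)$, with $\mu\to0$ as $\mu_0\to0$ and $k\to0$ as $k_0\to0$. Growth conditions. With $|\xi|_{p,q,r}:=|F|^p+|\zeta|^q+|w|^r$, for some constant $c>0$ and $p\ge4$, $q,r,\ell>1$: (G1) $c(|\xi|_{p,q,r}+\theta^\ell)-c\le\hat e(\xi,\theta)\le c(|\xi|_{p,q,r}+\theta^\ell)+c$; (G2) $\displaystyle\lim_{|\xi|_{p,q,r}+\theta^\ell\to\infty}\frac{|\partial_F\hat\psi|+|\partial_\zeta\hat\psi|^{\frac{p}{p-1}}+|\partial_w\hat\psi|^{\frac{p}{p-2}}}{|\xi|_{p,q,r}+\theta^\ell}=0$; (G3) $\displaystyle\lim_{|\xi|_{p,q,r}+\theta^\ell\to\infty}\frac{|\partial_\theta\hat\psi|}{|\xi|_{p,q,r}+\theta^\ell}=0$. The compact set is $\Gamma_{M,\delta}:=\{(\bar\xi,\bar v,\bar\theta): |\bar F|\le M,|\bar\zeta|\le M,|\bar w|\le M,|\bar v|\le M,\ 0<\delta\le\bar\theta\le M\}$. Relative entropy. For $U=(\xi,v,\theta)$,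 $\bar U=(\bar\xi,\bar v,\bar\theta)$, $$I(U|\bar U)=I(\xi,v,\theta|\bar\xi,\bar v,\bar\theta)=\hat\psi(\xi,\theta|\bar\xi,\bar\theta)+\tfrac12|v-\bar v|^2+(\hat\eta(\xi,\theta)-\hat\eta(\bar\xi,\bar\theta))(\theta-\bar\theta),$$ $$\hat\psi(\xi,\theta|\bar\xi,\bar\theta)=\hat\psi(\xi,\theta)-\hat\psi(\bar\xi,\bar\theta)-\frac{\partial\hat\psi}{\partial\xi^B}(\bar\xi,\bar\theta)(\xi^B-\bar\xi^B)+\hat\eta(\bar\xi,\bar\theta)(\theta-\bar\theta).$$ *)

(* Defs.v *)
From HB Require Import structures.
From mathcomp Require Import all_boot all_order all_algebra.
From mathcomp Require Import all_classical all_reals all_analysis.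

Set Implicit Arguments.
Unset Strict Implicit.
Unset Printing Implicit Defensive.

Import Order.TTheory GRing.Theory Num.Theory.
Import numFieldNormedType.Exports.

Local Open Scope classical_set_scope.
Local Open Scope ring_scope.

(** * Extended variables *)

(* xi = (F, zeta, w), an element of R^19 *)
Notation xi_space R := ('M[R]_3 * 'M[R]_3 * R)%type.

(* The index B = 1, ..., 19: nine entries of F, nine of zeta, and w. *)
Definition Bidx : finType := ('I_3 * 'I_3 + 'I_3 * 'I_3 + unit)%type.

Definition comp (R : realType) (xi : xi_space R) (B : Bidx) : R :=
  match B with
  | inl (inl ij) => xi.1.1 ij.1 ij.2
  | inl (inr ij) => xi.1.2 ij.1 ij.2
  | inr _ => xi.2
  end.

Definition basis (R : realType) (B : Bidx) : xi_space R :=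
  match B with
  | inl (inl ij) => (delta_mx ij.1 ij.2, 0, 0)
  | inl (inr ij) => (0, delta_mx ij.1 ij.2, 0)
  | inr _ => (0, 0, 1)
  end.

Definition cof (R : realType) (F : 'M[R]_3) : 'M[R]_3 :=
  \matrix_(i, j) cofactor F i j.

Definition Phi (R : realType) (F : 'M[R]_3) : xi_space R := (F, cof F, \det F).

(* \partial Phi^B / \partial F_{i alpha} *)
Definition dPhi (R : realType) (B : Bidx) (i al : 'I_3) (F : 'M[R]_3) : R :=
  'D_(delta_mx i al) (fun G : 'M[R]_3 => comp (Phi G) B) F.

(* Euclidean norms; the library norm on matrices is the maximum norm. *)
Definition mxnorm2 (R : realType) (m n : nat) (A : 'M[R]_(m, n)) : R :=
  Num.sqrt (\sum_i \sum_j A i j ^+ 2).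

(** * Functions of class C^n *)

(* f is n times continuously differentiable on the open set D, where the vectors
   e i form a basis of the finite-dimensional space V. *)
Fixpoint Cn (R : realType) (V : normedModType R) (I : Type) (e : I -> V)
    (D : set V) (n : nat) (f : V -> R) {struct n} : Prop :=
  (forall z, D z -> {for z, continuous f}) /\
  match n with
  | 0%N => True
  | m.+1 => forall i, (forall z, D z -> derivable f z (e i)) /\
                      Cn e D m (fun z => 'D_(e i) f z)
  end.

(** * Constitutive functions *)

(* Functions of (xi, theta) or (F, theta) are total in Rocq; only their values
   at theta > 0 are ever constrained or used. *)

Definition xt_dir (R : realType) (o : option Bidx) : xi_space R * R :=
  if o is Some B then (basis R B, 0) else (0, 1).

Definition psi_xi (R : realType) (psi : xi_space R * R -> R) (B : Bidx)
  (z : xi_space R * R) : R := 'D_(xt_dir R (Some B)) psi z.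

Definition psi_theta (R : realType) (psi : xi_space R * R -> R)
  (z : xi_space R * R) : R := 'D_(xt_dir R None) psi z.

Definition eta (R : realType) (psi : xi_space R * R -> R)
  (z : xi_space R * R) : R := - psi_theta psi z.

Definition energy (R : realType) (psi : xi_space R * R -> R)
  (z : xi_space R * R) : R := psi z - z.2 * psi_theta psi z.

Definition is_C3 (R : realType) (psi : xi_space R * R -> R) : Prop :=
  Cn (@xt_dir R) [set z | 0 < z.2] 3 psi.

Definition hessian_xi_pos (R : realType) (psi : xi_space R * R -> R) : Prop :=
  forall (xi : xi_space R) (theta : R), 0 < theta ->
  forall h : xi_space R, h != 0 ->
    0 < \sum_(B : Bidx) \sum_(B' : Bidx)
          psi_xi (psi_xi psi B) B' (xi, theta) * comp h B * comp h B'.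

Definition eta_theta_pos (R : realType) (psi : xi_space R * R -> R) : Prop :=
  forall (xi : xi_space R) (theta : R), 0 < theta ->
    0 < 'D_(xt_dir R None) (eta psi) (xi, theta).

(** * Growth conditions *)

(* |xi|_{p,q,r} + theta^l *)
Definition growth (R : realType) (p q r l : R) (z : xi_space R * R) : R :=
  mxnorm2 z.1.1.1 `^ p + mxnorm2 z.1.1.2 `^ q + `|z.1.2| `^ r + z.2 `^ l.

(* f(xi, theta) -> 0 as |xi|_{p,q,r} + theta^l -> oo, theta > 0 *)
Definition vanishes_at_infty (R : realType) (p q r l : R)
    (f : xi_space R * R -> R) : Prop :=
  forall eps : R, 0 < eps -> exists K : R,
    forall z, 0 < z.2 -> K < growth p q r l z -> `|f z| < eps.

Definition psi_F_mx (R : realType) (psi : xi_space R * R -> R)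
  (z : xi_space R * R) : 'M[R]_3 := \matrix_(i, j) psi_xi psi (inl (inl (i, j))) z.

Definition psi_zeta_mx (R : realType) (psi : xi_space R * R -> R)
  (z : xi_space R * R) : 'M[R]_3 := \matrix_(i, j) psi_xi psi (inl (inr (i, j))) z.

Definition psi_w (R : realType) (psi : xi_space R * R -> R)
  (z : xi_space R * R) : R := psi_xi psi (inr tt) z.

Definition G1 (R : realType) (c p q r l : R) (psi : xi_space R * R -> R) : Prop :=
  forall z, 0 < z.2 ->
    c * growth p q r l z - c <= energy psi z <= c * growth p q r l z + c.

Definition G2 (R : realType) (p q r l : R) (psi : xi_space R * R -> R) : Prop :=
  vanishes_at_infty p q r l (fun z =>
    (mxnorm2 (psi_F_mx psi z) + mxnorm2 (psi_zeta_mx psi z) `^ (p / (p - 1))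
     + `|psi_w psi z| `^ (p / (p - 2))) / growth p q r l z).

Definition G3 (R : realType) (p q r l : R) (psi : xi_space R * R -> R) : Prop :=
  vanishes_at_infty p q r l (fun z => `|psi_theta psi z| / growth p q r l z).

(** * States and relative entropy *)

Record state (R : realType) : Type :=
  State { xi : xi_space R; vel : 'rV[R]_3; temp : R }.

Definition defgrad (R : realType) (U : state R) : 'M[R]_3 := (xi U).1.1.

Definition xt (R : realType) (U : state R) : xi_space R * R := (xi U, temp U).

Definition Ft (R : realType) (U : state R) : 'M[R]_3 * R := (defgrad U, temp U).

Definition Gamma (R : realType) (M delta : R) : set (state R) :=
  [set U | [/\ mxnorm2 (xi U).1.1 <= M, mxnorm2 (xi U).1.2 <= M,
               `|(xi U).2| <= M, mxnorm2 (vel U) <= M &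
               0 < delta /\ delta <= temp U <= M]].

(* psi(xi, theta | xibar, thetabar) *)
Definition rel_psi (R : realType) (psi : xi_space R * R -> R)
    (z zb : xi_space R * R) : R :=
  psi z - psi zb - \sum_(B : Bidx) psi_xi psi B zb * (comp z.1 B - comp zb.1 B)
  + eta psi zb * (z.2 - zb.2).

(* I(U | Ubar) *)
Definition rel_entropy (R : realType) (psi : xi_space R * R -> R)
    (U Ub : state R) : R :=
  rel_psi psi (xt U) (xt Ub) + 2^-1 * mxnorm2 (vel U - vel Ub) ^+ 2
  + (eta psi (xt U) - eta psi (xt Ub)) * (temp U - temp Ub).

(** * Space-time and the torus *)

(* Fields on T^3 x [0, T) are functions of (x, t) in R^3 x R, 1-periodic in each
   coordinate of x, of which only the values at t in the relevant time interval
   are ever constrained or used. *)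
Notation spacetime R := ('rV[R]_3 * R)%type.

Definition st_dir (R : realType) (o : option 'I_3) : spacetime R :=
  if o is Some al then (delta_mx 0 al, 0) else (0, 1).

Definition d_x (R : realType) (al : 'I_3) (f : spacetime R -> R)
  (z : spacetime R) : R := 'D_(st_dir R (Some al)) f z.

Definition d_t (R : realType) (f : spacetime R -> R) (z : spacetime R) : R :=
  'D_(st_dir R None) f z.

(* |nabla v|^2 and |nabla theta|^2 *)
Definition grad_vel_sq (R : realType) (U : spacetime R -> state R)
    (z : spacetime R) : R :=
  \sum_(i < 3) \sum_(al < 3) d_x al (fun y => vel (U y) 0 i) z ^+ 2.

Definition grad_temp_sq (R : realType) (U : spacetime R -> state R)
    (z : spacetime R) : R :=
  \sum_(al < 3) d_x al (fun y => temp (U y)) z ^+ 2.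

Definition vec3 (R : realType) (y : R * R * R) : 'rV[R]_3 :=
  \row_i [:: y.1.1; y.1.2; y.2]`_i.

(* The integral over T^3 of a 1-periodic function, as a Lebesgue integral over
   the fundamental cell [0, 1]^3. *)
Definition torus_int (R : realType) (f : 'rV[R]_3 -> R) : \bar R :=
  (\int[(lebesgue_measure \x lebesgue_measure) \x lebesgue_measure]_(y in
      (`[0%R, 1%R] `*` `[0%R, 1%R]) `*` `[0%R, 1%R]) (f (vec3 y))%:E)%E.

Definition periodic_on (R : realType) (D : set (spacetime R))
    (U : spacetime R -> state R) : Prop :=
  forall x t (al : 'I_3), D (x, t) -> U (x + delta_mx 0 al, t) = U (x, t).

Definition componentwise (R : realType) (P : (spacetime R -> R) -> Prop)
    (U : spacetime R -> state R) : Prop :=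
  [/\ forall B, P (fun z => comp (xi (U z)) B),
      forall i, P (fun z => vel (U z) 0 i) &
      P (fun z => temp (U z))].

(* The maximal time Ts may be infinite. *)
Definition open_cyl (R : realType) (Ts : \bar R) : set (spacetime R) :=
  [set z | 0 < z.2 /\ (z.2%:E < Ts)%E].
Definition init_cyl (R : realType) (Ts : \bar R) : set (spacetime R) :=
  [set z | 0 <= z.2 /\ (z.2%:E < Ts)%E].
Definition closed_cyl (R : realType) (T : R) : set (spacetime R) :=
  [set z | 0 <= z.2 <= T].

Definition C1_open (R : realType) (Ts : \bar R) (f : spacetime R -> R) : Prop :=
  Cn (@st_dir R) (open_cyl Ts) 1 f.

(* f is C^1 on T^3 x (0, T), and f and its first partial derivatives extend
   continuously to T^3 x [0, T]. *)
Definition C1_closed (R : realType) (T : R) (f : spacetime R -> R) : Prop :=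
  [/\ {within closed_cyl T, continuous f}, C1_open T%:E f &
      forall o, exists g : spacetime R -> R,
        {within closed_cyl T, continuous g} /\
        forall z, open_cyl T%:E z -> g z = 'D_(st_dir R o) f z].

Definition C1_in_x (R : realType) (Ts : \bar R) (f : spacetime R -> R) : Prop :=
  forall al : 'I_3,
    forall z, open_cyl Ts z ->
      derivable f z (st_dir R (Some al)) /\ {for z, continuous (d_x al f)}.

(** * The systems *)

(* (\partial psi / \partial xi^B)(xi, theta) (\partial Phi^B / \partial F_{i alpha})(F) *)
Definition stress (R : realType) (psi : xi_space R * R -> R) (i al : 'I_3)
    (U : state R) : R :=
  \sum_(B : Bidx) psi_xi psi B (xt U) * dPhi B i al (defgrad U).

Definition total_energy (R : realType) (psi : xi_space R * R -> R)
    (U : state R) : R :=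
  2^-1 * mxnorm2 (vel U) ^+ 2 + energy psi (xt U).

Definition visc_flux (R : realType) (mu : 'M[R]_3 * R -> R) (i al : 'I_3)
    (U : spacetime R -> state R) (z : spacetime R) : R :=
  mu (Ft (U z)) * d_x al (fun y => vel (U y) 0 i) z.

Definition heat_flux (R : realType) (k : 'M[R]_3 * R -> R) (al : 'I_3)
    (U : spacetime R -> state R) (z : spacetime R) : R :=
  k (Ft (U z)) * d_x al (fun y => temp (U y)) z.

Definition viscous_system (R : realType) (psi : xi_space R * R -> R)
    (mu k : 'M[R]_3 * R -> R) (U : spacetime R -> state R)
    (z : spacetime R) : Prop :=
  [/\ forall B : Bidx,
        d_t (fun y => comp (xi (U y)) B) z
        - \sum_(al < 3) d_x al (fun y =>
            \sum_(i < 3) dPhi B i al (defgrad (U y)) * vel (U y) 0 i) z = 0,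
      forall i : 'I_3,
        d_t (fun y => vel (U y) 0 i) z
        - \sum_(al < 3) d_x al (fun y => stress psi i al (U y)) z
        = \sum_(al < 3) d_x al (visc_flux mu i al U) z,
      d_t (fun y => total_energy psi (U y)) z
        - \sum_(al < 3) d_x al (fun y =>
            \sum_(i < 3) stress psi i al (U y) * vel (U y) 0 i) z
        = \sum_(al < 3) d_x al (fun y =>
            \sum_(i < 3) vel (U y) 0 i * visc_flux mu i al U y) z
          + \sum_(al < 3) d_x al (heat_flux k al U) z &
      forall i al be : 'I_3,
        d_x al (fun y => defgrad (U y) i be) z
        - d_x be (fun y => defgrad (U y) i al) z = 0].

Definition adiabatic_system (R : realType) (psi : xi_space R * R -> R)
    (U : spacetime R -> state R) (z : spacetime R) : Prop :=
  [/\ forall B : Bidx,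
        d_t (fun y => comp (xi (U y)) B) z
        - \sum_(al < 3) d_x al (fun y =>
            \sum_(i < 3) dPhi B i al (defgrad (U y)) * vel (U y) 0 i) z = 0,
      forall i : 'I_3,
        d_t (fun y => vel (U y) 0 i) z
        - \sum_(al < 3) d_x al (fun y => stress psi i al (U y)) z = 0,
      d_t (fun y => total_energy psi (U y)) z
        - \sum_(al < 3) d_x al (fun y =>
            \sum_(i < 3) stress psi i al (U y) * vel (U y) 0 i) z = 0 &
      forall i al be : 'I_3,
        d_x al (fun y => defgrad (U y) i be) z
        - d_x be (fun y => defgrad (U y) i al) z = 0].

(* Strong solution on T^3 x [0, Ts) with data U0: attained continuously at
   t = 0, and regular enough for t > 0 that every derivative in the system is a
   continuous classical derivative. *)
Definition strong_solution (R : realType) (psi : xi_space R * R -> R)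
    (mu k : 'M[R]_3 * R -> R) (Ts : \bar R) (U0 : 'rV[R]_3 -> state R)
    (U : spacetime R -> state R) : Prop :=
  [/\ periodic_on (init_cyl Ts) U
      /\ (forall z, init_cyl Ts z -> 0 < temp (U z)),
      forall x, U (x, 0) = U0 x,
      componentwise (fun f => {within init_cyl Ts, continuous f}) U
      /\ componentwise (C1_open Ts) U,
      (forall i al, C1_in_x Ts (visc_flux mu i al U))
      /\ (forall al, C1_in_x Ts (heat_flux k al U)) &
      forall z, open_cyl Ts z -> viscous_system psi mu k U z].

(* U cannot be continued as a strong solution beyond Ts. *)
Definition maximal_domain (R : realType) (psi : xi_space R * R -> R)
    (mu k : 'M[R]_3 * R -> R) (Ts : \bar R) (U0 : 'rV[R]_3 -> state R)
    (U : spacetime R -> state R) : Prop :=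
  forall (Ts' : \bar R) (V : spacetime R -> state R), (Ts < Ts')%E ->
    strong_solution psi mu k Ts' U0 V ->
    ~ (forall z, init_cyl Ts z -> V z = U z).

Definition entropy_production (R : realType) (psi : xi_space R * R -> R)
    (mu k : 'M[R]_3 * R -> R) (Ts : \bar R)
    (U : spacetime R -> state R) : Prop :=
  forall z, open_cyl Ts z ->
    d_t (fun y => eta psi (xt (U y))) z
    - \sum_(al < 3) d_x al (fun y => heat_flux k al U y / temp (U y)) z
    = k (Ft (U z)) * grad_temp_sq U z / temp (U z) ^+ 2
      + mu (Ft (U z)) * grad_vel_sq U z / temp (U z).

(* Smooth solution on T^3 x [0, T] with data U0. *)
Definition smooth_adiabatic_solution (R : realType) (psi : xi_space R * R -> R)
    (T : R) (U0 : 'rV[R]_3 -> state R) (U : spacetime R -> state R) : Prop :=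
  [/\ periodic_on (closed_cyl T) U
      /\ (forall z, closed_cyl T z -> 0 < temp (U z)),
      forall x, U (x, 0) = U0 x,
      componentwise (C1_closed T) U,
      forall z, open_cyl T%:E z -> adiabatic_system psi U z &
      forall z, open_cyl T%:E z -> d_t (fun y => eta psi (xt (U y))) z = 0].

(* Admissible viscosity or conductivity: continuous and positive for
   theta > 0. *)
Definition transport_coef (R : realType) (mu : 'M[R]_3 * R -> R) : Prop :=
  forall z, 0 < z.2 -> {for z, continuous mu} /\ 0 < mu z.

(* Integral over T^3 of I(U(t) | Ubar(t)). *)
Definition rel_entropy_int (R : realType) (psi : xi_space R * R -> R)
    (U Ub : 'rV[R]_3 -> state R) : \bar R :=
  torus_int (fun x => rel_entropy psi (U x) (Ub x)).

(* Space-time integral of mu theta |nabla vbar|^2 / thetabar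
   + k |nabla thetabar|^2 / thetabar over T^3 x [0, T]. *)
Definition dissipation_int (R : realType) (mu k : 'M[R]_3 * R -> R) (T : R)
    (U Ub : spacetime R -> state R) : \bar R :=
  (\int[lebesgue_measure]_(s in `[0%R, T])
     torus_int (fun x =>
       (mu (Ft (U (x, s))) * temp (U (x, s)) * grad_vel_sq Ub (x, s)
          / temp (Ub (x, s))
        + k (Ft (U (x, s))) * grad_temp_sq Ub (x, s)
          / temp (Ub (x, s)))%R))%E.

(* Main.v *)
(** The relative entropy [I(U | Ubar)] is the entropy-energy balance of [U] with its
    affine part at [Ubar] removed.  Pointwise, [d_t I - div G = Q]: the null Lagrangian
    identity [sum_al d_al (dPhi^B / dF_(i al)) = 0] and [d_t eta(Ubar) = 0] cancel every
    term of [Q] that is linear in [U - Ubar].  What is left are products of two differences,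
    weighted by derivatives of [Ubar] and bounded by [C I], and diffusive terms, which
    Young's inequality bounds by [mu theta |grad vbar|^2 / thetabar
    + k |grad thetabar|^2 / thetabar].

    The bounds by [C I] are uniform in [U], with three regimes.  Where the growth function
    is large they follow from (G1)-(G3), since [I] is then comparable with the energy.
    On compact sets with [theta] bounded below they follow from Taylor expansion and from
    the convexity of [psi] in [xi] and its concavity in [theta].  For bounded [xi] and small
    [theta], where [psi_theta] may blow up, [psi], [psi_xi] and [e] stay bounded and [I] is
    bounded below by a positive constant, so that only [eta] has to be compared with [I], of
    which [- thetabar eta] is a part.

    Gronwall's inequality gives the first claim.  For the second, the dissipation is at most
    [C (mu_0 + k_0) (1 + I)] because [|e| <= C (1 + I)], so it is absorbed by the supremum
    of [I] when [mu_0 + k_0] is small. *)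

Require Import Defs.
From HB Require Import structures.
From mathcomp Require Import all_boot all_order all_algebra.
From mathcomp Require Import all_classical all_reals all_analysis.
From mathcomp Require Import ring lra measurable_realfun.
(* The library shadows some names of Defs, such as [comp]. *)
Import Defs.

Set Implicit Arguments.
Unset Strict Implicit.
Unset Printing Implicit Defensive.

Import Order.TTheory GRing.Theory Num.Theory.
Import numFieldNormedType.Exports.

Local Open Scope classical_set_scope.
Local Open Scope ring_scope.

(** * Partial derivatives *)

(** The degrees of the minors shape the estimates. The derivative of [Phi^B] has degree 0, 1 or 2 in
    [F]: Young's inequality controls its products with the stresses exactly with the exponents of
    (G2), and its square has degree at most four, whence [4 <= p]. As [psi] is convex in [xi] but
    concave in [theta], no joint convexity is available; the relative potential is split at the
    intermediate state [(xi, thetabar)] into a remainder in [theta] alone and a remainder in [xi]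
    alone, each with a sign. Smoothness is given by partial derivatives only, so the chain rule and
    the symmetry of second derivatives are derived from the continuity of the partials. The
    equations hold for [0 < t < T], while data and claims concern the closed interval: Gronwall's
    inequality is proved inside and extended by continuity. All constants come from [psi], [T], [M],
    [delta] and [Ub] before any viscous solution is introduced, so they serve every [mu] and [k]. *)

Lemma is_derive_line (R : realType) (V : normedModType R) (f : V -> R)
    (w v : V) (s : R) :
  derivable f (w + s *: v) v ->
  is_derive s 1 (fun h => f (w + h *: v)) ('D_v f (w + s *: v)).
Proof.
have E : (fun h => h^-1 *: (((fun h => f (w + h *: v)) \o shift s) (h *: 1)
             - f (w + s *: v)))
    = (fun h => h^-1 *: ((f \o shift (w + s *: v)) (h *: v) - f (w + s *: v))).
  apply/funext => h /=; congr (_ *: (f _ - _)).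
  by rewrite [h *: 1]mulr1 scalerDl addrCA.
move=> df; apply: DeriveDef; first by rewrite /derivable E.
by rewrite /derive E.
Qed.

Lemma MVT_line (R : realType) (V : normedModType R) (f : V -> R)
    (w v : V) (c : R) :
  (forall s, `|s| <= `|c| -> derivable f (w + s *: v) v) ->
  exists2 s, `|s| <= `|c| & f (w + c *: v) - f w = c * 'D_v f (w + s *: v).
Proof.
move=> df; have [c0|c0] := leP 0 c.
  have dg x : x \in `[0, c] -> is_derive x 1 (fun h => f (w + h *: v))
      ('D_v f (w + x *: v)).
    rewrite in_itv/= => /andP[x0 xc]; apply/is_derive_line/df.
    by rewrite !ger0_norm.
  have [|s] := @MVT_segment R (fun h => f (w + h *: v))
    (fun s => 'D_v f (w + s *: v)) 0 c c0 (fun x xc => dg x (subset_itv_oo_cc xc)).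
    by apply: derivable_within_continuous => x /dg[].
  rewrite in_itv/= scale0r addr0 subr0 => /andP[s0 sc] ->.
  by exists s; rewrite ?ger0_norm// mulrC.
have dg x : x \in `[c, 0] -> is_derive x 1 (fun h => f (w + h *: v))
    ('D_v f (w + x *: v)).
  rewrite in_itv/= => /andP[x0 xc]; apply/is_derive_line/df.
  by rewrite ler0_norm// ltr0_norm// lerN2.
have [|s] := @MVT_segment R (fun h => f (w + h *: v))
  (fun s => 'D_v f (w + s *: v)) c 0 (ltW c0) (fun x xc => dg x (subset_itv_oo_cc xc)).
  by apply: derivable_within_continuous => x /dg[].
rewrite in_itv/= scale0r addr0 sub0r => /andP[s0 sc] H.
exists s; first by rewrite ler0_norm// ltr0_norm// lerN2.
by rewrite -[LHS]opprB H; ring.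
Qed.

(** The increment is made one direction at a time, each step costing one application of the mean
    value theorem. The list [s] carries the induction, and the weighted sum below [rho] keeps every
    intermediate point in the ball where the partials vary by at most [eps]. *)
Lemma increment_partials (R : realType) (V : normedModType R) (I : finType)
    (e : I -> V) (f : V -> R) (z0 : V) (eps : R) :
  0 < eps ->
  (\forall z \near z0, forall i, derivable f z (e i)) ->
  (forall i, {for z0, continuous ('D_(e i) f)}) ->
  exists2 rho, 0 < rho & forall (c : I -> R) (s : seq I),
    \sum_(i <- s) `|c i| * `|e i| < rho ->
    `|f (z0 + \sum_(i <- s) c i *: e i) - f z0
      - \sum_(i <- s) c i * 'D_(e i) f z0| <= eps * \sum_(i <- s) `|c i|.
Proof.
move=> eps0 df cf.
have : \forall z \near z0, forall i, derivable f z (e i) /\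
    `|'D_(e i) f z - 'D_(e i) f z0| <= eps.
  have : \forall z \near z0, forall i, `|'D_(e i) f z - 'D_(e i) f z0| <= eps.
    apply: filter_forall => i.
    have /cvgrPdist_le/(_ _ eps0) := cf i.
    by apply: filterS => z; rewrite distrC.
  by apply: filterS2 df => z dfz H i; split.
move=> /nbhs_ballP[rho /= rho0 Hb]; exists rho => // c.
elim=> [|i s IH] Hs.
  by rewrite !big_nil addr0 subrr subr0 normr0 mulr0.
move: Hs; rewrite !big_cons => Hs.
have {}IH := IH (le_lt_trans (ler_wpDl (mulr_ge0 (normr_ge0 _) (normr_ge0 _))
  (lexx _)) Hs).
set w := z0 + \sum_(j <- s) c j *: e j.
have Hw t : `|t| <= `|c i| -> ball z0 rho (w + t *: e i).
  move=> tc; rewrite -ball_normE /ball_/= /w -addrA opprD addNKr normrN.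
  apply: le_lt_trans Hs; rewrite (le_trans (ler_normD _ _))// addrC lerD//.
    by rewrite normrZ ler_wpM2r.
  rewrite (le_trans (ler_norm_sum _ _ _))//.
  by apply: ler_sum => j _; rewrite normrZ.
have [t tc Ht] := @MVT_line R V f w (e i) (c i)
  (fun t tc => (Hb _ (Hw t tc) i).1).
rewrite [c i *: _ + _]addrC addrA -/w.
have -> : f (w + c i *: e i) - f z0 -
    (c i * 'D_(e i) f z0 + \sum_(j <- s) c j * 'D_(e j) f z0) =
    c i * ('D_(e i) f (w + t *: e i) - 'D_(e i) f z0) +
    (f w - f z0 - \sum_(j <- s) c j * 'D_(e j) f z0).
  by rewrite mulrBr -Ht; ring.
rewrite (le_trans (ler_normD _ _))// [eps * _]mulrDr lerD//.
rewrite normrM mulrC ler_wpM2r//; exact: (Hb _ (Hw t tc) i).2.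
Unshelve. all: by end_near. Qed.

Lemma cvg_bigsum (R : realType) (V : normedModType R) (T : Type)
    (F : set_system T) (FF : Filter F) (I : Type) (r : seq I)
    (f : I -> T -> V) (l : I -> V) :
  (forall i, f i x @[x --> F] --> l i) ->
  \sum_(i <- r) f i x @[x --> F] --> \sum_(i <- r) l i.
Proof.
move=> H; elim: r => [|i r IH].
  rewrite big_nil (_ : (fun x => _) = cst 0); first exact: cvg_cst.
  by apply/funext => x; rewrite big_nil.
rewrite big_cons (_ : (fun x => _) = (fun x => f i x + \sum_(j <- r) f j x)).
  exact: cvgD.
by apply/funext => x; rewrite big_cons.
Qed.

(** The first-order expansion of [f] is applied to the coordinate increments [h * q i h], where
    [q i] is the difference quotient of [c i]. Coordinates enter only through the expansion of [g]
    in the vectors [e i]. *)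
Lemma is_derive_chain (R : realType) (W V : normedModType R) (I : finType)
    (e : I -> V) (f : V -> R) (g : W -> V) (c : I -> W -> R) (x v : W)
    (dc : I -> R) :
  (forall y, g y = \sum_i c i y *: e i) ->
  (\forall z \near g x, forall i, derivable f z (e i)) ->
  (forall i, {for g x, continuous ('D_(e i) f)}) ->
  (forall i, is_derive x v (c i) (dc i)) ->
  is_derive x v (f \o g) (\sum_i dc i * 'D_(e i) f (g x)).
Proof.
move=> gE df cf dcP.
pose q i h := h^-1 * (c i (h *: v + x) - c i x).
have qc i : q i h @[h --> 0^'] --> dc i.
  have [+ <-] := dcP i; exact.
suff H : h^-1 *: (((f \o g) \o shift x) (h *: v) - (f \o g) x) @[h --> 0^']
    --> \sum_i dc i * 'D_(e i) f (g x).
  by apply: DeriveDef; [apply/cvg_ex; eexists; exact: H|exact/cvg_lim].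
apply/cvgrPdist_le => eps eps0.
(* [B] exceeds the limit of the sum of the [|q i h|], hence bounds that sum for small [h]; with the
   tolerance [eps / 2 / B] the remainder divided by [h] is at most [eps / 2]. *)
pose B := \sum_i (`|dc i| + 1) + 1.
have B0 : 0 < B.
  by rewrite /B ltr_wpDl// sumr_ge0// => i _; rewrite addr_ge0.
have eB0 : 0 < eps / 2 / B by rewrite !divr_gt0.
have [rho rho0 Hrho] := increment_partials eB0 df cf.
have qD : \sum_i q i h * 'D_(e i) f (g x) @[h --> 0^'] -->
    \sum_i dc i * 'D_(e i) f (g x).
  by apply: cvg_bigsum => i; apply: cvgM; [exact: qc|exact: cvg_cst].
have {}qD := (cvgrPdist_le _ _).1 qD (eps / 2) (divr_gt0 eps0 (ltr0Sn _ 1)).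
have qB : \sum_i `|q i h| @[h --> 0^'] --> \sum_i `|dc i|.
  by apply: cvg_bigsum => i; apply: cvg_norm; exact: qc.
have hq : \sum_i `|h * q i h| * `|e i| @[h --> (0:R)^'] -->
    \sum_(i : I) `|0 * dc i| * `|e i|.
  apply: cvg_bigsum => i; apply: cvgM; last exact: cvg_cst.
  apply: cvg_norm; apply: cvgM; last exact: qc.
  exact: cvg_within.
near=> h.
have h0 : h != 0 by near: h; exact: nbhs_dnbhs_neq.
have ch i : c i (h *: v + x) = c i x + h * q i h.
  by rewrite /q mulrA mulfV// mul1r addrCA subrr addr0.
have gh : g (h *: v + x) = g x + \sum_i (h * q i h) *: e i.
  by rewrite !gE -big_split/=; apply: eq_bigr => i _; rewrite ch scalerDl.
have Hr : \sum_i `|h * q i h| * `|e i| < rho.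
  near: h; apply: (cvgr_lt _ hq).
  by rewrite big1// => i _; rewrite mul0r normr0 mul0r.
have {Hrho} := Hrho (fun i => h * q i h) _ Hr.
rewrite -gh => Hrho.
have qBh : \sum_i `|q i h| <= B.
  near: h; apply: (cvgr_le _ qB); rewrite /B big_split/= -addrA ltrDl.
  by rewrite ltr_wpDl// sumr_ge0.
have qDh : `|\sum_i dc i * 'D_(e i) f (g x) -
    \sum_i q i h * 'D_(e i) f (g x)| <= eps / 2.
  by near: h; exact: qD.
rewrite /=.
rewrite (_ : _ - _ = (\sum_i dc i * 'D_(e i) f (g x) -
    \sum_i q i h * 'D_(e i) f (g x)) - h^-1 * (f (g (h *: v + x)) - f (g x)
  - \sum_i h * q i h * 'D_(e i) f (g x))); last first.
  have -> : \sum_i h * q i h * 'D_(e i) f (g x) =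
      h * \sum_i q i h * 'D_(e i) f (g x).
    by rewrite mulr_sumr; apply: eq_bigr => i _; rewrite mulrA.
  rewrite [in RHS]mulrBr [h^-1 * (h * _)]mulrA mulVf// mul1r.
  by rewrite /GRing.scale/=; ring.
rewrite (le_trans (ler_normB _ _))// [leRHS](splitr eps) lerD//.
rewrite normrM normfV ler_pdivrMl ?normr_gt0//.
apply: le_trans Hrho _.
under eq_bigr do rewrite normrM.
rewrite -mulr_sumr mulrCA ler_wpM2l// mulrAC ler_pdivrMr// ler_wpM2l//.
by rewrite ltW// divr_gt0.
Unshelve. all: by end_near. Qed.

Lemma continuous_coords (R : realType) (W : topologicalType)
    (V : normedModType R) (I : finType) (e : I -> V) (g : W -> V)
    (c : I -> W -> R) (x : W) :
  (forall y, g y = \sum_i c i y *: e i) ->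
  (forall i, {for x, continuous (c i)}) -> {for x, continuous g}.
Proof.
move=> gE cc; have -> : g = (fun y => \sum_i c i y *: e i) by apply/funext.
by apply: cvg_bigsum => i; apply: cvgZr_tmp; exact: cc.
Qed.

Lemma is_derive_shift_in (R : realType) (V : normedModType R) (f : V -> R)
    (a z v : V) (d : R) :
  is_derive (z + a) v f d -> is_derive z v (fun w => f (w + a)) d.
Proof.
have E : (fun h : R => h^-1 *: (((fun w => f (w + a)) \o shift z) (h *: v)
             - f (z + a)))
    = (fun h => h^-1 *: ((f \o shift (z + a)) (h *: v) - f (z + a))).
  by apply/funext => h /=; rewrite addrA.
by move=> [df <-]; apply: DeriveDef; rewrite ?/derivable ?/derive E.
Qed.

(** Two mean value theorems: in direction [u] for the increment [w |-> f (w + h v) - f w], then in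
    direction [v] for ['D_u f]. *)
Lemma mixed_difference (R : realType) (V : normedModType R) (f : V -> R)
    (z u v : V) (rho h : R) :
  (forall w, ball z rho w ->
     derivable f w u /\ derivable ('D_u f) w v) ->
  `|h| * `|u| + `|h| * `|v| < rho ->
  exists2 w, `|w - z| <= `|h| * `|u| + `|h| * `|v| &
  f (z + h *: u + h *: v) - f (z + h *: u) - (f (z + h *: v) - f z)
    = h * h * 'D_v ('D_u f) w.
Proof.
move=> df hrho.
have nb s t : `|s| <= `|h| -> `|t| <= `|h| ->
    `|(z + s *: u + t *: v) - z| <= `|h| * `|u| + `|h| * `|v|.
  move=> sh th; have -> : z + s *: u + t *: v - z = s *: u + t *: v.
    by rewrite addrAC addrC [z + _]addrC addrK addrC.
  rewrite (le_trans (ler_normD _ _))//.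
  by rewrite !normrZ lerD// ler_wpM2r.
have inb s t : `|s| <= `|h| -> `|t| <= `|h| -> ball z rho (z + s *: u + t *: v).
  move=> sh th; rewrite -ball_normE /ball_/= distrC.
  exact: le_lt_trans (nb _ _ sh th) hrho.
have in0 s : `|s| <= `|h| -> ball z rho (z + s *: u).
  by move=> sh; have := inb s 0 sh; rewrite normr0 scale0r addr0; exact.
have dphi s : `|s| <= `|h| -> is_derive (z + s *: u) u
    (fun w => f (w + h *: v) - f w)
    ('D_u f (z + s *: u + h *: v) - 'D_u f (z + s *: u)).
  move=> sh; apply: is_deriveB.
    by apply: is_derive_shift_in; apply: derivableP; apply: (df _ _).1; exact: inb.
  by apply: derivableP; apply: (df _ _).1; exact: in0.
have [s sh Hs] := @MVT_line R V (fun w => f (w + h *: v) - f w) z u h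
  (fun s sh => ex_derive (is_derive := dphi s sh)).
have [t th Ht] := @MVT_line R V ('D_u f) (z + s *: u) v h
  (fun t th => (df _ (inb s t sh th)).2).
exists (z + s *: u + t *: v); first exact: nb.
rewrite -mulrA -Ht -(@derive_val _ _ _ _ _ _ _ (dphi s sh)) -Hs.
by rewrite addrAC [z + _ + _]addrAC.
Qed.

(** The second difference over a small parallelogram is symmetric in [u] and [v]. It equals [h * h]
    times either mixed derivative, each at some nearby point, and continuity brings both points back
    to [z]. *)
Lemma derive_comm (R : realType) (V : normedModType R) (f : V -> R) (z u v : V) :
  (\forall w \near z, derivable f w u /\ derivable ('D_u f) w v) ->
  (\forall w \near z, derivable f w v /\ derivable ('D_v f) w u) ->
  {for z, continuous ('D_v ('D_u f))} -> {for z, continuous ('D_u ('D_v f))} ->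
  'D_v ('D_u f) z = 'D_u ('D_v f) z.
Proof.
move=> duv dvu cuv cvu; apply/eqP; rewrite -subr_eq0 -normr_le0.
apply/ler_addgt0Pl => eps eps0; rewrite addr0.
have near_mid (a b x : R) : `|a - x| <= eps / 2 -> `|b - x| <= eps / 2 -> `|a - b| <= eps.
  move=> ax bx; rewrite (_ : a - b = (a - x) - (b - x)); last by ring.
  by rewrite (le_trans (ler_normB _ _))// [leRHS](splitr eps) lerD.
have eps2 : 0 < eps / 2 by rewrite divr_gt0.
have /cvgrPdist_le/(_ _ eps2) {}cuv := cuv.
have /cvgrPdist_le/(_ _ eps2) {}cvu := cvu.
have FI A B : nbhs z A -> nbhs z B -> nbhs z (A `&` B) by exact: filterI.
have := FI _ _ (FI _ _ duv dvu) (FI _ _ cuv cvu).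
move=> /nbhs_ballP[rho /= rho0 H].
(* Small enough for the whole parallelogram to stay in the ball; the [+ 1] covers [u = v = 0]. *)
pose h := rho / (`|u| + `|v| + 1).
have B0 : 0 < `|u| + `|v| + 1 by rewrite ltr_wpDl// addr_ge0.
have h0 : 0 < h by rewrite divr_gt0.
have hrho : `|h| * `|u| + `|h| * `|v| < rho.
  rewrite -mulrDr gtr0_norm// /h -mulrA gtr_pMr// mulrC ltr_pdivrMr// mul1r.
  by rewrite ltrDl.
have [w wz Hw] := mixed_difference (fun w Bw => (H w Bw).1.1) hrho.
have [w' w'z Hw'] : exists2 w, `|w - z| <= `|h| * `|u| + `|h| * `|v| &
  f (z + h *: u + h *: v) - f (z + h *: u) - (f (z + h *: v) - f z)
    = h * h * 'D_u ('D_v f) w.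
  have [|w' w'z Hw'] := mixed_difference (fun w Bw => (H w Bw).1.2) (h := h).
    by rewrite addrC.
  exists w'; first by rewrite [leRHS]addrC.
  by rewrite -Hw' [z + _ + _]addrAC; ring.
have {Hw Hw'}E : 'D_v ('D_u f) w = 'D_u ('D_v f) w'.
  apply: (@mulfI _ (h * h)); first by rewrite mulf_neq0 ?gt_eqF.
  exact: etrans (esym Hw) Hw'.
have Bw : ball z rho w.
  by rewrite -ball_normE /ball_/= distrC (le_lt_trans wz).
have Bw' : ball z rho w'.
  by rewrite -ball_normE /ball_/= distrC (le_lt_trans w'z).
have Hw := (H w Bw).2.1; have Hw' := (H w' Bw').2.2.
by apply: near_mid Hw _; rewrite E; exact: Hw'.
Qed.

(** The bound on [g2] is integrated twice through the mean value theorem: it makes [g1] grow at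
    least linearly, and then [k], the difference between [g] and the comparison parabola, has a
    nonnegative derivative. *)
Lemma taylor2_ge (R : realType) (g g1 g2 : R -> R) (m : R) :
  (forall s : R, 0 <= s <= 1 -> is_derive s 1 g (g1 s)) ->
  (forall s : R, 0 <= s <= 1 -> is_derive s 1 g1 (g2 s)) ->
  (forall s, 0 <= s <= 1 -> m <= g2 s) ->
  m / 2 <= g 1 - g 0 - g1 0.
Proof.
move=> d1 d2 m2.
have g1_ge (s : R) : 0 <= s <= 1 -> m * s <= g1 s - g1 0.
  move=> /andP[s0 s1].
  have [||x] := @MVT_segment R g1 g2 0 s s0.
  - by move=> x; rewrite in_itv/= => /andP[x0 xs]; apply: d2; lra.
  - apply: derivable_within_continuous => x; rewrite in_itv/= => /andP[x0 xs].
    by have [|//] := d2 x; lra.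
  - rewrite in_itv/= => /andP[x0 xs] ->; rewrite subr0 ler_wpM2r// m2//; lra.
pose k s := g s - (g1 0 * s + m / 2 * (s * s)).
have dk (s : R) : 0 <= s <= 1 -> is_derive s 1 k (g1 s - (g1 0 + m * s)).
  move=> s01; have := d1 s s01 => dgs.
  apply: is_derive_eq; rewrite /GRing.scale/=; lra.
have [||x] := @MVT_segment R k (fun s => g1 s - (g1 0 + m * s)) 0 1 ler01.
- by move=> x; rewrite in_itv/= => /andP[x0 xs]; apply: dk; lra.
- apply: derivable_within_continuous => x; rewrite in_itv/= => x01.
  by have [|//] := dk x.
- rewrite in_itv/= /k => x01; have := g1_ge x x01; lra.
Qed.

(** * Functions of class C^1 on an open set *)

Lemma Cn1E (R : realType) (V : normedModType R) (I : Type) (e : I -> V)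
    (D : set V) (f : V -> R) :
  Cn e D 1 f -> forall z, D z ->
  {for z, continuous f} /\
  forall i, is_derive z (e i) f ('D_(e i) f z) /\ {for z, continuous ('D_(e i) f)}.
Proof.
move=> [cf df] z Dz; split; first exact: cf.
by move=> i; have [di [c _]] := df i; split; [exact/derivableP/di|exact: c].
Qed.

Section Cn1.
Context (R : realType) (V : normedModType R) (I : Type) (e : I -> V) (D : set V).
Hypothesis oD : open D.
Implicit Types f g : V -> R.

Lemma continuous_near_eq f g z : D z -> (forall y, D y -> f y = g y) ->
  {for z, continuous g} -> {for z, continuous f}.
Proof.
move=> Dz fg cg; rewrite /prop_for/= /continuous_at fg//.
apply: cvg_trans cg; apply: near_eq_cvg.
by have := open_nbhs_nbhs (conj oD Dz); apply: filterS => y /fg ->.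
Qed.

(** The candidates [df] agree with the derivatives on [D] only; since [D] is open, this is agreement
    near each of its points, which is enough to transfer continuity. *)
Lemma Cn1I f (df : I -> V -> R) :
  (forall z, D z -> {for z, continuous f}) ->
  (forall i z, D z -> is_derive z (e i) f (df i z) /\ {for z, continuous (df i)}) ->
  Cn e D 1 f.
Proof.
move=> cf dfP; split=> // i; split=> [z /(dfP i)[[]]//|]; split=> // z Dz.
apply: (continuous_near_eq Dz _ (dfP i z Dz).2) => y /(dfP i)[+ _].
by move=> ?; rewrite derive_val.
Qed.

Lemma Cn1_cst c : Cn e D 1 (cst c).
Proof.
apply: (@Cn1I _ (fun _ _ => 0)) => [z _|i z _]; first exact: cst_continuous.
by split; [exact: is_derive_cst|exact: cst_continuous].
Qed.

Lemma Cn1_add f g : Cn e D 1 f -> Cn e D 1 g -> Cn e D 1 (fun z => f z + g z).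
Proof.
move=> cf cg.
apply: (@Cn1I _ (fun i z => 'D_(e i) f z + 'D_(e i) g z)) => [z Dz|i z Dz];
  have [cfz /(_ _)dfz] := Cn1E cf Dz; have [cgz /(_ _)dgz] := Cn1E cg Dz.
  exact: continuousD.
by split; [apply: is_deriveD; [exact: (dfz i).1|exact: (dgz i).1]
          |apply: continuousD; [exact: (dfz i).2|exact: (dgz i).2]].
Qed.

Lemma Cn1_mul f g : Cn e D 1 f -> Cn e D 1 g -> Cn e D 1 (fun z => f z * g z).
Proof.
move=> cf cg.
apply: (@Cn1I _ (fun i z => f z * 'D_(e i) g z + g z * 'D_(e i) f z)) => [z Dz|i z Dz];
  have [cfz /(_ _)dfz] := Cn1E cf Dz; have [cgz /(_ _)dgz] := Cn1E cg Dz.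
  exact: continuousM.
split; first by apply: is_deriveM; [exact: (dfz i).1|exact: (dgz i).1].
by apply: continuousD; apply: continuousM => //; [exact: (dgz i).2|exact: (dfz i).2].
Qed.

Lemma Cn1_opp f : Cn e D 1 f -> Cn e D 1 (fun z => - f z).
Proof.
move=> cf; have -> : (fun z => - f z) = (fun z => cst (-1) z * f z).
  by apply/funext => z; rewrite mulN1r.
by apply: Cn1_mul; [exact: Cn1_cst|exact: cf].
Qed.

Lemma Cn1_sub f g : Cn e D 1 f -> Cn e D 1 g -> Cn e D 1 (fun z => f z - g z).
Proof. by move=> cf cg; apply: Cn1_add; [exact: cf|exact: Cn1_opp]. Qed.

Lemma Cn1_sum (J : Type) (r : seq J) (f : J -> V -> R) :
  (forall j, Cn e D 1 (f j)) -> Cn e D 1 (fun z => \sum_(j <- r) f j z).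
Proof.
move=> cf; elim: r => [|j r IH].
  have -> : (fun z => \sum_(j <- [::]) f j z) = cst 0.
    by apply/funext => z; rewrite big_nil.
  exact: Cn1_cst.
have -> : (fun z => \sum_(j <- j :: r) f j z)
    = (fun z => f j z + \sum_(j <- r) f j z).
  by apply/funext => z; rewrite big_cons.
exact: Cn1_add.
Qed.

Lemma Cn1_inv f : Cn e D 1 f -> (forall z, D z -> f z != 0) ->
  Cn e D 1 (fun z => (f z)^-1).
Proof.
move=> cf f0.
apply: (@Cn1I _ (fun i z => - (f z ^- 2) * 'D_(e i) f z)) => [z Dz|i z Dz];
  have [cfz /(_ _)dfz] := Cn1E cf Dz.
  by apply: continuousV => //; exact: f0.
have dfi : derivable f z (e i) by have [[]] := dfz i.
split; first by apply: DeriveDef; [apply: derivableV (f0 z Dz) dfi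
                                  |exact: deriveV (f0 z Dz) dfi].
apply: continuousM; last exact: (dfz i).2.
apply: continuousN; apply: continuousV; first by rewrite expf_neq0 ?f0.
by apply: (@continuous_comp _ _ _ f (fun x => x ^+ 2)) => //; exact: exprn_continuous.
Qed.

Lemma Cn1_comp (V' : normedModType R) (J : finType) (e' : J -> V') (D' : set V')
    (f : V' -> R) (g : V -> V') (c : J -> V -> R) :
  open D' -> (forall z, D z -> D' (g z)) ->
  (forall y, g y = \sum_j c j y *: e' j) ->
  (forall j, Cn e D 1 (c j)) -> Cn e' D' 1 f ->
  Cn e D 1 (fun z => f (g z)).
Proof.
move=> oD' gD gE cc cf.
have cg z : D z -> {for z, continuous g}.
  by move=> Dz; apply: (continuous_coords gE) => j; exact: (cc j).1.
apply: (@Cn1I _ (fun i z => \sum_j 'D_(e i) (c j) z * 'D_(e' j) f (g z)))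
    => [z Dz|i z Dz]; have [cfz /(_ _)dfz] := Cn1E cf (gD _ Dz).
  by apply: continuous_comp => //; exact: cg.
split.
  apply: (is_derive_chain gE).
  - have := open_nbhs_nbhs (conj oD' (gD _ Dz)); apply: filterS => y Dy j.
    exact: (cf.2 j).1.
  - by move=> j; exact: (dfz j).2.
  - by move=> j; exact: ((Cn1E (cc j) Dz).2 i).1.
apply: cvg_bigsum => j; apply: cvgM; first exact: ((Cn1E (cc j) Dz).2 i).2.
by apply: (@continuous_comp _ _ _ g ('D_(e' j) f)); [exact: cg|exact: (dfz j).2].
Qed.

End Cn1.

(** * Minors and coordinates of the extended variables *)

(* Row and column indices are added in Z/3Z. *)
Definition minor3 (R : pzRingType) (F : 'M[R]_3) (i j : 'I_3) : R :=
  F (i + 1) (j + 1) * F (i + 2) (j + 2) - F (i + 1) (j + 2) * F (i + 2) (j + 1).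

(** Cyclic indices absorb the sign $(-1)^{i+j}$, so that the nine cofactors share one formula. *)
Lemma cofactor_minor3 (R : comNzRingType) (F : 'M[R]_3) (i j : 'I_3) :
  cofactor F i j = minor3 F i j.
Proof.
pose f (a b : nat) := F (inord a) (inord b).
have fE x y : F x y = f x y by rewrite /f !inord_val.
rewrite /cofactor /minor3 (expand_det_row _ ord0) !big_ord_recr big_ord0 /=.
rewrite /cofactor !det_mx11 !mxE !fE.
by case: i => -[|[|[|//]]] /= ?; case: j => -[|[|[|//]]] /= ?;
  rewrite /bump/= /expn/=; rewrite ?expr0 ?expr1; ring.
Qed.

Lemma is_derive_coord (R : realType) (m n : nat) (F v : 'M[R]_(m, n))
    (i : 'I_m) (j : 'I_n) :
  is_derive F v (fun G : 'M[R]_(m, n) => G i j) (v i j).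
Proof.
suff H : h^-1 *: (((fun G : 'M[R]_(m, n) => G i j) \o shift F) (h *: v) - F i j)
    @[h --> 0^'] --> v i j.
  by apply: DeriveDef; [apply/cvg_ex; eexists; exact: H|exact/cvg_lim].
apply: (cvg_trans _ (@cvg_cst _ (v i j) _ (0:R)^' _)); apply: near_eq_cvg; near=> h.
rewrite /= !mxE addrK /GRing.scale/= mulrA mulVf ?mul1r//.
by near: h; exact: nbhs_dnbhs_neq.
Unshelve. all: by end_near. Qed.

(** The minor is a quadratic form in the matrix; this is its polarization, bilinear and symmetric in
    [F] and [H]. *)
Definition dminor3 (R : pzRingType) (F H : 'M[R]_3) (a b : 'I_3) : R :=
  H (a + 1) (b + 1) * F (a + 2) (b + 2) + F (a + 1) (b + 1) * H (a + 2) (b + 2)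
  - (H (a + 1) (b + 2) * F (a + 2) (b + 1) + F (a + 1) (b + 2) * H (a + 2) (b + 1)).

Lemma is_derive_minor3 (R : realType) (F H : 'M[R]_3) (a b : 'I_3) :
  is_derive F H (fun G => minor3 G a b) (dminor3 F H a b).
Proof.
have d i j := @is_derive_coord R 3 3 F H i j.
have e := is_deriveB (is_deriveM (d (a + 1) (b + 1)) (d (a + 2) (b + 2)))
                     (is_deriveM (d (a + 1) (b + 2)) (d (a + 2) (b + 1))).
by rewrite /minor3; apply: (is_derive_eq e); rewrite /dminor3 /GRing.scale/=; ring.
Qed.

Lemma det3 (R : comNzRingType) (F : 'M[R]_3) (i : 'I_3) :
  \det F = \sum_j F i j * minor3 F i j.
Proof.
by rewrite (expand_det_row _ i); apply: eq_bigr => j _; rewrite cofactor_minor3.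
Qed.

Lemma dPhi_F (R : realType) (a b i al : 'I_3) (F : 'M[R]_3) :
  dPhi (inl (inl (a, b))) i al F = delta_mx i al a b.
Proof. exact: (derive_val (is_derive := is_derive_coord _ _ _ _)). Qed.

Lemma dPhi_zeta (R : realType) (a b i al : 'I_3) (F : 'M[R]_3) :
  dPhi (inl (inr (a, b))) i al F = dminor3 F (delta_mx i al) a b.
Proof.
rewrite /dPhi (_ : (fun G => _) = (fun G => minor3 G a b)).
  exact: (derive_val (is_derive := is_derive_minor3 _ _ _ _)).
by apply/funext => G /=; rewrite mxE cofactor_minor3.
Qed.

(** The determinant is expanded along row [i]. The minors of that row do not involve row [i], so
    only the factor [G i al] contributes. *)
Lemma dPhi_w (R : realType) (i al : 'I_3) (F : 'M[R]_3) :
  dPhi (inr tt) i al F = minor3 F i al.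
Proof.
have i1 : (i + 1 == i) = false by case: i => -[|[|[|//]]].
have i2 : (i + 2 == i) = false by case: (i) => -[|[|[|//]]].
rewrite /dPhi (_ : (fun G => _) = \sum_(j < 3) (fun G : 'M[R]_3 => G i j * minor3 G i j)).
  have d (j : 'I_3) := is_deriveM (@is_derive_coord R 3 3 F (delta_mx i al) i j)
                        (is_derive_minor3 F (delta_mx i al) i j).
  rewrite (derive_val (is_derive := is_derive_sum d)) (bigD1 al)//= big1 ?addr0.
    rewrite /dminor3 !mxE !eqxx i1 i2 /= /GRing.scale/=.
    ring.
  move=> j jal; rewrite /dminor3 !mxE (negPf jal) i1 i2 andbF /= /GRing.scale/=.
  ring.
by apply/funext => G /=; rewrite (det3 _ i) fct_sumE.
Qed.

Lemma dminor3D (R : comPzRingType) (F G H : 'M[R]_3) a b :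
  dminor3 (F - G) H a b = dminor3 F H a b - dminor3 G H a b.
Proof. by rewrite /dminor3 !mxE; ring. Qed.

(** The index [None] stands for the temperature: sums over [option Bidx] run over all twenty
    coordinates. *)
Definition co (R : realType) (o : option Bidx) (z : xi_space R * R) : R :=
  if o is Some B then comp z.1 B else z.2.

Lemma coD (R : realType) o (x y : xi_space R * R) : co o (x + y) = co o x + co o y.
Proof. by case: o => [[[[i j]|[i j]]|[]]|] //=; rewrite mxE. Qed.

Lemma coN (R : realType) o (x : xi_space R * R) : co o (- x) = - co o x.
Proof. by case: o => [[[[i j]|[i j]]|[]]|] //=; rewrite mxE. Qed.

Lemma coB (R : realType) o (x y : xi_space R * R) : co o (x - y) = co o x - co o y.
Proof. by rewrite coD coN. Qed.

Lemma coZ (R : realType) o a (x : xi_space R * R) : co o (a *: x) = a * co o x.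
Proof. by case: o => [[[[i j]|[i j]]|[]]|] //=; rewrite mxE. Qed.

Lemma co0 (R : realType) o : co o (0 : xi_space R * R) = 0.
Proof. by case: o => [[[[i j]|[i j]]|[]]|] //=; rewrite mxE. Qed.

Lemma co_sum (R : realType) o (J : Type) (r : seq J) (f : J -> xi_space R * R) :
  co o (\sum_(j <- r) f j) = \sum_(j <- r) co o (f j).
Proof. by apply: (big_morph (co o)); [exact: coD|exact: co0]. Qed.

Lemma co_dir (R : realType) o o' : co o (xt_dir R o') = (o == o')%:R.
Proof.
case: o o' => [[[[i j]|[i j]]|[]]|] [[[[i' j']|[i' j']]|[]]|] //=; by rewrite mxE.
Qed.

Lemma co_inj (R : realType) (x y : xi_space R * R) : (forall o, co o x = co o y) -> x = y.
Proof.
move: x y => [[[F1 Z1] w1] t1] [[[F2 Z2] w2] t2] H.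
have -> : F1 = F2 by apply/matrixP => i j; exact: (H (Some (inl (inl (i, j))))).
have -> : Z1 = Z2 by apply/matrixP => i j; exact: (H (Some (inl (inr (i, j))))).
have /= -> := H (Some (inr tt)).
by have /= -> := H None.
Qed.

Lemma co_span (R : realType) (c : option Bidx -> R) o :
  co o (\sum_o' c o' *: xt_dir R o') = c o.
Proof.
rewrite co_sum (bigD1 o)//= coZ co_dir eqxx mulr1 big1 ?addr0// => o' oo'.
by rewrite coZ co_dir eq_sym (negPf oo') mulr0.
Qed.

Lemma xt_decomp (R : realType) (z : xi_space R * R) : z = \sum_o co o z *: xt_dir R o.
Proof. by apply: co_inj => o; rewrite co_span. Qed.

Lemma sum_option (R : nmodType) (T : finType) (F : option T -> R) :
  \sum_o F o = F None + \sum_t F (Some t).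
Proof.
rewrite (bigD1 None)//=; congr (_ + _).
rewrite (reindex_omap Some id) /=; last by case.
by apply: eq_bigl => t; rewrite eqxx.
Qed.

Lemma continuous_co (R : realType) o : continuous (@co R o).
Proof.
have cF (T : topologicalType) (f : T -> 'M[R]_3) i j z :
    {for z, continuous f} -> {for z, continuous (fun z => f z i j)}.
  move=> cf; apply: (@continuous_comp _ _ _ f (fun M => M i j)) => //.
  exact: coord_continuous.
case: o => [[[[i j]|[i j]]|[]]|] z; rewrite /co/=.
- apply: (cF _ (fun z : xi_space R * R => z.1.1.1)).
  apply: (@continuous_comp _ _ _ (fun z : xi_space R * R => z.1.1) fst); last exact: cvg_fst.
  apply: (@continuous_comp _ _ _ (fun z : xi_space R * R => z.1) fst); exact: cvg_fst.
- apply: (cF _ (fun z : xi_space R * R => z.1.1.2)).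
  apply: (@continuous_comp _ _ _ (fun z : xi_space R * R => z.1.1) snd); last exact: cvg_snd.
  apply: (@continuous_comp _ _ _ (fun z : xi_space R * R => z.1) fst); exact: cvg_fst.
- apply: (@continuous_comp _ _ _ (fun z : xi_space R * R => z.1) snd);
    [exact: cvg_fst|exact: cvg_snd].
- exact: cvg_snd.
Qed.

(** * Compact boxes of states *)

Definition pos_temp (R : realType) : set (xi_space R * R) := [set z | 0 < z.2].

Lemma open_pos_temp (R : realType) : open (@pos_temp R).
Proof.
apply: (@open_comp _ _ (@co R None) [set x | 0 < x]); last exact: open_gt.
by move=> z _; exact: continuous_co.
Qed.

(** The set is the continuous image of a finite product of compact sets of reals. *)
Lemma span_compact (R : realType) (V : normedModType R) (I : finType) (e : I -> V)
    (A : I -> set R) : (forall i, compact (A i)) ->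
  compact [set z | exists2 c, (forall i, A i (c i)) & z = \sum_i c i *: e i].
Proof.
move=> cA.
pose g (v : 'rV[R]_#|I|) := \sum_i v 0 (enum_rank i) *: e i.
rewrite (_ : mkset _ = [set g v | v in [set v : 'rV[R]_#|I| |
    forall j, A (enum_val j) (v ord0 j)]]).
  apply: continuous_compact.
    apply: continuous_subspaceT => v; apply: continuous_coords => [y|i].
      reflexivity.
    exact: coord_continuous.
  by apply: (@rV_compact R _ (fun j => A (enum_val j))) => j; exact: cA.
apply/seteqP; split => [_ [c Ac ->]|_ [v Av <-]].
  exists (\row_j c (enum_val j)); first by move=> j; rewrite mxE; exact: Ac.
  by apply: eq_bigr => i _; rewrite mxE enum_rankK.
exists (fun i => v 0 (enum_rank i)) => // i.
by have := Av (enum_rank i); rewrite enum_rankK.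
Qed.

Lemma compact_bounded_fun (R : realType) (T : topologicalType) (A : set T) (f : T -> R) :
  compact A -> (forall z, A z -> {for z, continuous f}) ->
  exists2 L, 0 <= L & forall z, A z -> `|f z| <= L.
Proof.
move=> cA cf; have [->|/set0P A0] := eqVneq A set0; first by exists 0.
have cf' : {within A, continuous (fun z => `|f z|)}.
  apply: continuous_in_subspaceT => z /[!inE] Az.
  by apply: continuous_comp; [exact: cf|exact: norm_continuous].
have [c _ H] := compact_EVT_max A0 cA cf'.
by exists `|f c| => // z Az; apply: H; rewrite inE.
Qed.

(** A compact convex set, so that derivative bounds on it control Taylor remainders along segments
    between its points; [d] keeps it away from the singular temperature [0]. *)
Definition box (R : realType) (N d : R) : set (xi_space R * R) :=
  [set z | (forall B, `|comp z.1 B| <= N) /\ d <= z.2 <= N].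

Lemma box_compact (R : realType) (N d : R) : compact (@box R N d).
Proof.
pose A (o : option Bidx) : set R := if o is Some _ then `[- N, N]%classic else `[d, N]%classic.
have cA o : compact (A o) by case: o => [B|]; exact: segment_compact.
have := @span_compact R _ _ (@xt_dir R) A cA; congr (compact _).
apply/seteqP; split => [_ [c Ac ->]|z [zB zN]].
  split=> [B|].
    have := co_span c (Some B); rewrite /= => ->.
    by have /= := Ac (Some B); rewrite in_itv/= ler_norml.
  by have := co_span c None; rewrite /= => ->; have /= := Ac None; rewrite in_itv.
exists (fun o => co o z); last exact: xt_decomp.
by case=> [B|] /=; rewrite in_itv/= -?ler_norml.
Qed.

Lemma box_pos (R : realType) (N d : R) : 0 < d -> @box R N d `<=` @pos_temp R.
Proof. by move=> d0 z [_ /andP[dz _]]; exact: lt_le_trans dz. Qed.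

Lemma box_convex (R : realType) (N d : R) (x y : xi_space R * R) (s : R) :
  box N d x -> box N d y -> 0 <= s <= 1 -> box N d (x + s *: (y - x)).
Proof.
move=> [xB /andP[x1 x2]] [yB /andP[y1 y2]] /andP[s0 s1].
have E o : co o (x + s *: (y - x)) = co o x + s * (co o y - co o x).
  by rewrite coD coZ coB.
split=> [B|].
  have /= -> := E (Some B); move: (xB B) (yB B); rewrite !ler_norml; nra.
have /= -> := E None; nra.
Qed.

(** * Taylor expansion along segments *)

Lemma Cn_deriv (R : realType) (V : normedModType R) (I : Type) (e : I -> V)
    (D : set V) (n : nat) (f : V -> R) (i : I) :
  Cn e D n.+1 f -> Cn e D n ('D_(e i) f).
Proof. by move=> [_ /(_ i)[]]. Qed.

Lemma CnW (R : realType) (V : normedModType R) (I : Type) (e : I -> V)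
    (D : set V) (n : nat) (f : V -> R) :
  Cn e D n.+1 f -> Cn e D n f.
Proof.
elim: n f => [|n IH] f [cf df]; first by split.
by split=> // i; have [d c] := df i; split => //; exact: IH.
Qed.

Lemma is_derive_bigsum (R : realType) (W : normedModType R) (J : Type) (r : seq J)
    (f : J -> W -> R) (df : J -> R) (x v : W) :
  (forall j, is_derive x v (f j) (df j)) ->
  is_derive x v (fun y => \sum_(j <- r) f j y) (\sum_(j <- r) df j).
Proof.
move=> dfP; rewrite (_ : (fun y => _) = \sum_(j <- r) f j); last first.
  by apply/funext => y; rewrite fct_sumE.
elim: r => [|j r IH]; first by rewrite !big_nil; exact: is_derive_cst.
by rewrite !big_cons; exact: is_deriveD.
Qed.

Section Segments.
Context (R : realType).
Implicit Types (f : xi_space R * R -> R) (x y z : xi_space R * R).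
Local Notation e := (@xt_dir R).
Local Notation pos := (@pos_temp R).

Lemma is_derive_seg f x y (s : R) : Cn e pos 1 f -> pos (x + s *: (y - x)) ->
  is_derive s 1 (fun t => f (x + t *: (y - x)))
    (\sum_o co o (y - x) * 'D_(e o) f (x + s *: (y - x))).
Proof.
move=> cf ps; have [cfz dfz] := Cn1E cf ps.
have := @is_derive_chain R R^o _ _ e f (fun t => x + t *: (y - x))
  (fun o t => co o x + t * co o (y - x)) s 1 (fun o => co o (y - x)).
apply.
- by move=> t; rewrite {1}(xt_decomp (x + _)); apply: eq_bigr => o _; rewrite coD coZ.
- have := open_nbhs_nbhs (conj (@open_pos_temp R) ps).
  by apply: filterS => w pw o; exact: (cf.2 o).1.
- by move=> o; exact: (dfz o).2.
- move=> o; have dt := @is_deriveD R R^o R^o _ _ s 1 _ _ (is_derive_cst (co o x) s 1)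
    (is_deriveM (is_derive_id s 1) (is_derive_cst (co o (y - x)) s 1)).
  apply: (is_derive_eq dt).
  by rewrite add0r /GRing.scale/= mulr0 mulr1 add0r.
Qed.

Lemma seg_bound_1 f x y (L : R) : Cn e pos 1 f ->
  (forall s : R, 0 <= s <= 1 -> pos (x + s *: (y - x))) ->
  (forall o (s : R), 0 <= s <= 1 -> `|'D_(e o) f (x + s *: (y - x))| <= L) ->
  `|f y - f x| <= L * \sum_o `|co o (y - x)|.
Proof.
move=> cf ps Lf.
have d (s : R) : 0 <= s <= 1 -> is_derive s 1 (fun t => f (x + t *: (y - x)))
    (\sum_o co o (y - x) * 'D_(e o) f (x + s *: (y - x))).
  by move=> /ps; exact: is_derive_seg.
have [||s] := @MVT_segment R (fun t => f (x + t *: (y - x)))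
  (fun s => \sum_o co o (y - x) * 'D_(e o) f (x + s *: (y - x))) 0 1 ler01.
- by move=> s; rewrite in_itv/= => /andP[s0 s1]; apply: d; rewrite !ltW.
- by apply: derivable_within_continuous => s; rewrite in_itv/= => /d[].
rewrite in_itv/= => s01; rewrite subr0 mulr1 scale1r scale0r addr0 [x + _]addrC subrK => ->.
rewrite (le_trans (ler_norm_sum _ _ _))// mulr_sumr; apply: ler_sum => o _.
by rewrite normrM mulrC ler_wpM2r//; exact: Lf.
Qed.

(** The first-order Taylor remainder of [f] at [zb]. For [psi] it carries the convexity; for the
    derivatives of [psi] it is the quadratic error left in the balance of relative entropy. *)
Definition rel2 f z zb : R :=
  f z - f zb - \sum_o co o (z - zb) * 'D_(e o) f zb.

Lemma is_derive_seg2 f x y (s : R) : Cn e pos 2 f -> pos (x + s *: (y - x)) ->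
  is_derive s 1 (fun t => \sum_o co o (y - x) * 'D_(e o) f (x + t *: (y - x)))
    (\sum_o co o (y - x) *
     \sum_o' co o' (y - x) * 'D_(e o') ('D_(e o) f) (x + s *: (y - x))).
Proof.
move=> cf ps.
apply: is_derive_bigsum => o.
apply: (@is_deriveZ R R^o R^o (fun t => 'D_(e o) f (x + t *: (y - x)))).
by apply: is_derive_seg; [exact: Cn_deriv|exact: ps].
Qed.

Lemma seg_taylor_ge f x y (m : R) : Cn e pos 2 f ->
  (forall s : R, 0 <= s <= 1 -> pos (x + s *: (y - x))) ->
  (forall s : R, 0 <= s <= 1 -> m <= \sum_o co o (y - x) *
     \sum_o' co o' (y - x) * 'D_(e o') ('D_(e o) f) (x + s *: (y - x))) ->
  m / 2 <= rel2 f y x.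
Proof.
move=> cf ps Hm.
have := @taylor2_ge R (fun t => f (x + t *: (y - x))) _ _ m.
rewrite /rel2 => /(_ _ _ (fun s s01 => is_derive_seg (CnW cf) (ps s s01))).
move=> /(_ _ (fun s s01 => is_derive_seg2 cf (ps s s01)) Hm).
by rewrite scale1r scale0r addr0 [x + _]addrC subrK.
Qed.

Lemma seg_taylor_le f x y (m : R) : Cn e pos 2 f ->
  (forall s : R, 0 <= s <= 1 -> pos (x + s *: (y - x))) ->
  (forall s : R, 0 <= s <= 1 -> \sum_o co o (y - x) *
     \sum_o' co o' (y - x) * 'D_(e o') ('D_(e o) f) (x + s *: (y - x)) <= m) ->
  rel2 f y x <= m / 2.
Proof.
move=> cf ps Hm.
have := @taylor2_ge R (fun t => - f (x + t *: (y - x))) _ _ (- m).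
rewrite /rel2 => /(_ _ _ (fun s s01 => is_deriveN (is_derive_seg (CnW cf) (ps s s01)))).
move=> /(_ _ (fun s s01 => is_deriveN (is_derive_seg2 cf (ps s s01)))).
rewrite scale1r scale0r addr0 [x + _]addrC subrK => H.
have {}H := H (fun s s01 => eq_ind_r is_true (Hm s s01) (lerN2 _ _)).
move: H; set S := \sum_o _; lra.
Qed.

Lemma seg_bound_2 f x y (L : R) : Cn e pos 2 f ->
  (forall s : R, 0 <= s <= 1 -> pos (x + s *: (y - x))) ->
  (forall o o' (s : R), 0 <= s <= 1 -> `|'D_(e o') ('D_(e o) f) (x + s *: (y - x))| <= L) ->
  `|rel2 f y x| <= L * (\sum_o `|co o (y - x)|) ^+ 2.
Proof.
move=> cf ps Lf.
set S := \sum_o _.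
have S0 : 0 <= S by rewrite sumr_ge0.
have L0 : 0 <= L by apply: le_trans (Lf None None 0 _); rewrite ?lexx ?ler01.
have Q (s : R) : 0 <= s <= 1 -> `|\sum_o co o (y - x) *
     \sum_o' co o' (y - x) * 'D_(e o') ('D_(e o) f) (x + s *: (y - x))| <= L * S ^+ 2.
  move=> s01; rewrite (le_trans (ler_norm_sum _ _ _))//.
  rewrite expr2 mulrA [L * S]mulrC -mulrA {1}/S mulr_suml; apply: ler_sum => o _.
  rewrite normrM ler_wpM2l// (le_trans (ler_norm_sum _ _ _))//.
  rewrite mulr_sumr; apply: ler_sum => o' _.
  by rewrite normrM mulrC ler_wpM2r//; exact: Lf.
have H1 : - (L * S ^+ 2) / 2 <= rel2 f y x.
  by apply: seg_taylor_ge => // s s01; have := Q s s01; rewrite ler_norml => /andP[].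
have H2 : rel2 f y x <= (L * S ^+ 2) / 2.
  by apply: seg_taylor_le => // s s01; have := Q s s01; rewrite ler_norml => /andP[].
have LS : 0 <= L * S ^+ 2 by rewrite mulr_ge0// sqr_ge0.
rewrite ler_norml; lra.
Qed.

End Segments.

(** * The relative potential *)

Lemma sqr_sum_le (R : realType) (I : finType) (a : I -> R) :
  (\sum_i `|a i|) ^+ 2 <= #|I|%:R * \sum_i a i ^+ 2.
Proof.
rewrite expr2 mulr_suml.
have H i : `|a i| * (\sum_j `|a j|) <= \sum_j (a i ^+ 2 + a j ^+ 2) / 2.
  rewrite mulr_sumr; apply: ler_sum => j _.
  rewrite -[a i ^+ 2]real_normK ?num_real// -[a j ^+ 2]real_normK ?num_real//.
  have := sqr_ge0 (`|a i| - `|a j|); lra.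
apply: (le_trans (ler_sum _ (fun i _ => H i))).
under eq_bigr => i _ do rewrite -mulr_suml big_split/= sumr_const.
rewrite -mulr_suml big_split/=; set S := \sum_i0 a i0 ^+ 2.
have -> : \sum_(i : I) S = #|I|%:R * S by rewrite sumr_const mulr_natl.
have -> : \sum_i a i ^+ 2 *+ #|xpredT : pred I| = #|I|%:R * S.
  by rewrite sumrMnl mulr_natl.
by lra.
Qed.

Lemma bounded_family (R : realType) (T : topologicalType) (I : finType) (A : set T)
    (f : I -> T -> R) : compact A ->
  (forall i z, A z -> {for z, continuous (f i)}) ->
  exists2 L, 0 <= L & forall i z, A z -> `|f i z| <= L.
Proof.
move=> cA cf.
have /choice[L HL] : forall i, exists L, 0 <= L /\ forall z, A z -> `|f i z| <= L.
  by move=> i; have [L L0 H] := compact_bounded_fun cA (cf i); exists L.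
exists (\sum_i L i); first by apply: sumr_ge0 => i _; exact: (HL i).1.
move=> i z Az; rewrite (le_trans ((HL i).2 z Az))// (bigD1 i)//= lerDl.
by apply: sumr_ge0 => j _; exact: (HL j).1.
Qed.

Lemma continuous_bigsum (R : realType) (T : topologicalType) (J : Type) (r : seq J)
    (f : J -> T -> R) (x : T) :
  (forall j, {for x, continuous (f j)}) ->
  {for x, continuous (fun y => \sum_(j <- r) f j y)}.
Proof. by move=> H; exact: cvg_bigsum. Qed.

Lemma sum_None (R : pzRingType) (c g : option Bidx -> R) :
  (forall B, c (Some B) = 0) -> \sum_o c o * g o = c None * g None.
Proof.
move=> c0; rewrite (bigD1 None)//= big1 ?addr0// => -[B|]// _.
by rewrite c0 mul0r.
Qed.

(** The relative entropy without its kinetic part, a function of [(xi, theta)] alone. *)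
Definition rel_pot (R : realType) (psi : xi_space R * R -> R)
    (z zb : xi_space R * R) : R :=
  rel_psi psi z zb + (eta psi z - eta psi zb) * (z.2 - zb.2).

Section Potential.
Context (R : realType) (psi : xi_space R * R -> R).
Implicit Types (x y z : xi_space R * R).
Local Notation e := (@xt_dir R).
Local Notation pos := (@pos_temp R).
Hypothesis psi_C3 : is_C3 psi.
Hypothesis psi_convex : hessian_xi_pos psi.
Hypothesis eta_incr : eta_theta_pos psi.

Lemma psi_Cn3 : Cn e pos 3 psi. Proof. exact: psi_C3. Qed.

Lemma dpsi_Cn2 o : Cn e pos 2 ('D_(e o) psi).
Proof. exact: Cn_deriv psi_Cn3. Qed.

Lemma ddpsi_Cn1 o o' : Cn e pos 1 ('D_(e o') ('D_(e o) psi)).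
Proof. exact: Cn_deriv (dpsi_Cn2 o). Qed.

Lemma dpsi_comm o o' z : pos z ->
  'D_(e o') ('D_(e o) psi) z = 'D_(e o) ('D_(e o') psi) z.
Proof.
move=> pz; apply: derive_comm; last 2 first.
- exact: (ddpsi_Cn1 o o').1.
- exact: (ddpsi_Cn1 o' o).1.
- have := open_nbhs_nbhs (conj (@open_pos_temp R) pz); apply: filterS => w pw.
  by split; [exact: (psi_Cn3.2 o).1|exact: ((dpsi_Cn2 o).2 o').1].
- have := open_nbhs_nbhs (conj (@open_pos_temp R) pz); apply: filterS => w pw.
  by split; [exact: (psi_Cn3.2 o').1|exact: ((dpsi_Cn2 o').2 o).1].
Qed.

Lemma jet_bound (N d : R) : 0 < d -> exists2 L, 0 <= L & forall z, box N d z ->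
  [/\ `|psi z| <= L, forall o, `|'D_(e o) psi z| <= L,
      forall o o', `|'D_(e o') ('D_(e o) psi) z| <= L &
      forall o o' o'', `|'D_(e o'') ('D_(e o') ('D_(e o) psi)) z| <= L].
Proof.
move=> d0; have cB := @box_compact R N d; have pB := @box_pos R N d d0.
have [L0 L00 H0] := compact_bounded_fun cB (fun z Bz => psi_Cn3.1 z (pB z Bz)).
have [L1 L10 H1] := bounded_family cB (fun o z Bz => (dpsi_Cn2 o).1 z (pB z Bz)).
have [L2 L20 H2] := @bounded_family R _ (option Bidx * option Bidx)%type _
  (fun p => 'D_(e p.2) ('D_(e p.1) psi)) cB
  (fun p z Bz => (ddpsi_Cn1 p.1 p.2).1 z (pB z Bz)).
have [L3 L30 H3] := @bounded_family R _ (option Bidx * option Bidx * option Bidx)%type _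
  (fun p => 'D_(e p.2) ('D_(e p.1.2) ('D_(e p.1.1) psi))) cB
  (fun p z Bz => (Cn_deriv p.2 (ddpsi_Cn1 p.1.1 p.1.2)).1 z (pB z Bz)).
exists (L0 + L1 + L2 + L3) => [|z Bz]; first by rewrite !addr_ge0.
split=> [|o|o o'|o o' o''].
- by have := H0 z Bz; lra.
- by have := H1 o z Bz; lra.
- by have := H2 (o, o') z Bz; rewrite /=; lra.
- by have := H3 (o, o', o'') z Bz; rewrite /=; lra.
Qed.

Definition hess z (h : xi_space R) : R :=
  \sum_B \sum_B' psi_xi (psi_xi psi B) B' z * comp h B * comp h B'.

Lemma hess_ge0 z h : pos z -> 0 <= hess z h.
Proof.
move=> pz; have [->|h0] := eqVneq h 0; last first.
  by case: z pz => xi th pz; rewrite ltW//; exact: psi_convex.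
rewrite /hess big1// => B _; rewrite big1// => B' _.
by have /= -> := co0 R (Some B'); rewrite mulr0.
Qed.

(** Strict positivity becomes uniform on the product of the box with the unit sphere of directions,
    which is compact; homogeneity of degree two extends the bound to all [h]. *)
Lemma hess_coercive (N d : R) : 0 < d -> exists2 m, 0 < m &
  forall z h, box N d z -> m * (\sum_B comp h B ^+ 2) <= hess z h.
Proof.
move=> d0.
(* The unit sphere of [xi]-directions, placed in a box of extended states to inherit compactness;
   its temperature component ranges over [[0, 1]]. *)
pose S := @box R 1 0 `&` [set w | \sum_B comp w.1 B ^+ 2 = 1].
have cq : continuous (fun w : xi_space R * R => \sum_B comp w.1 B ^+ 2).
  move=> w; apply: continuous_bigsum => B.
  have cB := @continuous_co R (Some B) w.
  exact: (continuous_comp cB (@exprn_continuous R 2 _)).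
have cS : compact S.
  apply: compact_closedI; first exact: box_compact.
  exact: (preimage_closed (fun w _ => cq w) (@closed_eq R 1)).
have cK := compact_setX (@box_compact R N d) cS.
have hne w : \sum_B comp w.1 B ^+ 2 = 1 -> w.1 != 0 :> xi_space R.
  move=> w1; apply/eqP => w0; move: w1; rewrite w0 big1.
    by move/eqP; rewrite eq_sym oner_eq0.
  by move=> B _; have /= -> := co0 R (Some B); rewrite expr0n.
(* An upper bound [L] for the inverse of the positive continuous function [hess] is a lower bound
   for [hess]; taking [(L + 1)^-1] keeps it meaningful when [L = 0]. *)
have [|L L0 HL] := @compact_bounded_fun R _ _
    (fun p : (xi_space R * R) * (xi_space R * R) => (hess p.1 p.2.1)^-1) cK.
  move=> [z w] [/= Bz [_ Sw]].
  have pz := box_pos d0 Bz.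
  apply: continuousV.
    by rewrite gt_eqF//; case: (z) pz => xi th pz; apply: psi_convex => //; exact: hne.
  apply: continuous_bigsum => B; apply: continuous_bigsum => B'.
  have cw C : {for (z, w), continuous
      (fun p : (xi_space R * R) * (xi_space R * R) => comp p.2.1 C)}.
    by apply: (@continuous_comp _ _ _ snd (@co R (Some C)));
      [exact: cvg_snd|exact: continuous_co].
  apply: continuousM; last exact: cw.
  apply: continuousM; last exact: cw.
  apply: (@continuous_comp _ _ _ fst (psi_xi (psi_xi psi B) B')); first exact: cvg_fst.
  exact: (ddpsi_Cn1 (Some B) (Some B')).1.
exists (L + 1)^-1; first by rewrite invr_gt0 ltr_wpDl.
move=> z h Bz; set q := \sum_B _.
have pz := box_pos d0 Bz.
have q0 : 0 <= q by apply: sumr_ge0 => B _; exact: sqr_ge0.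
have [->|qn0] := eqVneq q 0; first by rewrite mulr0 hess_ge0.
have qp : 0 < q by rewrite lt_neqAle eq_sym qn0.
pose s := Num.sqrt q.
have s0 : 0 < s by rewrite sqrtr_gt0.
have s2 : s ^+ 2 = q by rewrite sqr_sqrtr.
pose w : xi_space R * R := (s^-1 *: h, 0).
have cw B : comp w.1 B = s^-1 * comp h B by exact: (coZ (Some B) s^-1 (h, 0)).
have w1 : \sum_B comp w.1 B ^+ 2 = 1.
  under eq_bigr do rewrite cw exprMn.
  by rewrite -mulr_sumr -/q -s2 exprVn mulVf// sqrf_eq0 gt_eqF.
have Sw : S w.
  split=> //; split; last by rewrite /= lexx ler01.
  move=> B; rewrite -(@ler_pXn2r _ 2)// ?nnegrE// expr1n real_normK ?num_real//.
  rewrite -w1 (bigD1 B)//= lerDl; apply: sumr_ge0 => B' _; exact: sqr_ge0.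
have Hw : hess z w.1 = s ^- 2 * hess z h.
  rewrite /hess mulr_sumr; apply: eq_bigr => B _; rewrite mulr_sumr.
  by apply: eq_bigr => B' _; rewrite !cw expr2 invfM; ring.
have hw0 : 0 < hess z w.1.
  by case: (z) pz => xi th pz; apply: psi_convex => //; exact: hne.
have := HL (z, w) (conj Bz Sw); rewrite /= gtr0_norm ?invr_gt0// => hL.
have : (L + 1)^-1 <= hess z w.1.
  by rewrite -[leRHS]invrK lef_pV2 ?posrE ?invr_gt0// ?ltr_wpDl// (le_trans hL) ?lerDl.
by rewrite Hw s2 ler_pdivlMl// mulrC.
Qed.

Lemma psi_theta2_lt0 z : pos z -> 'D_(e None) ('D_(e None) psi) z < 0.
Proof.
move=> pz; have [_ /(_ None)[d _]] := Cn1E (CnW (dpsi_Cn2 None)) pz.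
have := eta_incr z.1 pz; rewrite -surjective_pairing.
rewrite (_ : eta psi = - 'D_(e None) psi)//.
by rewrite (derive_val (is_derive := is_deriveN d)) oppr_gt0.
Qed.

Lemma psi_theta2_coercive (N d : R) : 0 < d -> exists2 m, 0 < m &
  forall z, box N d z -> m <= - 'D_(e None) ('D_(e None) psi) z.
Proof.
move=> d0.
have [|L L0 HL] := @compact_bounded_fun R _ _
    (fun z => (- 'D_(e None) ('D_(e None) psi) z)^-1) (@box_compact R N d).
  move=> z /(box_pos d0) pz; apply: continuousV.
    by rewrite oppr_eq0 lt_eqF// psi_theta2_lt0.
  apply: continuousN; exact: (ddpsi_Cn1 None None).1.
exists (L + 1)^-1; first by rewrite invr_gt0 ltr_wpDl.
move=> z Bz; have := psi_theta2_lt0 (box_pos d0 Bz); rewrite -oppr_gt0 => h0.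
have := HL z Bz; rewrite gtr0_norm ?invr_gt0// => hL.
by rewrite -[leRHS]invrK lef_pV2 ?posrE ?invr_gt0// ?ltr_wpDl// (le_trans hL) ?lerDl.
Qed.

Lemma pos_seg x y (s : R) : pos x -> pos y -> 0 <= s <= 1 -> pos (x + s *: (y - x)).
Proof.
move=> px py /andP[s0 s1]; rewrite /pos_temp /=.
by move: px py; rewrite /pos_temp/GRing.scale/=; nra.
Qed.

Lemma rel_psi_xi_ge x y (m : R) : pos x -> y.2 = x.2 ->
  (forall s : R, 0 <= s <= 1 ->
    m * (\sum_B comp (y - x).1 B ^+ 2) <= hess (x + s *: (y - x)) (y - x).1) ->
  m * (\sum_B comp (y - x).1 B ^+ 2) / 2 <= rel2 psi y x.
Proof.
move=> px yx Hm.
have py : pos y by rewrite /pos_temp/= yx.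
apply: seg_taylor_ge; first exact: CnW psi_Cn3.
  by move=> s; exact: pos_seg.
move=> s s01; rewrite (le_trans (Hm s s01))// sum_option.
have -> : co None (y - x) = 0 by rewrite coB/= yx subrr.
rewrite mul0r add0r /hess le_eqVlt; apply/orP; left; apply/eqP.
apply: eq_bigr => B _; rewrite sum_option.
have -> : co None (y - x) = 0 by rewrite coB/= yx subrr.
rewrite mul0r add0r mulr_sumr; apply: eq_bigr => B' _.
by rewrite [co (Some B) _]/= [co (Some B') _]/= /psi_xi; ring.
Qed.

Lemma rel_psi_xi_ge0 x y : pos x -> y.2 = x.2 -> 0 <= rel2 psi y x.
Proof.
move=> px yx; have := @rel_psi_xi_ge x y 0 px yx; rewrite !mul0r; apply => s s01.
by apply: hess_ge0; apply: pos_seg => //; rewrite /pos_temp/= yx.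
Qed.

Lemma rel_psi_theta_ge x y (m : R) : pos x -> pos y -> y.1 = x.1 ->
  (forall s : R, 0 <= s <= 1 ->
    m <= - 'D_(e None) ('D_(e None) psi) (x + s *: (y - x))) ->
  m / 2 * (y.2 - x.2) ^+ 2 <= - rel2 psi y x.
Proof.
move=> px py yx Hm.
have c0 B : co (Some B) (y - x) = 0 by rewrite coB/= yx subrr.
suff : rel2 psi y x <= - m * (y.2 - x.2) ^+ 2 / 2 by lra.
apply: seg_taylor_le; first exact: CnW psi_Cn3.
  by move=> s; exact: pos_seg.
move=> s s01; rewrite !sum_None//.
rewrite coB /=; have := Hm s s01.
set D := 'D_(e None) _ _ => HD; have := sqr_ge0 (y.2 - x.2); nra.
Qed.

Lemma rel_psi_theta_ge0 x y : pos x -> pos y -> y.1 = x.1 -> 0 <= - rel2 psi y x.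
Proof.
move=> px py yx; have := @rel_psi_theta_ge x y 0 px py yx; rewrite !mul0r.
by apply => s s01; rewrite oppr_ge0 ltW// psi_theta2_lt0//; exact: pos_seg.
Qed.

(** The path from [z] to [zb] turns at [(z.1, zb.2)]. The temperature leg is expanded at [z], not at
    [zb], which is what the difference of entropies in [rel_pot] encodes. Concavity in [theta] gives
    the first term its sign, convexity in [xi] the second. *)
Lemma rel_potE z zb :
  rel_pot psi z zb = - rel2 psi (z.1, zb.2) z + rel2 psi (z.1, zb.2) zb.
Proof.
have c0 B : co (Some B) ((z.1, zb.2) - z) = 0 by rewrite coB/= subrr.
rewrite /rel2 [X in - (_ - X)]sum_None//.
rewrite [\sum_o _]sum_option !coB/= subrr mul0r add0r.
have -> : \sum_t co (Some t) ((z.1, zb.2) - zb) * 'D_(e (Some t)) psi zb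
    = \sum_B psi_xi psi B zb * (comp z.1 B - comp zb.1 B).
  by apply: eq_bigr => B _; rewrite coB/= mulrC.
rewrite /rel_pot /rel_psi /eta /psi_theta; ring.
Qed.

Lemma rel_pot_ge0 z zb : pos z -> pos zb -> 0 <= rel_pot psi z zb.
Proof.
move=> pz pzb; rewrite rel_potE addr_ge0//.
  exact: rel_psi_theta_ge0.
exact: rel_psi_xi_ge0.
Qed.

Lemma rel_pot_coercive (N d : R) : 0 < d -> exists2 m, 0 < m &
  forall z zb, box N d z -> box N d zb ->
    m * (\sum_o co o (z - zb) ^+ 2) <= rel_pot psi z zb.
Proof.
move=> d0.
have [m1 m10 H1] := hess_coercive N d0; have [m2 m20 H2] := psi_theta2_coercive N d0.
exists (Num.min m1 m2 / 2); first by rewrite divr_gt0// lt_min m10.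
move=> z zb Bz Bzb; rewrite rel_potE.
have By : box N d (z.1, zb.2) by case: Bz Bzb => [? _] [_ ?]; split.
have := @rel_psi_xi_ge zb (z.1, zb.2) m1 (box_pos d0 Bzb) erefl
  (fun s s01 => H1 _ _ (box_convex Bzb By s01)).
have := @rel_psi_theta_ge z (z.1, zb.2) m2 (box_pos d0 Bz) (box_pos d0 By) erefl
  (fun s s01 => H2 _ (box_convex Bz By s01)).
have -> : \sum_B comp ((z.1, zb.2) - zb).1 B ^+ 2 = \sum_B co (Some B) (z - zb) ^+ 2.
  by apply: eq_bigr => B _.
rewrite sum_option [co None _]coB/=.
set S := \sum_t _; have S0 : 0 <= S by apply: sumr_ge0 => B _; exact: sqr_ge0.
have -> : (zb.2 - z.2) ^+ 2 = (z.2 - zb.2) ^+ 2 by ring.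
have := sqr_ge0 (z.2 - zb.2); set Q := (z.2 - zb.2) ^+ 2 => Q0.
have : Num.min m1 m2 <= m1 by rewrite ge_min lexx.
have : Num.min m1 m2 <= m2 by rewrite ge_min lexx orbT.
set m := Num.min _ _; nra.
Qed.

End Potential.

(** * Norms, powers and bounds on the minors *)

Lemma mxnorm2_ge0 (R : realType) m n (A : 'M[R]_(m, n)) : 0 <= mxnorm2 A.
Proof. exact: sqrtr_ge0. Qed.

Lemma ler_mxnorm2 (R : realType) m n (A : 'M[R]_(m, n)) i j : `|A i j| <= mxnorm2 A.
Proof.
have S0 : 0 <= \sum_i \sum_j A i j ^+ 2.
  by apply: sumr_ge0 => ? _; apply: sumr_ge0 => ? _; exact: sqr_ge0.
rewrite -(@ler_pXn2r _ 2)// ?nnegrE ?mxnorm2_ge0//.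
rewrite real_normK ?num_real// sqr_sqrtr// (bigD1 i)//= (bigD1 j)//= -addrA lerDl.
by rewrite addr_ge0//; apply: sumr_ge0 => ? _; rewrite ?sqr_ge0//;
  apply: sumr_ge0 => ? _; exact: sqr_ge0.
Qed.

Lemma mxnorm2_le (R : realType) (A : 'M[R]_3) (N : R) :
  (forall i j, `|A i j| <= N) -> mxnorm2 A <= 3 * N.
Proof.
move=> AN; have N0 : 0 <= N by exact: le_trans (AN 0 0).
rewrite -[leRHS]ger0_norm ?mulr_ge0// -sqrtr_sqr ler_sqrt ?sqr_ge0//.
have H i : \sum_j A i j ^+ 2 <= 3 * N ^+ 2.
  apply: (@le_trans _ _ (\sum_(j < 3) N ^+ 2)).
    apply: ler_sum => j _; rewrite -[leLHS]real_normK ?num_real//.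
    by rewrite ler_pXn2r// nnegrE.
  by rewrite sumr_const card_ord mulr_natl.
apply: (@le_trans _ _ (\sum_(i < 3) 3 * N ^+ 2)); first by apply: ler_sum => i _.
by rewrite sumr_const card_ord -mulr_natl exprMn mulrA; lra.
Qed.

(** The constant is the threshold beyond which [x^(p-1)] exceeds [1 / eps]; below the threshold it
    bounds [x] itself. *)
Lemma le_eps_powR (R : realType) (p eps : R) : 1 < p -> 0 < eps ->
  exists2 C, 0 <= C & forall x, 0 <= x -> x <= eps * x `^ p + C.
Proof.
move=> p1 eps0; exists (eps^-1 `^ (p - 1)^-1) => [|x x0]; first exact: powR_ge0.
set C := eps^-1 `^ _.
have C0 : 0 < C by rewrite powR_gt0// invr_gt0.
have [xC|Cx] := leP x C; first by rewrite ler_wpDl// mulr_ge0 ?powR_ge0// ltW.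
rewrite ler_wpDr ?(ltW C0)// -ler_pdivrMl// mulrC.
have xp : 0 < x by exact: lt_trans Cx.
have -> : x `^ p = x * x `^ (p - 1).
  by rewrite -{2}(powRr1 x0) -powRD ?(gt_eqF xp) ?implybT// addrC subrK.
rewrite ler_wpM2l//.
have -> : eps^-1 = C `^ (p - 1).
  by rewrite -powRrM mulVf ?subr_eq0 ?gt_eqF// powRr1// invr_ge0 ltW.
by rewrite ge0_ler_powR// ?nnegrE ?subr_ge0 ltW.
Qed.

(** Young's inequality with conjugate exponents, its weights [1 / p] and [(p - 1) / p] being bounded
    by [1]. *)
Lemma mulr_le_powR (R : realType) (p x y : R) : 1 < p -> 0 <= x -> 0 <= y ->
  x * y <= x `^ p + y `^ (p / (p - 1)).
Proof.
move=> p1 x0 y0.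
have p0 : 0 < p by lra.
have q1 : 1 <= p / (p - 1) by rewrite ler_pdivlMr; lra.
have q0 : 0 < p / (p - 1) by lra.
have := conjugate_powR x0 y0 p0 q0.
have -> : p^-1 + (p / (p - 1))^-1 = 1 by field; lra.
move=> /(_ erefl) H; apply: (le_trans H); rewrite lerD// ler_pdivrMr//.
  by rewrite ler_peMr ?powR_ge0// ltW.
by rewrite ler_peMr ?powR_ge0.
Qed.

Lemma exprn_le_powR (R : realType) (p x : R) (n : nat) : n%:R <= p -> 0 <= x ->
  x ^+ n <= 1 + x `^ p.
Proof.
move=> np x0; have [x1|x1] := leP x 1.
  by rewrite ler_wpDr ?powR_ge0// exprn_ile1.
by rewrite ler_wpDl// -powR_mulrn// ler_powR// ltW.
Qed.

Lemma powR_le1D (R : realType) (p x : R) : 1 <= p -> 0 <= x -> x <= 1 + x `^ p.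
Proof. by move=> p1 x0; have := @exprn_le_powR R p x 1 p1 x0; rewrite expr1. Qed.

(** Each [dPhi] is a polynomial of degree 0, 1 or 2 in [F]; the factors 4 and 2 count its terms. The
    same degrees lie behind the exponents [1], [p / (p - 1)] and [p / (p - 2)] of (G2). *)
Lemma dPhi_bound (R : realType) (F : 'M[R]_3) (N : R) B i al :
  (forall i j, `|F i j| <= N) ->
  `|dPhi B i al F| <= match B with
    | inl (inl _) => 1 | inl (inr _) => 4 * N | inr _ => 2 * N ^+ 2 end.
Proof.
move=> FN; have N0 : 0 <= N by exact: le_trans (FN 0 0).
have d1 a b : `|(delta_mx i al : 'M[R]_3) a b| <= 1.
  by rewrite mxE; case: (_ && _); rewrite ?normr1// normr0 ler01.
have P a b x : `|a| <= 1 -> `|b| <= x -> `|a * b| <= x :> R.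
  by move=> a1 bx; rewrite normrM; apply: le_trans bx; rewrite ler_piMl.
have P' a b x : `|a| <= 1 -> `|b| <= x -> `|b * a| <= x :> R.
  by move=> a1 bx; rewrite mulrC; exact: P.
have Q a b : `|a| <= N -> `|b| <= N -> `|a * b| <= N ^+ 2.
  by move=> aN bN; rewrite normrM expr2; apply: ler_pM.
case: B => [[[a b]|[a b]]|[]].
- by rewrite dPhi_F.
- rewrite dPhi_zeta /dminor3.
  have := P _ _ _ (d1 (a + 1) (b + 1)) (FN (a + 2) (b + 2)).
  have := P' _ _ _ (d1 (a + 2) (b + 2)) (FN (a + 1) (b + 1)).
  have := P _ _ _ (d1 (a + 1) (b + 2)) (FN (a + 2) (b + 1)).
  have := P' _ _ _ (d1 (a + 2) (b + 1)) (FN (a + 1) (b + 2)).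
  rewrite !ler_norml; lra.
- rewrite dPhi_w /minor3.
  have := Q _ _ (FN (i + 1) (al + 1)) (FN (i + 2) (al + 2)).
  have := Q _ _ (FN (i + 1) (al + 2)) (FN (i + 2) (al + 1)).
  rewrite !ler_norml; lra.
Qed.

(** For the cofactors the derivative is linear in [F], so the previous bound applies to [F - G]; for
    the determinant each product is split as [a (b - b') + (a - a') b']. *)
Lemma dPhi_lip (R : realType) (F G : 'M[R]_3) (N s : R) B i al :
  0 <= s ->
  (forall i j, `|F i j| <= N) -> (forall i j, `|G i j| <= N) ->
  (forall i j, `|F i j - G i j| <= s) ->
  `|dPhi B i al F - dPhi B i al G| <= (4 + 4 * N) * s.
Proof.
move=> s0 FN GN FG; have N0 : 0 <= N by exact: le_trans (FN 0 0).
have Ns : 0 <= N * s by exact: mulr_ge0.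
have Q a b a' b' : `|a| <= N -> `|b'| <= N -> `|a - a'| <= s -> `|b - b'| <= s ->
    `|a * b - a' * b'| <= 2 * (N * s).
  move=> aN bN aa bb; have -> : a * b - a' * b' = a * (b - b') + (a - a') * b' by ring.
  rewrite (le_trans (ler_normD _ _))// !normrM mulr2n mulrDl !mul1r lerD//.
    exact: ler_pM.
  by rewrite mulrC; apply: ler_pM.
case: B => [[[a b]|[a b]]|[]].
- by rewrite !dPhi_F subrr normr0; lra.
- have FG' x y : `|(F - G) x y| <= s by rewrite !mxE.
  have := dPhi_bound (inl (inr (a, b))) i al FG'.
  rewrite !dPhi_zeta dminor3D; lra.
- rewrite !dPhi_w /minor3.
  have := Q _ _ _ _ (FN (i + 1) (al + 1)) (GN (i + 2) (al + 2))
    (FG (i + 1) (al + 1)) (FG (i + 2) (al + 2)).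
  have := Q _ _ _ _ (FN (i + 1) (al + 2)) (GN (i + 2) (al + 1))
    (FG (i + 1) (al + 2)) (FG (i + 2) (al + 1)).
  rewrite !ler_norml; lra.
Qed.

(** * Bounds by the relative potential *)

(* Young's inequality in the form needed for (G2): [X = f ^ p], [Y] and [W] are the powers
   of [sZ] and [sw] whose sum is controlled by the growth function [G]. *)
Lemma growth_absorbs (R : realType) (G X Y W f sF sZ sw st c C2 : R) :
  1 <= G -> X <= G -> 0 <= c -> 0 <= C2 -> 0 <= X -> 0 <= Y -> 0 <= W -> 0 <= sF ->
  0 <= sZ -> 0 <= sw ->
  sF + Y + W < G -> sZ <= 1 + Y -> sw <= 1 + W -> st <= G ->
  f ^+ 2 <= 1 + X -> f ^+ 4 <= 1 + X -> f * sZ <= X + Y -> f ^+ 2 * sw <= X + W ->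
  let A := 32 + C2 + 2 * c in
  [/\ [/\ sF <= A * G, sZ <= A * G, sw <= A * G & st <= A * G],
      1 * G + C2 <= A * G /\ c * G + c <= A * G,
      [/\ 1 <= A * G, (4 * f) ^+ 2 <= A * G & (2 * f ^+ 2) ^+ 2 <= A * G] &
      [/\ 1 * sF <= A * G, 4 * f * sZ <= A * G & 2 * f ^+ 2 * sw <= A * G]].
Proof.
move=> G1 XG c0 C20 X0 Y0 W0 F0 Z0 w0 S hZ hw ht h2 h4 hfZ hfw A.
have AG : 32 * G + C2 + 2 * c <= A * G.
  have H1 : C2 <= C2 * G by rewrite ler_peMr.
  have H2 : c <= c * G by rewrite ler_peMr.
  rewrite /A; lra.
have AG' : c * G + c <= A * G.
  have H1 : 0 <= C2 * G by rewrite mulr_ge0//; lra.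
  have H2 : c <= c * G by rewrite ler_peMr.
  rewrite /A; lra.
have -> : (4 * f) ^+ 2 = 16 * f ^+ 2 by ring.
have -> : (2 * f ^+ 2) ^+ 2 = 4 * f ^+ 4 by ring.
by split; split; (try split); lra.
Qed.

(** * States with a large growth function *)

Section Regions.
Context (R : realType) (psi : xi_space R * R -> R) (c p q r l : R).
Implicit Types (x y z zb : xi_space R * R).
Local Notation e := (@xt_dir R).
Local Notation pos := (@pos_temp R).
Local Notation gr := (growth p q r l).
Hypothesis psi_C3 : is_C3 psi.
Hypothesis psi_convex : hessian_xi_pos psi.
Hypothesis eta_incr : eta_theta_pos psi.
Hypotheses (c_gt0 : 0 < c) (p_ge4 : 4 <= p) (q_gt1 : 1 < q) (r_gt1 : 1 < r)
  (l_gt1 : 1 < l).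
Hypothesis growth1 : G1 c p q r l psi.
Hypothesis growth2 : G2 p q r l psi.
Hypothesis growth3 : G3 p q r l psi.
Variables M delta : R.
Hypotheses (M_gt0 : 0 < M) (delta_gt0 : 0 < delta).

Local Notation nO := (#|{: option Bidx}|%:R : R).

Lemma growth_ge0 z : 0 <= gr z.
Proof. by rewrite /growth !addr_ge0// powR_ge0. Qed.

Lemma growth_parts z : [/\ mxnorm2 z.1.1.1 `^ p <= gr z, mxnorm2 z.1.1.2 `^ q <= gr z,
  `|z.1.2| `^ r <= gr z & z.2 `^ l <= gr z].
Proof.
rewrite /growth.
have := powR_ge0 (mxnorm2 z.1.1.1) p; have := powR_ge0 (mxnorm2 z.1.1.2) q.
have := powR_ge0 `|z.1.2| r; have := powR_ge0 z.2 l.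
move: (_ `^ p) (_ `^ q) (_ `^ r) (_ `^ l) => a b x y a0 b0 x0 y0.
by split; lra.
Qed.

(** All four exponents exceed 1, so every coordinate is negligible against the growth function. With
    [eps = 1] this also shows that the sublevel sets of the growth function are bounded. *)
Lemma coords_le_growth (eps : R) : 0 < eps -> exists2 C, 0 <= C &
  forall z, 0 <= z.2 -> forall o, `|co o z| <= eps * gr z + C.
Proof.
move=> eps0; have p4 := p_ge4; have p1 : 1 < p by lra.
have [C1 C10 H1] := le_eps_powR p1 eps0; have [C2 C20 H2] := le_eps_powR q_gt1 eps0.
have [C3 C30 H3] := le_eps_powR r_gt1 eps0; have [C4 C40 H4] := le_eps_powR l_gt1 eps0.
exists (C1 + C2 + C3 + C4) => [|z z0 o]; first by rewrite !addr_ge0.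
have [g1 g2 g3 g4] := growth_parts z.
case: o => [[[[i j]|[i j]]|[]]|] /=.
- have := ler_mxnorm2 z.1.1.1 i j; have := H1 _ (mxnorm2_ge0 z.1.1.1); nra.
- have := ler_mxnorm2 z.1.1.2 i j; have := H2 _ (mxnorm2_ge0 z.1.1.2); nra.
- have := H3 _ (normr_ge0 z.1.2); nra.
- by have := H4 _ z0; rewrite ger0_norm//; nra.
Qed.

Lemma energy_bound z : pos z -> `|energy psi z| <= c * gr z + c.
Proof.
have c0 := c_gt0; move=> pz; have /andP[e1 e2] := growth1 pz; rewrite ler_norml e2 andbT.
have := growth_ge0 z; nra.
Qed.

(** The dependence on [z] is reduced to the energy, the entropy with the bounded weight [zb.2], and
    terms affine in [xi]. Far out only the first is of the order of the growth function. *)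
Lemma rel_pot_energyE z zb : rel_pot psi z zb =
  energy psi z - zb.2 * eta psi z - psi zb
  - \sum_B psi_xi psi B zb * (comp z.1 B - comp zb.1 B).
Proof. by rewrite /rel_pot /rel_psi /energy /eta; ring. Qed.

(** The ingredients of [relative_bounds] at [z] alone: when [z] is far from [zb] the differences
    bring no cancellation, and sizes suffice. *)
Definition crude_bounds z (A : R) : Prop :=
  [/\ forall o, `|'D_(e o) psi z| <= A, forall o, `|co o z| <= A,
      forall B i al, dPhi B i al z.1.1.1 ^+ 2 <= A,
      forall B i al, `|dPhi B i al z.1.1.1| * `|psi_xi psi B z| <= A &
      `|energy psi z| <= A].

(** These are the quantities met in the balance. The squared difference of [dPhi] is paired there
    with the velocity difference, whose square is the kinetic part of the relative entropy; the
    bound on the energy serves to absorb the dissipation for small amplitudes. *)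
Definition relative_bounds (C : R) z zb : Prop :=
  [/\ 0 <= rel_pot psi z zb,
      forall o, `|rel2 ('D_(e o) psi) z zb| <= C * rel_pot psi z zb,
      forall B i al, (dPhi B i al z.1.1.1 - dPhi B i al zb.1.1.1) ^+ 2
        <= C * rel_pot psi z zb,
      forall B i al, `|dPhi B i al z.1.1.1 - dPhi B i al zb.1.1.1| *
        `|psi_xi psi B z - psi_xi psi B zb| <= C * rel_pot psi z zb &
      `|energy psi z| <= C * (1 + rel_pot psi z zb)].

Lemma relative_boundsW (C C' : R) z zb : C <= C' ->
  relative_bounds C z zb -> relative_bounds C' z zb.
Proof.
move=> CC [h0 h1 h2 h3 h4].
have H : C * rel_pot psi z zb <= C' * rel_pot psi z zb by rewrite ler_wpM2r.
split=> [//|o|B i al|B i al|].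
- exact: le_trans (h1 o) H.
- exact: le_trans (h2 B i al) H.
- exact: le_trans (h3 B i al) H.
- by rewrite (le_trans h4)// ler_wpM2r// addr_ge0.
Qed.

(** Quantities at [zb] are bounded on the box, hence by multiples of [G] as [1 <= G]; those at [z]
    are bounded by [A * G]. If [rel_pot] dominates [G], every difference is thus dominated by
    [rel_pot]. *)
Lemma crude_relative (A A' : R) : 0 <= A -> 0 <= A' -> exists2 C, 0 <= C &
  forall z zb (G : R), pos z -> box M delta zb -> 1 <= G ->
    crude_bounds z (A * G) -> G <= A' * rel_pot psi z zb ->
    relative_bounds C z zb.
Proof.
move=> A0 A'0; have d0 := delta_gt0.
have [L L0 HL] := jet_bound psi_C3 M delta_gt0.
pose L' := 1 + 4 * M + 2 * M ^+ 2.
have M0 : 0 <= M by rewrite ltW.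
have L'0 : 0 <= L' by rewrite !addr_ge0// ?mulr_ge0// sqr_ge0.
have n0 : 0 <= nO by rewrite ler0n.
pose C1 := A + L + nO * ((A + M) * L).
have C10 : 0 <= C1 by rewrite !addr_ge0// !mulr_ge0// addr_ge0.
pose C2 := 2 * A + 2 * L' ^+ 2.
have C20 : 0 <= C2 by rewrite addr_ge0// mulr_ge0// sqr_ge0.
pose C3 := A + L * (1 + A) + L' * A + L' * L.
have C30 : 0 <= C3 by rewrite !addr_ge0// !mulr_ge0// addr_ge0.
have S0 : 0 <= C1 + C2 + C3 + A := addr_ge0 (addr_ge0 (addr_ge0 C10 C20) C30) A0.
exists ((C1 + C2 + C3 + A) * A'); first exact: mulr_ge0.
move=> z zb G pz Bzb G1 [h1 h2 h3 h4 h5] GP.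
have G0 : 0 <= G by lra.
have [Lpsi Ld Ldd Lddd] := HL zb Bzb.
have pzb : pos zb := box_pos delta_gt0 Bzb.
have P0 : 0 <= rel_pot psi z zb by exact: rel_pot_ge0.
have W a K : 0 <= K -> K <= C1 + C2 + C3 + A -> a <= K * G ->
    a <= (C1 + C2 + C3 + A) * A' * rel_pot psi z zb.
  move=> K0 KC aK; apply: (le_trans aK); rewrite -mulrA; apply: ler_pM => //.
have cob o : `|co o zb| <= M.
  case: Bzb => zB /andP[z1 z2]; case: o => [B|]; first exact: zB.
  by rewrite /= ger0_norm// ltW.
have dPb B i al : `|dPhi B i al zb.1.1.1| <= L'.
  have Fb i' j' : `|zb.1.1.1 i' j'| <= M by exact: (cob (Some (inl (inl (i', j'))))).
  rewrite (le_trans (dPhi_bound B i al Fb))// /L'.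
  have := sqr_ge0 M; case: B => [[_|_]|_] M2; lra.
have dPz B i al : `|dPhi B i al z.1.1.1| <= 1 + A * G.
  have := h3 B i al; rewrite -[_ ^+ 2]real_normK ?num_real//.
  have := normr_ge0 (dPhi B i al z.1.1.1); nra.
have AG : 0 <= A * G by rewrite mulr_ge0.
split=> [//|o|B i al|B i al|].
- apply: (W _ C1) => //; first by move: C20 C30 A0; lra.
  rewrite /rel2 (le_trans (ler_normB _ _))//.
  have Hs : `|\sum_o' co o' (z - zb) * 'D_(e o') ('D_(e o) psi) zb| <=
      nO * ((A + M) * L) * G.
    rewrite (le_trans (ler_norm_sum _ _ _))// -mulrA.
    have -> : nO * ((A + M) * L * G) = \sum_(o' : option Bidx) ((A + M) * L * G).
      by rewrite sumr_const mulr_natl.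
    apply: ler_sum => o' _; rewrite normrM mulrAC; apply: ler_pM => //.
    rewrite coB (le_trans (ler_normB _ _))// mulrDl.
    by apply: lerD; [exact: h2|rewrite (le_trans (cob o'))// ler_peMr].
  have := ler_normB ('D_(e o) psi z) ('D_(e o) psi zb).
  have := h1 o; have := Ld o; rewrite /C1; nra.
- apply: (W _ C2) => //; first by lra.
  have := h3 B i al; have := dPb B i al; have := normr_ge0 (dPhi B i al zb.1.1.1).
  have : `|dPhi B i al zb.1.1.1| ^+ 2 = dPhi B i al zb.1.1.1 ^+ 2.
    by rewrite real_normK ?num_real.
  have := sqr_ge0 (dPhi B i al z.1.1.1 + dPhi B i al zb.1.1.1).
  rewrite /C2; set a := dPhi B i al z.1.1.1; set b := dPhi B i al zb.1.1.1.
  move=> ab bb b0 bL aA.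
  have bL2 : b ^+ 2 <= L' ^+ 2 by rewrite -bb ler_pXn2r// nnegrE.
  have : L' ^+ 2 <= L' ^+ 2 * G by rewrite ler_peMr// sqr_ge0.
  have : (a - b) ^+ 2 + (a + b) ^+ 2 = 2 * a ^+ 2 + 2 * b ^+ 2 by ring.
  lra.
- apply: (W _ C3) => //; first by lra.
  have := h4 B i al; have := dPb B i al; have := dPz B i al.
  have := h1 (Some B); have := Ld (Some B).
  rewrite -/(psi_xi psi B z) -/(psi_xi psi B zb).
  have := ler_normB (dPhi B i al z.1.1.1) (dPhi B i al zb.1.1.1).
  have := ler_normB (psi_xi psi B z) (psi_xi psi B zb).
  have := normr_ge0 (dPhi B i al z.1.1.1); have := normr_ge0 (dPhi B i al zb.1.1.1).
  have := normr_ge0 (psi_xi psi B z); have := normr_ge0 (psi_xi psi B zb).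
  set s := `|psi_xi psi B z - _|; set t := `|dPhi _ _ _ z.1.1.1 - _|.
  set x1 := `|psi_xi psi B z|; set x2 := `|psi_xi psi B zb|.
  set a := `|dPhi _ _ _ z.1.1.1|; set b := `|dPhi _ _ _ zb.1.1.1|.
  move=> x20 x10 b0 a0 tx sa x2L x1A aA bL ax.
  have st : t * s <= (a + b) * (x1 + x2)
    by apply: ler_pM; [exact: normr_ge0|exact: normr_ge0|exact: sa|exact: tx].
  have ax2 : a * x2 <= (1 + A * G) * L by apply: ler_pM.
  have bx1 : b * x1 <= L' * (A * G) by apply: ler_pM.
  have bx2 : b * x2 <= L' * L by apply: ler_pM.
  have : L' * L <= L' * L * G by rewrite ler_peMr// mulr_ge0.
  have : L <= L * G by rewrite ler_peMr.
  rewrite /C3; nra.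
- have : `|energy psi z| <= (C1 + C2 + C3 + A) * A' * rel_pot psi z zb.
    by apply: (W _ A) => //; lra.
  move=> H; apply: (le_trans H); rewrite ler_wpM2l//; first exact: mulr_ge0.
  by rewrite lerDr.
Qed.

Lemma far_bounds : exists K A A' : R, [/\ 0 <= A, 0 <= A' &
  forall z zb, pos z -> box M delta zb -> K < gr z ->
    [/\ 1 <= gr z, crude_bounds z (A * gr z) & gr z <= A' * rel_pot psi z zb]].
Proof.
have c0 := c_gt0.
(* The arithmetic of the conclusion: the energy provides [c * g - c], the entropy and the affine
   term take at most [c / 8 * g] each, all constants together at most [c / 4 * g], and half of
   [c * g] remains. *)
have lin (X : R) : X * c <= c / 8 * (8 * (X + 1)) by lra.
have fin (a b d s x y g K : R) : c * g - c <= a -> b <= c / 8 * g ->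
    s <= y + x -> 4 * (c + K + x) <= c * g -> y <= c / 8 * g -> d <= K ->
    c * g <= 2 * (a - b - d - s) by lra.
have p4 := p_ge4; have Mp := M_gt0.
have p1 : 1 < p by lra.
have p2 : 1 < p / 2 by lra.
have qZ : 1 <= p / (p - 1) by rewrite ler_pdivlMr; lra.
have qw : 1 <= p / (p - 2) by rewrite ler_pdivlMr; lra.
have conj2 : p / 2 / (p / 2 - 1) = p / (p - 2) by field; lra.
have p2' : (2 : R) <= p by lra.
have [L L0 HL] := jet_bound psi_C3 M delta_gt0.
have n0 : 0 <= nO by rewrite ler0n.
have M0 : 0 <= M by rewrite ltW.
(* With [zb.2 <= M], the tolerance [c / (8 * M)] in (G3) limits the entropy term to [c / 8] of the
   growth; the minimum with [1] also bounds [psi_theta] by the growth itself. *)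
pose e3 := Num.min 1 (c / (8 * M)).
have e30 : 0 < e3 by rewrite lt_min ltr01 divr_gt0// mulr_gt0.
have [K2 H2] := growth2 (@ltr01 R).
have [K3 H3] := growth3 e30.
(* The affine term has at most [nO] summands with coefficients bounded by [L]; this tolerance limits
   its growing part to [c / 8] of the growth. *)
pose e1 := c / (8 * (nO * L + 1)).
have nL : 0 < nO * L + 1 by rewrite ltr_wpDl// mulr_ge0.
have e10 : 0 < e1 by rewrite divr_gt0// mulr_gt0.
have [C1 C10 H1] := coords_le_growth e10.
have [C2 C20 H1'] := coords_le_growth (@ltr01 R).
pose C0 := c + L + nO * (L * (C1 + M)).
have C00 : 0 <= C0.
  exact: addr_ge0 (addr_ge0 (ltW c0) L0) (mulr_ge0 n0 (mulr_ge0 L0 (addr_ge0 C10 M0))).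
(* Beyond [K] the growth is at least [1], (G2) and (G3) apply with their tolerances, and the
   constants collected in [C0] are at most a quarter of [c * gr z]. *)
pose K := 1 + `|K2| + `|K3| + 4 * C0 / c.
have K1 : 1 <= K.
  rewrite /K -!addrA lerDl !addr_ge0//; apply: divr_ge0; last exact: ltW.
  by rewrite mulr_ge0.
exists K, (32 + C2 + 2 * c), (2 / c); split.
- by rewrite !addr_ge0// mulr_ge0// ltW.
- by rewrite divr_ge0// ltW.
move=> z zb pz Bzb Kg.
have g1 : 1 <= gr z by rewrite ltW//; exact: le_lt_trans Kg.
have C0c : 0 <= 4 * C0 / c by apply: divr_ge0; [rewrite mulr_ge0|exact: ltW].
have K2g : K2 < gr z.
  by apply: le_lt_trans Kg; rewrite /K; have := ler_norm K2; have := normr_ge0 K3; lra.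
have K3g : K3 < gr z.
  by apply: le_lt_trans Kg; rewrite /K; have := ler_norm K3; have := normr_ge0 K2; lra.
have C0g : 4 * C0 <= c * gr z.
  rewrite -ler_pdivrMl// mulrC ltW//; apply: le_lt_trans Kg.
  by rewrite /K; have := normr_ge0 K3; have := normr_ge0 K2; lra.
have g0 : 0 < gr z by lra.
have z0 : 0 <= z.2 by rewrite ltW.
have {}H2 := H2 z pz K2g; have {}H3 := H3 z pz K3g.
have {}H1 := H1 z z0; have {}H1' := H1' z z0.
have [gF gZ gw gt] := growth_parts z.
(* The derivatives of [psi] are replaced by real bounds, which leaves a purely real problem for
   [growth_absorbs]. *)
have [sF [sZ [sw [[sF0 sZ0 sw0] [psiF psiZ psiW] S]]]] : exists sF sZ sw : R,
    [/\ [/\ 0 <= sF, 0 <= sZ & 0 <= sw],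
       [/\ forall i j, `|psi_xi psi (inl (inl (i, j))) z| <= sF,
           forall i j, `|psi_xi psi (inl (inr (i, j))) z| <= sZ &
           `|psi_w psi z| <= sw] &
       sF + sZ `^ (p / (p - 1)) + sw `^ (p / (p - 2)) < gr z].
  exists (mxnorm2 (psi_F_mx psi z)), (mxnorm2 (psi_zeta_mx psi z)), `|psi_w psi z|.
  split.
  - by split; [exact: mxnorm2_ge0|exact: mxnorm2_ge0|exact: normr_ge0].
  - split=> [i j|i j|//].
      by have := ler_mxnorm2 (psi_F_mx psi z) i j; rewrite mxE.
    by have := ler_mxnorm2 (psi_zeta_mx psi z) i j; rewrite mxE.
  - move: H2; rewrite ger0_norm; first by rewrite ltr_pdivrMr// mul1r.
    apply: divr_ge0; last exact: ltW.
    exact: addr_ge0 (addr_ge0 (mxnorm2_ge0 _) (powR_ge0 _ _)) (powR_ge0 _ _).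
have fF i j : `|z.1.1.1 i j| <= mxnorm2 z.1.1.1 by exact: ler_mxnorm2.
have f0 := mxnorm2_ge0 z.1.1.1.
move: (mxnorm2 z.1.1.1) f0 gF fF => f f0 gF fF.
have pZ0 := powR_ge0 sZ (p / (p - 1)); have pw0 := powR_ge0 sw (p / (p - 2)).
have eg : `|psi_theta psi z| < e3 * gr z.
  move: H3; rewrite ger0_norm ?divr_ge0// ?ltW//.
  by rewrite ltr_pdivrMr.
have {eg} [st eg ste] : exists2 st : R, `|psi_theta psi z| <= st & st <= e3 * gr z.
  by exists (e3 * gr z) => //; exact: ltW.
have e31 : e3 <= 1 by rewrite ge_min lexx.
have e3c : M * e3 <= c / 8.
  have : e3 <= c / (8 * M) by rewrite ge_min lexx orbT.
  move=> /(ler_wpM2l M0) /le_trans; apply.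
  have -> : M * (c / (8 * M)) = c / 8 by field; rewrite gt_eqF.
  exact: lexx.
have sZ1 := powR_le1D qZ sZ0; have sw1 := powR_le1D qw sw0.
have f2 : f ^+ 2 <= 1 + f `^ p by exact: exprn_le_powR.
(* This is where [4 <= p] enters: the squared minors have degree four in [F]. *)
have f4 : f ^+ 4 <= 1 + f `^ p by exact: exprn_le_powR.
have fZ : f * sZ <= f `^ p + sZ `^ (p / (p - 1)) by exact: mulr_le_powR.
(* The derivative of the determinant is quadratic in [F]: Young's inequality is used with exponent
   [p / 2], whose conjugate is [p / (p - 2)]. *)
have fw : f ^+ 2 * sw <= f `^ p + sw `^ (p / (p - 2)).
  have := mulr_le_powR p2 (sqr_ge0 f) sw0.
  have -> : (f ^+ 2) `^ (p / 2) = f `^ p.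
    by rewrite -powR_mulrn// -powRrM; congr (_ `^ _); field.
  by rewrite conj2.
split=> //.
  have stg : st <= gr z.
    by apply: (le_trans ste); rewrite ger_pMl.
  have [] := growth_absorbs g1 gF (ltW c0) C20 (powR_ge0 f p) pZ0 pw0 sF0 sZ0 sw0 S sZ1 sw1
    stg f2 f4 fZ fw.
  move=> [RF RZ Rw Rt] [Rco Re] [R1 R4 R2] [RpF RpZ Rpw].
  split.
  - case=> [[[[i j]|[i j]]|[]]|].
    + exact: le_trans (psiF i j) RF.
    + exact: le_trans (psiZ i j) RZ.
    + exact: le_trans psiW Rw.
    + exact: le_trans eg Rt.
  - by move=> o; apply: (le_trans (H1' o)).
  - move=> B i al; have := dPhi_bound B i al fF.
    rewrite -[dPhi _ _ _ _ ^+ 2]real_normK ?num_real//.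
    have := normr_ge0 (dPhi B i al z.1.1.1).
    move: `|dPhi B i al z.1.1.1| => a a0 aB.
    have sq (b : R) : a <= b -> b ^+ 2 <= (32 + C2 + 2 * c) * gr z ->
        a ^+ 2 <= (32 + C2 + 2 * c) * gr z.
      move=> ab; apply: le_trans; rewrite lerXn2r// nnegrE; exact: le_trans ab.
    case: B aB => [[_|_]|_] aB.
    + by apply: (sq 1 aB); rewrite expr1n.
    + exact: (sq (4 * f) aB).
    + exact: (sq (2 * f ^+ 2) aB).
  - move=> B i al; have := dPhi_bound B i al fF.
    have := normr_ge0 (dPhi B i al z.1.1.1).
    move: `|dPhi B i al z.1.1.1| => a.
    case: B => [[[x y]|[x y]]|[]] a0 aB.
    + exact: le_trans (ler_pM a0 (normr_ge0 _) aB (psiF x y)) RpF.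
    + exact: le_trans (ler_pM a0 (normr_ge0 _) aB (psiZ x y)) RpZ.
    + exact: le_trans (ler_pM a0 (normr_ge0 _) aB psiW) Rpw.
  - exact: (le_trans (energy_bound pz) Re).
rewrite rel_pot_energyE.
have [Lpsi Ld Ldd Lddd] := HL zb Bzb.
have /andP[ez _] := growth1 pz.
have Hs : `|\sum_B psi_xi psi B zb * (comp z.1 B - comp zb.1 B)| <=
    nO * (L * (e1 * gr z + C1 + M)).
  rewrite (le_trans (ler_norm_sum _ _ _))//.
  have X0 : 0 <= L * (e1 * gr z + C1 + M).
    by rewrite mulr_ge0// !addr_ge0// mulr_ge0// ltW.
  have : \sum_(B : Bidx) L * (e1 * gr z + C1 + M) <= nO * (L * (e1 * gr z + C1 + M)).
    have -> : \sum_(B : Bidx) L * (e1 * gr z + C1 + M)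
        = #|{: Bidx}|%:R * (L * (e1 * gr z + C1 + M)) by rewrite sumr_const mulr_natl.
    by rewrite ler_wpM2r// card_option ler_nat.
  apply: le_trans; apply: ler_sum => B _; rewrite normrM; apply: ler_pM => //.
    exact: Ld (Some B).
  rewrite (le_trans (ler_normB _ _))// lerD//; first exact: H1 (Some B).
  by case: Bzb => + _; apply.
have e1c : nO * (L * (e1 * gr z)) <= c / 8 * gr z.
  have -> : nO * (L * (e1 * gr z)) = nO * L * e1 * gr z by rewrite -!mulrA.
  rewrite ler_wpM2r ?(ltW g0)// /e1 mulrA ler_pdivrMr ?mulr_gt0//.
have zbM : 0 <= zb.2 <= M.
  by case: Bzb => _ /andP[z1 ->]; rewrite andbT (le_trans (ltW delta_gt0)).
have et : zb.2 * eta psi z <= c / 8 * gr z.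
  rewrite (le_trans (ler_norm _))// normrM ger0_norm; last by case/andP: zbM.
  rewrite normrN; case/andP: zbM => zb0 zbM.
  have : zb.2 * `|psi_theta psi z| <= M * (e3 * gr z).
    by apply: ler_pM => //; exact: le_trans ste.
  move=> H; apply: (le_trans H); rewrite mulrA ler_wpM2r// ltW//.
have Lp := ler_norm (psi zb).
move: Hs; rewrite ler_norml => /andP[_ Hs].
rewrite mulrAC ler_pdivlMr// mulrC; rewrite /C0 in C0g.
have E : nO * (L * (e1 * gr z + C1 + M)) =
    nO * (L * (e1 * gr z)) + nO * (L * (C1 + M)) by ring.
rewrite {}E in Hs; exact: fin ez et Hs C0g e1c (le_trans Lp Lpsi).
Qed.

End Regions.

(** * Bounded states, with temperature away from zero or near zero *)

(** Here [u], [v] are the values of a concave function at [d] and [th], and [du], [dv] its slopes.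
    The tangent at [d] bounds [v] above. The tangent at [th], multiplied by [th], bounds it below:
    [th * dv] is replaced by [v + E], the coefficients of [v] add up to [d], and one divides by [d]
    instead of the small [th]. *)
Lemma concave_bound (R : realType) (d th u v du dv E L : R) :
  0 < th -> th <= d ->
  - L <= u <= L -> - L <= du <= L -> - E <= v - th * dv <= E ->
  0 <= - (v - u - (th - d) * du) -> 0 <= - (u - v - (d - th) * dv) ->
  - (`|E| + 2 * L + d * L) <= v <= `|E| + 2 * L + d * L.
Proof.
move=> th0 thd /andP[u1 u2] /andP[du1 du2] /andP[e1 e2] H1 H2.
have EE := ler_norm E.
have L0 : 0 <= L by lra.
have dL : 0 <= d * L by apply: mulr_ge0; lra.
apply/andP; split; last first.
  have : (d - th) * - du <= (d - th) * L by rewrite ler_wpM2l; lra.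
  have : 0 <= th * L by rewrite mulr_ge0// ltW.
  lra.
have H3 : (d - th) * (th * dv) <= (d - th) * (v + E) by rewrite ler_wpM2l; lra.
have H4 : 0 <= th * - (u - v - (d - th) * dv) by rewrite mulr_ge0// ltW.
have d0 : 0 < d by lra.
have : d * (- (`|E| + L)) <= d * v.
  have : (d - th) * E <= (d - th) * `|E| by rewrite ler_wpM2l// subr_ge0.
  have : th * - L <= th * u by rewrite ler_wpM2l// ltW.
  have : 0 <= (d - th) * L by rewrite mulr_ge0// subr_ge0.
  have : 0 <= th * `|E| by rewrite mulr_ge0// ltW.
  lra.
rewrite ler_pM2l//; lra.
Qed.

(** The remainder from [th] to [t] is the sum of the remainder from [th] to [d], nonnegative by
    concavity, of the one from [d] to [t], coercive with constant [m], and of [(t - d) * (D0 - D1)],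
    nonnegative because slopes decrease. The step [t - d] is at least [d]. *)
Lemma cold_lower (R : realType) (m d t th a0 a1 a2 D0 D1 : R) :
  0 < m -> 0 <= d -> 2 * d <= t -> m / 2 * (t - d) ^+ 2 <= - (a2 - a1 - (t - d) * D1) ->
  0 <= - (a1 - a0 - (d - th) * D0) -> D1 <= D0 ->
  m / 2 * d ^+ 2 <= - (a2 - a0 - (t - th) * D0).
Proof.
move=> m0 d0 dt h1 h2 h3.
have td0 : 0 <= t - d by lra.
have h4 : d ^+ 2 <= (t - d) ^+ 2 by rewrite ler_pXn2r ?nnegrE//; lra.
have h5 : m / 2 * d ^+ 2 <= m / 2 * (t - d) ^+ 2 by rewrite ler_wpM2l//; lra.
have : 0 <= (t - d) * (D0 - D1) by apply: mulr_ge0; lra.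
lra.
Qed.

(** The entropy [et] is bounded above but may tend to minus infinity; then [- zb2 * et] makes [P]
    large at rate at least [dl]. The bounded contributions are paid for by the lower bound [c0] of
    [P]. *)
Lemma cold_eta (R : realType) (P zb2 et F L c0 dl a : R) : 0 <= P -> 0 < dl -> dl <= zb2 ->
  0 < c0 -> c0 <= P -> 0 <= F -> 0 <= L -> et <= L -> P = a - zb2 * et -> `|a| <= F ->
  1 + `|et| <= (dl^-1 + (1 + F / dl + L) / c0) * P.
Proof.
move=> P0 dl0 dz c00 cP F0 L0 eL Pa aF.
have K0 : 0 <= 1 + F / dl + L by rewrite !addr_ge0// divr_ge0// ltW.
have : 1 + F / dl + L <= (1 + F / dl + L) / c0 * P.
  by rewrite -mulrA ler_peMr// mulrC ler_pdivlMr// mul1r.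
rewrite mulrDl; suff : `|et| <= P / dl + F / dl + L by rewrite mulrC; lra.
have Fd : 0 <= F / dl by rewrite divr_ge0// ltW.
have Pd : 0 <= P / dl by rewrite divr_ge0// ltW.
rewrite ler_norml; apply/andP; split; last by lra.
suff : - et <= P / dl + F / dl by lra.
rewrite -mulrDl ler_pdivlMr//; have [et0|et0] := leP 0 et; first by nra.
have : - et * dl <= - et * zb2 by rewrite ler_wpM2l//; lra.
move: aF; rewrite ler_norml => /andP[a1 a2]; lra.
Qed.

Section Near.
Context (R : realType) (psi : xi_space R * R -> R) (c p q r l : R).
Implicit Types (x y z zb : xi_space R * R).
Local Notation e := (@xt_dir R).
Local Notation pos := (@pos_temp R).
Local Notation gr := (growth p q r l).
Hypothesis psi_C3 : is_C3 psi.
Hypothesis psi_convex : hessian_xi_pos psi.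
Hypothesis eta_incr : eta_theta_pos psi.
Hypotheses (c_gt0 : 0 < c) (p_ge0 : 0 <= p) (q_ge0 : 0 <= q) (r_ge0 : 0 <= r)
  (l_ge0 : 0 <= l).
Hypothesis growth1 : G1 c p q r l psi.
Variables M delta : R.
Hypotheses (M_gt0 : 0 < M) (delta_gt0 : 0 < delta).

Local Notation nO := (#|{: option Bidx}|%:R : R).

(** On the convex box every left-hand side other than the energy is quadratic in the distance [S] of
    the two states, and coercivity with the Cauchy-Schwarz inequality gives
    [S^2 <= nO / m * rel_pot]. The energy is simply bounded. *)
Lemma compact_relative (N d : R) : 0 < d -> exists2 C, 0 <= C &
  forall z zb, box N d z -> box N d zb -> relative_bounds psi C z zb.
Proof.
move=> d0; have [L L0 HL] := jet_bound psi_C3 N d0.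
have [m m0 Hm] := rel_pot_coercive psi_C3 psi_convex eta_incr N d0.
have n0 : 0 <= nO by rewrite ler0n.
pose N' := 4 + 4 * `|N|.
have N'0 : 0 <= N' by rewrite addr_ge0// mulr_ge0.
have K0 : 0 <= L + N' ^+ 2 + N' * L by rewrite !addr_ge0// ?sqr_ge0// mulr_ge0.
have C0 : 0 <= (L + N' ^+ 2 + N' * L) * (nO / m).
  by rewrite mulr_ge0// divr_ge0// ltW.
have L1 : 0 <= L + `|N| * L by rewrite addr_ge0// mulr_ge0.
exists ((L + N' ^+ 2 + N' * L) * (nO / m) + (L + `|N| * L)); first by rewrite addr_ge0.
move=> z zb Bz Bzb.
have pz := box_pos d0 Bz; have pzb := box_pos d0 Bzb.
have P0 : 0 <= rel_pot psi z zb by exact: rel_pot_ge0.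
have ps (s : R) : 0 <= s <= 1 -> pos (zb + s *: (z - zb)) by exact: pos_seg.
have bs (s : R) : 0 <= s <= 1 -> box N d (zb + s *: (z - zb)) by exact: box_convex.
pose S := \sum_o `|co o (z - zb)|.
have S0 : 0 <= S by rewrite sumr_ge0.
have S2 : S ^+ 2 <= nO / m * rel_pot psi z zb.
  rewrite (le_trans (sqr_sum_le _))// -mulrA ler_wpM2l// ler_pdivlMl//.
  exact: Hm.
have W a K : 0 <= K -> K <= L + N' ^+ 2 + N' * L -> a <= K * S ^+ 2 ->
    a <= ((L + N' ^+ 2 + N' * L) * (nO / m) + (L + `|N| * L)) * rel_pot psi z zb.
  move=> Kp KC aK; rewrite mulrDl ler_wpDr ?mulr_ge0//.
  rewrite -mulrA; apply: (le_trans aK); apply: ler_pM => //; exact: sqr_ge0.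
have cS o : `|co o (z - zb)| <= S.
  by rewrite /S (bigD1 o)//= lerDl sumr_ge0.
have NN : N <= `|N| := ler_norm N.
have dS B i al : `|dPhi B i al z.1.1.1 - dPhi B i al zb.1.1.1| <= N' * S.
  apply: dPhi_lip => // i' j'.
  - by case: Bz => /(_ (inl (inl (i', j'))))/= + _ => /le_trans; exact.
  - by case: Bzb => /(_ (inl (inl (i', j'))))/= + _ => /le_trans; exact.
  - by have := cS (Some (inl (inl (i', j')))); rewrite coB.
have N'2 : 0 <= N' ^+ 2 by exact: sqr_ge0.
have NL : 0 <= N' * L by exact: mulr_ge0.
split=> [//|o|B i al|B i al|].
- apply: (W _ L) => //; first by rewrite -addrA lerDl addr_ge0.
  apply: seg_bound_2 => //; first exact: dpsi_Cn2.
  by move=> o1 o2 s s01; have [_ _ _] := HL _ (bs s s01); apply.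
- apply: (W _ (N' ^+ 2)) => //; first by rewrite addrAC lerDr addr_ge0.
  rewrite -[leLHS]real_normK ?num_real// -exprMn ler_pXn2r// ?nnegrE//.
  exact: mulr_ge0.
- apply: (W _ (N' * L)) => //; first by rewrite lerDr addr_ge0.
  rewrite expr2 mulrACA; apply: ler_pM; [exact: normr_ge0|exact: normr_ge0|exact: dS|].
  apply: (@seg_bound_1 R ('D_(e (Some B)) psi) zb z L).
  - exact: CnW (dpsi_Cn2 psi_C3 _).
  - exact: ps.
  - by move=> o s s01; have [_ _ + _] := HL _ (bs s s01); apply.
- have [Lp /(_ None) Ld _ _] := HL z Bz.
  have zN : `|z.2| <= `|N|.
    by case: Bz => _ /andP[dz zN]; rewrite ger0_norm ?(le_trans zN)// (le_trans (ltW d0)).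
  have eL : `|energy psi z| <= L + `|N| * L.
    rewrite /energy (le_trans (ler_normB _ _))// lerD// normrM.
    by apply: ler_pM; [exact: normr_ge0|exact: normr_ge0|exact: zN|exact: Ld].
  apply: (le_trans eL); rewrite -[leLHS]mulr1; apply: ler_pM => //.
    by rewrite lerDr.
  by rewrite lerDl.
Qed.

Lemma growth_bounded (N d : R) : 0 <= N -> exists K, forall z,
  (forall B, `|comp z.1 B| <= N) -> 0 < z.2 <= d -> gr z <= K.
Proof.
move=> N0; exists ((3 * N) `^ p + (3 * N) `^ q + N `^ r + d `^ l) => z zN /andP[z0 zd].
have N3 : 0 <= 3 * N by rewrite mulr_ge0.
rewrite /growth; apply: lerD; first apply: lerD; first apply: lerD.
- apply: ge0_ler_powR => //; rewrite ?nnegrE ?mxnorm2_ge0//.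
  by apply: mxnorm2_le => i j; exact: (zN (inl (inl (i, j)))).
- apply: ge0_ler_powR => //; rewrite ?nnegrE ?mxnorm2_ge0//.
  by apply: mxnorm2_le => i j; exact: (zN (inl (inr (i, j)))).
- by apply: ge0_ler_powR => //; exact: (zN (inr tt)).
- by apply: ge0_ler_powR => //; rewrite nnegrE ltW// (lt_le_trans z0).
Qed.

Lemma rel2_temp f (xi : xi_space R) (s t : R) :
  rel2 f (xi, s) (xi, t) = f (xi, s) - f (xi, t) - (s - t) * 'D_(e None) f (xi, t).
Proof.
rewrite /rel2 sum_None; first by rewrite coB.
by move=> B; rewrite coB subrr.
Qed.

(* With theta1 := d, concavity in theta gives
   psi(theta) <= psi(d) + (theta - d) psi_theta(d) and
   psi(d) <= psi(theta) + (d - theta) psi_theta(theta), where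
   theta psi_theta(theta) = psi(theta) - e(theta) and e is bounded. *)
Lemma psi_bounded (N d : R) : 0 <= N -> 0 < d -> exists2 A, 0 <= A & forall z,
  (forall B, `|comp z.1 B| <= N) -> 0 < z.2 <= d -> `|psi z| <= A.
Proof.
move=> N0 d0; have [K HK] := growth_bounded d N0.
have [L L0 HL] := jet_bound psi_C3 (Num.max N d) d0.
pose E := c * K + c.
have E0 z : (forall B, `|comp z.1 B| <= N) -> 0 < z.2 <= d -> `|energy psi z| <= E.
  move=> zN zd; have /andP[pz _] := zd.
  apply: (le_trans (energy_bound c_gt0 growth1 pz)).
  by rewrite /E lerD2r ler_wpM2l ?(ltW c_gt0)// HK.
exists (`|E| + 2 * L + d * L) => [|z zN zd].
  by rewrite !addr_ge0// mulr_ge0// ltW.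
have := E0 z zN zd; case: z zN zd => xi th /= zN /andP[th0 thd] eE.
have Bd : box (Num.max N d) d (xi, d).
  split=> [B|/=]; last by rewrite lexx le_max lexx orbT.
  by rewrite (le_trans (zN B))// le_max lexx.
have [Lp /(_ None) Ld _ _] := HL _ Bd.
have pz : pos (xi, th) by [].
have pd : pos (xi, d) by [].
have := rel_psi_theta_ge0 psi_C3 eta_incr pd pz erefl.
have := rel_psi_theta_ge0 psi_C3 eta_incr pz pd erefl.
rewrite !rel2_temp /= in eE *.
rewrite /energy /psi_theta ler_norml/= -/(xt_dir R None) in eE.
move: Lp Ld; rewrite !ler_norml => u12 du12 H1 H2.
exact: concave_bound th0 thd u12 du12 eE H2 H1.
Qed.

(** A convex function has bounded slopes where it is bounded on a slightly larger set: its values at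
    unit distance along the directions [e B] and [- e B] control them, hence the radius [N + 1]. *)
Lemma psi_xi_bounded (N d : R) : 0 <= N -> 0 < d -> exists2 A, 0 <= A & forall z,
  (forall B, `|comp z.1 B| <= N) -> 0 < z.2 <= d -> forall B, `|psi_xi psi B z| <= A.
Proof.
move=> N0 d0; have N1 : 0 <= N + 1 by rewrite addr_ge0.
have [A A0 HA] := psi_bounded N1 d0.
exists (2 * A) => [|z zN zd B]; first by rewrite mulr_ge0.
have pz : pos z by case/andP: zd.
have Az : `|psi z| <= A by apply: HA => // B'; rewrite (le_trans (zN B'))// lerDl.
have H (s : R) : `|s| <= 1 -> s * psi_xi psi B z <= 2 * A.
  move=> s1; pose y := z + s *: e (Some B).
  have yz : y - z = s *: e (Some B) by rewrite /y addrC addKr.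
  have y2 : y.2 = z.2 by rewrite /y/= /GRing.scale/= mulr0 addr0.
  have := rel_psi_xi_ge0 psi_C3 psi_convex pz y2.
  rewrite /rel2 yz (bigD1 (Some B))// big1; last first.
    by move=> o oB; rewrite coZ co_dir (negPf oB) mulr0 mul0r.
  rewrite coZ co_dir eqxx mulr1 [X in _ - X]addr0.
  have Ay : `|psi y| <= A.
    apply: HA; last by rewrite y2.
    move=> B'; have := coD (Some B') z (s *: e (Some B)); rewrite coZ co_dir/= => ->.
    rewrite (le_trans (ler_normD _ _))// lerD// normrM.
    by rewrite -[leRHS]mulr1; apply: ler_pM => //; case: (_ == _); rewrite ?normr0 ?normr1.
  rewrite -/(psi_xi psi B z); move: Az Ay; rewrite !ler_norml.
  by move: (psi z) (psi y) (s * _) => a b d'; lra.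
have := H 1; have := H (-1); rewrite normrN normr1 lexx mul1r mulN1r => /(_ erefl) h1 /(_ erefl) h2.
by rewrite ler_norml; apply/andP; split => //; rewrite lerNl.
Qed.

Lemma psi_theta_decr (xi : xi_space R) (s t : R) : 0 < s -> s <= t ->
  psi_theta psi (xi, t) <= psi_theta psi (xi, s).
Proof.
move=> s0 st; pose x := (xi, s); pose y := (xi, t).
have px : pos x by [].
have py : pos y by rewrite /pos_temp/=; exact: lt_le_trans st.
have d (u : R) : 0 <= u <= 1 -> is_derive u 1
    (fun v => 'D_(e None) psi (x + v *: (y - x)))
    ((t - s) * 'D_(e None) ('D_(e None) psi) (x + u *: (y - x))).
  move=> u01; have := is_derive_seg (CnW (dpsi_Cn2 psi_C3 None)) (pos_seg px py u01).
  by rewrite sum_None ?coB// => B; rewrite coB subrr.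
have [|u] := @MVT_segment R (fun v => 'D_(e None) psi (x + v *: (y - x))) _ 0 1 ler01
  (fun u u01 => d u (subset_itv_oo_cc u01)).
  by apply: derivable_within_continuous => u; rewrite in_itv/= => /d[].
rewrite in_itv/= => u01; rewrite scale1r scale0r addr0 [x + _]addrC subrK => H.
rewrite -subr_le0 /psi_theta H subr0 mulr1.
rewrite mulr_ge0_le0 ?subr_ge0// ltW//.
exact: psi_theta2_lt0 psi_C3 eta_incr _ (pos_seg px py u01).
Qed.

(** The size [G] involves the entropy because [psi_theta] is the only quantity in [crude_bounds]
    that may blow up as the temperature tends to zero. *)
Lemma cold_bounds (N : R) : M <= N -> exists A A' : R, [/\ 0 <= A, 0 <= A' &
  forall z zb, pos z -> (forall B, `|comp z.1 B| <= N) -> z.2 <= delta / 2 ->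
    box M delta zb ->
    let G := 1 + `|eta psi z| in
    crude_bounds psi z (A * G) /\ G <= A' * rel_pot psi z zb].
Proof.
move=> MN; have N0 : 0 <= N by apply: le_trans MN; rewrite ltW.
(* Cold temperatures lie below [d] and reference temperatures above [2 * d]; the stretch between
   them, where the concavity is uniform, provides the positive lower bound [c0] of [rel_pot]. *)
pose d := delta / 2; have d0 : 0 < d by rewrite divr_gt0.
have [K HK] := growth_bounded d N0.
have [A1 A10 H1] := psi_xi_bounded N0 d0.
have [m m0 Hm] := psi_theta2_coercive psi_C3 eta_incr (Num.max N d) d0.
have [L L0 HL] := jet_bound psi_C3 (Num.max N d) d0.
have [L' L'0 HL'] := jet_bound psi_C3 M delta_gt0.
pose E := `|c * K + c|.
have E0 : 0 <= E by exact: normr_ge0.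
pose b := 1 + 4 * N + 2 * N ^+ 2.
have b0 : 0 <= b by rewrite !addr_ge0// ?mulr_ge0// sqr_ge0.
pose c0 := m / 2 * d ^+ 2.
have c00 : 0 < c0 by rewrite mulr_gt0 ?divr_gt0// exprn_gt0.
have n0 : 0 <= nO by rewrite ler0n.
pose F := E + L' + nO * (L' * (N + M)).
have F0 : 0 <= F by rewrite !addr_ge0// !mulr_ge0// addr_ge0// ltW.
have bA1 : 0 <= b ^+ 2 + b * A1 by rewrite addr_ge0 ?sqr_ge0// mulr_ge0.
exists (1 + A1 + N + d + (b ^+ 2 + b * A1) + E), (delta^-1 + (1 + F / delta + L) / c0).
split.
- exact: addr_ge0 (addr_ge0 (addr_ge0 (addr_ge0 (addr_ge0 ler01 A10) N0) (ltW d0)) bA1) E0.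
- apply: addr_ge0; first by rewrite invr_ge0 ltW.
  apply: divr_ge0 (ltW c00); apply: addr_ge0 => //; apply: addr_ge0 => //.
  by apply: divr_ge0 => //; exact: ltW.
move=> z zb pz zN zd Bzb G.
have zdd : 0 < z.2 <= d by rewrite zd andbT.
have G1 : 1 <= G by rewrite /G lerDl.
have eE : `|energy psi z| <= E.
  apply: (le_trans (energy_bound c_gt0 growth1 pz)); apply: le_trans (ler_norm _).
  by rewrite lerD2r ler_wpM2l ?(ltW c_gt0)// HK.
split.
  have W a K' : 0 <= K' -> K' <= 1 + A1 + N + d + (b ^+ 2 + b * A1) + E -> a <= K' ->
      a <= (1 + A1 + N + d + (b ^+ 2 + b * A1) + E) * G.
    move=> K'0 K'A aK; apply: (le_trans aK); apply: (le_trans K'A).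
    by rewrite ler_peMr// (le_trans K'0).
  have FN i j : `|z.1.1.1 i j| <= N by exact: (zN (inl (inl (i, j)))).
  have db B i al : `|dPhi B i al z.1.1.1| <= b.
    apply: (le_trans (dPhi_bound B i al FN)); rewrite /b.
    by have := sqr_ge0 N; case: B => [[_|_]|_]; lra.
  have d0' := ltW d0.
  split.
  - case=> [B|]; first by apply: (W _ A1); [|lra|exact: (H1 z zN zdd B)].
    rewrite (_ : `|_| = `|eta psi z|); last by rewrite /eta normrN.
    have X0 : 0 <= A1 + N + d + (b ^+ 2 + b * A1) + E by lra.
    have -> : 1 + A1 + N + d + (b ^+ 2 + b * A1) + E =
      1 + (A1 + N + d + (b ^+ 2 + b * A1) + E) by ring.
    move: (A1 + N + d + _ + E) X0 => X X0.
    by rewrite mulrDl mul1r -[leLHS]addr0 lerD// ?lerDr// mulr_ge0// (le_trans ler01).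
  - case=> [B|]; first by apply: (W _ N); [|lra|exact: zN].
    by apply: (W _ d); [|lra|rewrite /= ger0_norm// ltW].
  - move=> B i al; apply: (W _ (b ^+ 2)); [exact: sqr_ge0| |].
      have : 0 <= b * A1 by rewrite mulr_ge0.
      lra.
    by rewrite -[leLHS]real_normK ?num_real// ler_pXn2r// nnegrE.
  - move=> B i al; apply: (W _ (b * A1)); [exact: mulr_ge0| |].
      have := sqr_ge0 b; lra.
    by apply: ler_pM; [exact: normr_ge0|exact: normr_ge0|exact: db|exact: (H1 z zN zdd B)].
  - by apply: (W _ E); [|lra|].
have /andP[zb1 zb2] : delta <= zb.2 <= M by case: Bzb.
have zb0 : 0 < zb.2 by exact: lt_le_trans zb1.
have dd : d <= delta by rewrite /d; have := ltW delta_gt0; lra.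
have PE : F + `|zb.2 * L| >= 0 by rewrite addr_ge0.
have Bd (t : R) : d <= t <= N -> box (Num.max N d) d (z.1, t).
  move=> /andP[dt tN]; split=> [B|/=]; last by rewrite dt le_max tN.
  by rewrite (le_trans (zN B))// le_max lexx.
have B1 := Bd d; have B2 := Bd zb.2.
have dN : d <= N by apply: le_trans MN; apply: le_trans dd _; exact: le_trans zb2.
have {}B1 : box (Num.max N d) d (z.1, d) by apply: B1; rewrite lexx.
have {}B2 : box (Num.max N d) d (z.1, zb.2).
  by apply: B2; rewrite (le_trans dd)//= (le_trans zb2).
have Pc0 : c0 <= rel_pot psi z zb.
  rewrite rel_potE -[leLHS]addr0; apply: lerD; last first.
    by apply: rel_psi_xi_ge0 => //; exact: lt_le_trans zb1.
  have h1 := rel_psi_theta_ge psi_C3 (box_pos d0 B1) (box_pos d0 B2) erefl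
    (fun s s01 => Hm _ (box_convex B1 B2 s01)).
  have h2 : 0 <= - rel2 psi (z.1, d) z by apply: rel_psi_theta_ge0.
  have h3 := psi_theta_decr z.1 pz zd.
  have -> : rel2 psi (z.1, zb.2) z = rel2 psi (z.1, zb.2) (z.1, z.2) by case: (z).
  have {}h2 : 0 <= - rel2 psi (z.1, d) (z.1, z.2) by case: (z) h2.
  move: h1 h2; rewrite !rel2_temp => h1 h2.
  have dt : 2 * d <= zb.2 by rewrite /d mulrC divfK.
  exact: cold_lower m0 (ltW d0) dt h1 h2 h3.
pose a := energy psi z - psi zb - \sum_B psi_xi psi B zb * (comp z.1 B - comp zb.1 B).
apply: (@cold_eta _ (rel_pot psi z zb) zb.2 (eta psi z) F L c0 delta a) => //.
- exact: le_trans (ltW c00) Pc0.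
(* The entropy increases with the temperature, so below [d] it is at most its value at [d], which is
   bounded on the box. *)
- have [_ /(_ None) + _ _] := HL _ B1; rewrite ler_norml => /andP[+ _].
  have := psi_theta_decr z.1 pz zd; case: (z) => xi th /=; rewrite /eta /psi_theta.
  by move=> h1 h2; rewrite lerNl; exact: le_trans h2 h1.
- by rewrite rel_pot_energyE /a; ring.
have [Lp Ld _ _] := HL' zb Bzb.
rewrite /a (le_trans (ler_normB _ _))// /F lerD//.
  by rewrite (le_trans (ler_normB _ _))// lerD.
rewrite (le_trans (ler_norm_sum _ _ _))//.
have X0 : 0 <= L' * (N + M) by rewrite mulr_ge0// addr_ge0// ltW.
apply: (@le_trans _ _ (#|{: Bidx}|%:R * (L' * (N + M)))); last first.
  by rewrite ler_wpM2r// card_option ler_nat.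
have -> : #|{: Bidx}|%:R * (L' * (N + M)) = \sum_(B : Bidx) L' * (N + M).
  by rewrite sumr_const mulr_natl.
apply: ler_sum => B _; rewrite normrM.
apply: ler_pM; [exact: normr_ge0|exact: normr_ge0|exact: (Ld (Some B))|].
rewrite (le_trans (ler_normB _ _))// lerD//.
by case: Bzb => + _; apply.
Qed.

End Near.

Theorem relative_bounds_uniform (R : realType) (psi : xi_space R * R -> R)
    (c p q r l M delta : R) :
  is_C3 psi -> hessian_xi_pos psi -> eta_theta_pos psi ->
  0 < c -> 4 <= p -> 1 < q -> 1 < r -> 1 < l ->
  G1 c p q r l psi -> G2 p q r l psi -> G3 p q r l psi -> 0 < M -> 0 < delta ->
  exists2 C, 0 <= C & forall z zb, 0 < z.2 -> box M delta zb ->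
    relative_bounds psi C z zb.
Proof.
move=> C3 cvx einc c0 p4 q1 r1 l1 g1 g2 g3 M0 d0.
have [K [A [A' [A0 A'0 far]]]] := far_bounds C3 c0 p4 q1 r1 l1 g1 g2 g3 M0 d0.
have [C1 C10 H1] := crude_relative C3 cvx einc M0 d0 A0 A'0.
have p0 : 0 <= p by exact: le_trans p4.
have q0 : 0 <= q by rewrite ltW// (lt_trans ltr01).
have r0 : 0 <= r by rewrite ltW// (lt_trans ltr01).
have l0 : 0 <= l by rewrite ltW// (lt_trans ltr01).
have [C2 C20 H2] := coords_le_growth p4 q1 r1 l1 (@ltr01 R).
(* Large enough for the box of radius [N] to contain the reference box and, in each coordinate, the
   sublevel set where the growth is at most [K]. *)
pose N := M + `|K| + C2.
have MN : M <= N by rewrite /N -addrA lerDl addr_ge0.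
have [A2 [A2' [A20 A2'0 cold]]] :=
  cold_bounds C3 cvx einc c0 p0 q0 r0 l0 g1 M0 d0 MN.
have [C3' C3'0 H3] := crude_relative C3 cvx einc M0 d0 A20 A2'0.
have d20 : 0 < delta / 2 by rewrite divr_gt0.
have [C4 C40 H4] := compact_relative C3 cvx einc N d20.
exists (C1 + C3' + C4); first by rewrite !addr_ge0.
move=> z zb pz Bzb; have [gK|gK] := leP (growth p q r l z) K; last first.
  have [G1' cr GP] := far z zb pz Bzb gK.
  apply: relative_boundsW (H1 z zb _ pz Bzb G1' cr GP).
  by rewrite -addrA lerDl addr_ge0.
have coN o : `|co o z| <= N.
  rewrite (le_trans (H2 z (ltW pz) o))// mul1r /N lerD2r (le_trans gK)//.
  by rewrite (le_trans (ler_norm K))// lerDr ltW.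
have [hot|cd] := leP (delta / 2) z.2; last first.
  have [cr GP] := cold z zb pz (fun B => coN (Some B)) (ltW cd) Bzb.
  apply: relative_boundsW (H3 z zb _ pz Bzb _ cr GP); first by rewrite addrAC lerDr addr_ge0.
  by rewrite lerDl.
have Bz : box N (delta / 2) z.
  split; first by move=> B; exact: (coN (Some B)).
  by rewrite hot (le_trans (ler_norm _))//; exact: (coN None).
have Bzb' : box N (delta / 2) zb.
  case: Bzb => zB /andP[z1 z2]; split; first by move=> B; exact: le_trans (zB B) MN.
  rewrite (le_trans z2 MN) andbT (le_trans _ z1)// ler_pdivrMr// ler_peMr ?ltW//.
  by rewrite ltr1n.
apply: relative_boundsW (H4 z zb Bz Bzb').
by rewrite lerDr addr_ge0.
Qed.

(** * Integration over the torus *)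

(** The second variable is rounded down to a grid of mesh [1 / (n + 1)]. The rounded functions are
    measurable, being built from countably many slices, and they converge pointwise by continuity.
    This yields measurability of continuous functions for the product sigma-algebras. *)
Lemma measurable_slice_continuous d (T : measurableType d) (R : realType)
    (f : T * R -> R) :
  (forall y, measurable_fun setT (fun x => f (x, y))) ->
  (forall x, continuous (fun y => f (x, y))) ->
  measurable_fun setT f.
Proof.
move=> mf cf.
pose k (n : nat) (y : R) := Num.floor (y * n.+1%:R).
pose g n (p : T * R) := f (p.1, (k n p.2)%:~R / n.+1%:R).
apply: (@measurable_fun_cvg _ _ _ _ g) => [n|[x y] _]; last first.
  apply: (@cvg_comp _ _ _ (fun n => (k n y)%:~R / n.+1%:R) (fun z => f (x, z)));
    last exact: cf.
  apply/cvgrPdist_lt => eps eps0; near=> n.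
  have n0 : 0 < n.+1%:R :> R by rewrite ltr0n.
  have /andP[k1 k2] := floor_itv (y * n.+1%:R); rewrite -/(k n y) in k1 k2.
  have h1 : 0 <= y - (k n y)%:~R / n.+1%:R by rewrite subr_ge0 ler_pdivrMr.
  rewrite ger0_norm// ltrBlDr.
  have : n.+1%:R^-1 < eps by near: n; exact: near_infty_natSinv_lt (PosNum eps0).
  move=> h2; have {}h2 : 1 < eps * n.+1%:R by rewrite -ltr_pdivrMr// mul1r.
  rewrite -(ltr_pM2r n0) mulrDl divfK ?gt_eqF//.
  by rewrite (lt_trans k2)// intrD addrC ltrD2r.
move=> _ B mB; rewrite setTI.
have -> : g n @^-1` B = \bigcup_(i : int)
    ([set x | B (f (x, i%:~R / n.+1%:R))] `*` [set y | k n y = i]).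
  apply/seteqP; split=> [[x y] /= Bg|[x y] [i _ [/= Bx ki]]]; last by rewrite /g/= ki.
  by exists (k n y).
apply: countable_bigcupT_measurable => [|i]; first exact: countableP.
apply: measurableX.
  by have := mf (i%:~R / n.+1%:R) measurableT _ mB; rewrite setTI.
rewrite (_ : mkset _ = [set` `[i%:~R / n.+1%:R, (i + 1)%:~R / n.+1%:R[]).
  exact: measurable_itv.
have n0 : 0 < n.+1%:R :> R by rewrite ltr0n.
apply/seteqP; split => y /=; rewrite in_itv/= ler_pdivrMr// ltr_pdivlMr//.
  by move=> <-; exact: floor_itv.
by move=> h; apply: floor_def.
Unshelve. all: by end_near. Qed.

Lemma continuous_pairl (T U : topologicalType) (y : U) : continuous (fun x : T => (x, y)).
Proof.
move=> x; apply: (@cvg_pair _ _ _ (nbhs x) (nbhs x) (nbhs y)); first exact: cvg_id.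
exact: cvg_cst.
Qed.

Lemma continuous_pairr (T U : topologicalType) (x : T) : continuous (fun y : U => (x, y)).
Proof.
move=> y; apply: (@cvg_pair _ _ _ (nbhs y) (nbhs x) (nbhs y)); last exact: cvg_id.
exact: cvg_cst.
Qed.

Lemma sigma_finite_leb2 (R : realType) :
  sigma_finite setT (@lebesgue_measure R \x @lebesgue_measure R)%E.
Proof.
pose G (n : nat) : set (measurableTypeR R) := `[- n%:R, n%:R]%classic.
have mG n : measurable (G n) by exact: measurable_itv.
exists (fun n => G n `*` G n) => [|n].
  apply/seteqP; split=> // -[x y] _; exists (Num.bound (Num.max `|x| `|y|)) => //=.
  have xy0 : 0 <= Num.max `|x : R| `|y : R| by rewrite le_max normr_ge0.
  have := archi_boundP xy0; rewrite gt_max => /andP[xn yn].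
  by rewrite /G/= !in_itv/= -!ler_norml !ltW.
split; first exact: measurableX.
have Gfin : (lebesgue_measure (G n) < +oo)%E.
  by rewrite lebesgue_measure_itv/=; case: ifP => // _; rewrite -EFinB ltry.
rewrite [X in (X < _)%E](product_measure1E _ _ (mG n) (mG n)).
by rewrite lte_mul_pinfty// ge0_fin_numE.
Qed.

(* Instance inference does not find that a product measure is sigma-finite. *)
Definition leb2 (R : realType) := (@lebesgue_measure R \x @lebesgue_measure R)%E.

HB.instance Definition _ (R : realType) := Measure.on (@leb2 R).
HB.instance Definition _ (R : realType) :=
  Measure_isSigmaFinite.Build _ _ _ (@leb2 R) (sigma_finite_leb2 R).

Section Torus.
Context (R : realType).
Local Notation leb := (@lebesgue_measure R).
Local Notation MR := (measurableTypeR R).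
Let I01 : set MR := `[0%R, 1%R]%classic.

Lemma measurable_continuous2 (f : R * R -> R) : continuous f ->
  measurable_fun setT f.
Proof.
move=> cf; apply: measurable_slice_continuous => [y|x].
  apply: continuous_measurable_fun => x.
  apply: (@continuous_comp _ _ _ (fun x : R => (x, y)) f); last exact: cf.
  exact: continuous_pairl.
move=> y; apply: (@continuous_comp _ _ _ (fun y : R => (x, y)) f); last exact: cf.
exact: continuous_pairr.
Qed.

Lemma measurable_continuous3 (f : R * R * R -> R) : continuous f ->
  measurable_fun setT f.
Proof.
move=> cf; apply: measurable_slice_continuous => [y|x].
  apply: measurable_continuous2 => x.
  apply: (@continuous_comp _ _ _ (fun x : R * R => (x, y)) f); last exact: cf.
  exact: continuous_pairl.
move=> y; apply: (@continuous_comp _ _ _ (fun y : R => (x, y)) f); last exact: cf.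
exact: continuous_pairr.
Qed.

Lemma leb01 : leb I01 = 1%E.
Proof. by rewrite lebesgue_measure_itv/= lte_fin ltr01 oppr0 adde0. Qed.

Local Notation mu2 := (leb \x leb)%E.
Local Notation mu3 := ((leb \x leb) \x leb)%E.
Local Notation Q2 := (I01 `*` I01).
Local Notation Q3 := ((I01 `*` I01) `*` I01).

Lemma measurable_I01 : measurable I01.
Proof. exact: measurable_itv. Qed.

Lemma measurable_Q2 : measurable Q2.
Proof. by apply: measurableX; exact: measurable_I01. Qed.

Lemma measurable_Q3 : measurable Q3.
Proof. by apply: measurableX; [exact: measurable_Q2|exact: measurable_I01]. Qed.

Lemma mu2_Q2 : mu2 Q2 = 1%E.
Proof.
transitivity (leb I01 * leb I01)%E; last by rewrite leb01 mule1.
exact: product_measure1E measurable_I01 measurable_I01.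
Qed.

Lemma mu3_Q3 : mu3 Q3 = 1%E.
Proof.
transitivity (mu2 Q2 * leb I01)%E; last by rewrite leb01 mule1 mu2_Q2.
exact: product_measure1E measurable_Q2 measurable_I01.
Qed.

Lemma compact_Q2 : compact (Q2 : set (R * R)).
Proof. by apply: compact_setX; exact: segment_compact. Qed.

Lemma compact_Q3 : compact (Q3 : set (R * R * R)).
Proof. by apply: compact_setX; [exact: compact_Q2|exact: segment_compact]. Qed.

Lemma integrable_continuous2 (f : R * R -> R) : continuous f ->
  mu2.-integrable Q2 (EFin \o f).
Proof.
move=> cf; apply: measurable_bounded_integrable.
- exact: measurable_Q2.
- by apply: (@eq_ind_r _ _ (fun x => (x < +oo)%E) _ _ mu2_Q2); rewrite ltry.
- by apply: measurable_funTS; exact: measurable_continuous2.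
- have [L L0 HL] := @compact_bounded_fun R _ _ f compact_Q2 (fun z _ => cf z).
  exists L; split; first exact: num_real.
  by move=> x Lx z Qz; exact: le_trans (HL z Qz) (ltW Lx).
Qed.

Lemma integrable_continuous3 (f : R * R * R -> R) : continuous f ->
  mu3.-integrable Q3 (EFin \o f).
Proof.
move=> cf; apply: measurable_bounded_integrable.
- exact: measurable_Q3.
- by apply: (@eq_ind_r _ _ (fun x => (x < +oo)%E) _ _ mu3_Q3); rewrite ltry.
- by apply: measurable_funTS; exact: measurable_continuous3.
- have [L L0 HL] := @compact_bounded_fun R _ _ f compact_Q3 (fun z _ => cf z).
  exists L; split; first exact: num_real.
  by move=> x Lx z Qz; exact: le_trans (HL z Qz) (ltW Lx).
Qed.

Lemma continuous_vec3 : continuous (@vec3 R).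
Proof.
move=> y; apply: (@continuous_coords R _ _ 'I_3 (fun i => delta_mx 0 i)
  (@vec3 R) (fun i y => [:: y.1.1; y.1.2; y.2]`_i)).
  move=> z; apply/rowP => j; rewrite mxE summxE (bigD1 j)//= !mxE !eqxx mulr1.
  rewrite big1 ?addr0// => i ij; rewrite !mxE eqxx/=.
  by rewrite eq_sym (negPf ij) mulr0.
move=> [[|[|[|//]]] ?] /=.
- by apply: (@continuous_comp _ _ _ fst fst); exact: cvg_fst.
- by apply: (@continuous_comp _ _ _ fst snd); [exact: cvg_fst|exact: cvg_snd].
- exact: cvg_snd.
Qed.

Definition Tint (f : 'rV[R]_3 -> R) : R := (\int[mu3]_(y in Q3) (f (vec3 y)))%R.

Lemma integrable_vec3 (f : 'rV[R]_3 -> R) : continuous f ->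
  mu3.-integrable Q3 (EFin \o (f \o @vec3 R)).
Proof.
move=> cf; apply: integrable_continuous3 => y.
by apply: continuous_comp; [exact: continuous_vec3|exact: cf].
Qed.

Lemma torus_intE (f : 'rV[R]_3 -> R) : continuous f -> torus_int f = (Tint f)%:E.
Proof.
move=> cf; rewrite /Tint /Rintegral fineK//.
exact: (integrable_fin_num (f := EFin \o (f \o @vec3 R)) measurable_Q3 (integrable_vec3 cf)).
Qed.

(** The fields live on all of [R^3]; uniform bounds are taken on this compact cell, which is where
    the integrals look. *)
Definition in_cell (x : 'rV[R]_3) : Prop := exists2 y, Q3 y & x = vec3 y.

Lemma le_Tint (f g : 'rV[R]_3 -> R) : continuous f -> continuous g ->
  (forall x, in_cell x -> f x <= g x) -> Tint f <= Tint g.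
Proof.
move=> cf cg fg; apply: le_Rintegral.
- exact: measurable_Q3.
- exact: integrable_vec3.
- exact: integrable_vec3.
- by move=> y Qy; apply: fg; exists y.
Qed.

Lemma TintD (f g : 'rV[R]_3 -> R) : continuous f -> continuous g ->
  Tint (fun x => f x + g x) = Tint f + Tint g.
Proof.
move=> cf cg; rewrite /Tint -RintegralD//; first exact: measurable_Q3.
  exact: integrable_vec3.
exact: integrable_vec3.
Qed.

Lemma TintZ (a : R) (f : 'rV[R]_3 -> R) : continuous f ->
  Tint (fun x => a * f x) = a * Tint f.
Proof.
move=> cf; rewrite /Tint -RintegralZl//; first exact: measurable_Q3.
exact: integrable_vec3.
Qed.

Lemma Tint_cst (a : R) : Tint (fun=> a) = a.
Proof.
rewrite /Tint (Rintegral_cst mu3 measurable_Q3).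
by rewrite -[RHS]mulr1; exact: (congr1 (fun x => a * fine x) mu3_Q3).
Qed.

Lemma compact_cell : compact [set x | in_cell x].
Proof.
rewrite (_ : mkset _ = [set @vec3 R y | y in Q3]).
  apply: continuous_compact compact_Q3; apply: continuous_subspaceT.
  exact: continuous_vec3.
by apply/seteqP; split=> [x [y Qy ->]|x [y Qy <-]]; exists y.
Qed.

(** The restriction to the product set is moved into the integrand, which is extended by zero, so
    that Fubini's theorem on the whole space applies. *)
Lemma fubini_zero1 d (T : measurableType d) (m : {sigma_finite_measure set T -> \bar R})
    (A1 : set T) (f : T * R -> R) : measurable A1 ->
  (m \x leb)%E.-integrable (A1 `*` I01) (EFin \o f) ->
  (forall x, A1 x -> (\int[leb]_(y in I01) (f (x, y))%:E = 0)%E) ->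
  (\int[m \x leb]_(z in A1 `*` I01) (f z)%:E = 0)%E.
Proof.
move=> mA fi f0.
have mQ : measurable (A1 `*` I01) by apply: measurableX => //; exact: measurable_I01.
rewrite integral_mkcond -integral12_prod_meas1; last exact/(integrable_mkcond _ mQ).
apply: integral0_eq => x _; rewrite /fubini_F.
have [Ax|Ax] := pselect (A1 x); last first.
  apply: integral0_eq => y _; rewrite patchE ifF//.
  by apply/negbTE; rewrite notin_setE => -[].
rewrite -[RHS](f0 x Ax) [RHS]integral_mkcond; apply: eq_integral => y _.
rewrite !patchE; congr (if _ then _ else _); apply/idP/idP; rewrite !inE//.
by case.
Qed.

Lemma fubini_zero2 d (T : measurableType d) (m : {sigma_finite_measure set T -> \bar R})
    (A1 : set T) (f : T * R -> R) : measurable A1 ->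
  (m \x leb)%E.-integrable (A1 `*` I01) (EFin \o f) ->
  (forall y, I01 y -> (\int[m]_(x in A1) (f (x, y))%:E = 0)%E) ->
  (\int[m \x leb]_(z in A1 `*` I01) (f z)%:E = 0)%E.
Proof.
move=> mA fi f0.
have mQ : measurable (A1 `*` I01) by apply: measurableX => //; exact: measurable_I01.
rewrite integral_mkcond -integral21_prod_meas1; last exact/(integrable_mkcond _ mQ).
apply: integral0_eq => y _; rewrite /fubini_G.
have [Ay|Ay] := pselect (I01 y); last first.
  apply: integral0_eq => x _; rewrite patchE ifF//.
  by apply/negbTE; rewrite notin_setE => -[].
rewrite -[RHS](f0 y Ay) [RHS]integral_mkcond; apply: eq_integral => x _.
rewrite !patchE; congr (if _ then _ else _); apply/idP/idP; rewrite !inE//.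
by case.
Qed.

Lemma integral_period (f df : R -> R) :
  (forall s : R, is_derive s 1 f (df s)) -> continuous df -> f 1 = f 0 ->
  (\int[leb]_(s in I01) (df s)%:E = 0)%E.
Proof.
move=> dfP cdf f10.
have cf s : {for s, continuous f}.
  by apply/differentiable_continuous/derivable1_diffP; have [] := dfP s.
rewrite (@continuous_FTC2 R df f 0 1)// ?f10 -?EFinB ?subrr//.
- by apply: continuous_subspaceT.
- split=> [s _||]; first by have [] := dfP s.
    by apply: cvg_at_right_filter; exact: cf.
  by apply: cvg_at_left_filter; exact: cf.
- by move=> s _; rewrite derive1E; have [_ ->] := dfP s.
Qed.

(** Along a line in direction [al] the derivative integrates over one period to a difference of
    equal values. Fubini's theorem is used with that direction innermost, hence the case distinction
    on [al]. *)
Lemma Tint_period (f : 'rV[R]_3 -> R) (al : 'I_3) :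
  (forall x, derivable f x (delta_mx 0 al)) ->
  continuous ('D_(delta_mx 0 al) f) ->
  (forall x, f (x + delta_mx 0 al) = f x) ->
  Tint ('D_(delta_mx 0 al) f) = 0.
Proof.
move=> df cdf pf; set v := delta_mx 0 al in df cdf pf *.
have line (g : R -> 'rV[R]_3) (w : 'rV[R]_3) : (forall s, g s = w + s *: v) ->
    (\int[leb]_(s in I01) ('D_v f (g s))%:E = 0)%E.
  move=> gE; under eq_integral do rewrite gE.
  apply: (@integral_period (fun s : R => f (w + s *: v)) (fun s : R => 'D_v f (w + s *: v))).
  - by move=> s; apply: is_derive_line; exact: df.
  - move=> s; have cl : {for s, continuous (fun s : R => w + s *: v)}.
      by apply: cvgD; [exact: cvg_cst|apply: cvgZr_tmp; exact: cvg_id].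
    exact: (continuous_comp cl (cdf _)).
  - by rewrite scale1r scale0r addr0 pf.
rewrite /Tint /Rintegral.
suff -> : (\int[mu3]_(y in Q3) ('D_v f (vec3 y))%:E = 0)%E by [].
have I3 := integrable_vec3 cdf.
have vE (a b c : R) i : vec3 (a, b, c) 0 i = [:: a; b; c]`_i by rewrite mxE.
have ve i : v 0 i = (i == al)%:R by rewrite mxE.
case: al @v df cdf pf line I3 ve => -[|[|[|//]]] hal v df cdf pf line I3 ve.
- apply: (@fubini_zero2 _ _ (@leb2 R) Q2 (fun y => 'D_v f (vec3 y)) measurable_Q2 I3).
  move=> c _; apply: (@fubini_zero2 _ _ (@lebesgue_measure R) I01 (fun y => 'D_v f (vec3 (y, c)))).
  + exact: measurable_I01.
  + apply: integrable_continuous2 => y.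
    have cl : {for y, continuous (fun y : R * R => vec3 (y, c))}.
      exact: (continuous_comp (@continuous_pairl _ _ c y) (@continuous_vec3 _)).
    exact: (continuous_comp cl (cdf _)).
  + move=> b _; apply: (line _ (vec3 (0, b, c))) => a.
    by apply/rowP => i; rewrite !mxE; case: i => -[|[|[|//]]] /= _; ring.
- apply: (@fubini_zero2 _ _ (@leb2 R) Q2 (fun y => 'D_v f (vec3 y)) measurable_Q2 I3).
  move=> c _; apply: (@fubini_zero1 _ _ (@lebesgue_measure R) I01 (fun y => 'D_v f (vec3 (y, c)))).
  + exact: measurable_I01.
  + apply: integrable_continuous2 => y.
    have cl : {for y, continuous (fun y : R * R => vec3 (y, c))}.
      exact: (continuous_comp (@continuous_pairl _ _ c y) (@continuous_vec3 _)).
    exact: (continuous_comp cl (cdf _)).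
  + move=> a _; apply: (line _ (vec3 (a, 0, c))) => b.
    by apply/rowP => i; rewrite !mxE; case: i => -[|[|[|//]]] /= _; ring.
- apply: (@fubini_zero1 _ _ (@leb2 R) Q2 (fun y => 'D_v f (vec3 y)) measurable_Q2 I3).
  move=> [a b] _; apply: (line _ (vec3 (a, b, 0))) => c.
  by apply/rowP => i; rewrite !mxE; case: i => -[|[|[|//]]] /= _; ring.
Qed.

End Torus.

(** * Integrals depending on time and Gronwall's inequality *)

Section TimeIntegral.
Context (R : realType).
Let cell_measure : measure _ R :=
  ((@lebesgue_measure R \x @lebesgue_measure R) \x @lebesgue_measure R)%E.
Implicit Types (f : spacetime R -> R) (a b t : R).

Lemma slice_continuous f t : (forall x, {for (x, t), continuous f}) ->
  continuous (fun x => f (x, t)).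
Proof.
move=> cf x; exact: (continuous_comp (@continuous_pairl _ _ t x) (cf x)).
Qed.

Lemma slice_bounded f a b : (forall x t, a <= t <= b -> {for (x, t), continuous f}) ->
  exists2 L, 0 <= L & forall x t, in_cell x -> a <= t <= b -> `|f (x, t)| <= L.
Proof.
move=> cf; have cK := compact_setX (@compact_cell R) (@segment_compact R a b).
have [|L L0 HL] := @compact_bounded_fun R _ _ f cK.
  by move=> [x t] [_ /=]; rewrite in_itv/= => /cf.
by exists L => // x t cx ct; apply: (HL (x, t)); split; rewrite //= in_itv.
Qed.

Lemma sub_itv_around a b t : a < t < b -> exists a' b', [/\ a < a', a' < t, t < b' & b' < b].
Proof.
move=> /andP[at_ tb]; exists ((a + t) / 2), ((t + b) / 2); split; lra.
Qed.

(** Dominated convergence with a constant bound: the maximum over the cell and a compact time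
    interval around [t]. Continuity is assumed in the open interval only, whence the smaller
    interval [[a', b']]. *)
Lemma Tint_continuous f a b :
  (forall x t, a < t < b -> {for (x, t), continuous f}) ->
  forall t, a < t < b -> {for t, continuous (fun t => Tint (fun x => f (x, t)))}.
Proof.
move=> cf t tab; have [a' [b' [aa' a't tb' b'b]]] := sub_itv_around tab.
have sub s : a' <= s <= b' -> a < s < b.
  by move=> /andP[h1 h2]; rewrite (lt_le_trans aa' h1) (le_lt_trans h2 b'b).
have [L L0 HL] := slice_bounded (fun x s sab => cf x s (sub s sab)).
have cs s : a' <= s <= b' -> continuous (fun x => f (x, s)).
  by move=> sab; apply: slice_continuous => x; apply: cf; exact: sub.
have := @continuity_under_integral R _ _ cell_measure (fun s y => f (vec3 y, s)) _
  (@measurable_Q3 R) a' b' _ _ (fun=> L) _ _ t.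
apply.
- move=> s /=; rewrite in_itv/= => /andP[/ltW h1 /ltW h2].
  by apply: (@integrable_vec3 R (fun x => f (x, s))); apply: cs; rewrite h1.
- apply: aeW => y _ s /[!inE]; rewrite /= in_itv/= => /andP[/ltW h1 /ltW h2].
  apply: (continuous_comp (@continuous_pairr _ _ (vec3 y) s)).
  by apply: cf; apply: sub; rewrite h1.
- exact: (@integrable_vec3 R (fun=> L) (@cst_continuous _ _ L)).
- move=> s /=; rewrite in_itv/= => /andP[/ltW h1 /ltW h2]; apply: aeW => y Qy.
  by apply: HL; [exists y|rewrite h1].
- by rewrite inE/= in_itv/= a't.
Qed.

Lemma is_derive_time f x t : derivable f (x, t) (st_dir R None) ->
  is_derive t 1 (fun s => f (x, s)) (d_t f (x, t)).
Proof.
have E s : (x, s) = (x, 0) + s *: st_dir R None :> spacetime R.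
  by congr (_, _); rewrite /= ?scaler0 ?addr0 ?add0r// /GRing.scale/= mulr1.
have -> : (fun s => f (x, s)) = (fun s => f ((x, 0) + s *: st_dir R None)).
  by apply/funext => s; rewrite E.
by rewrite /d_t E; exact: is_derive_line.
Qed.

Lemma Tint_derive f a b :
  (forall x t, a < t < b -> [/\ {for (x, t), continuous f},
     derivable f (x, t) (st_dir R None) & {for (x, t), continuous (d_t f)}]) ->
  forall t, a < t < b ->
    is_derive t 1 (fun t => Tint (fun x => f (x, t))) (Tint (fun x => d_t f (x, t))).
Proof.
move=> cf t tab; have [a' [b' [aa' a't tb' b'b]]] := sub_itv_around tab.
have sub s : a' <= s <= b' -> a < s < b.
  by move=> /andP[h1 h2]; rewrite (lt_le_trans aa' h1) (le_lt_trans h2 b'b).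
have cdf x s : a' <= s <= b' -> {for (x, s), continuous (d_t f)}.
  by move=> /sub/(cf x)[].
have [L L0 HL] := slice_bounded cdf.
have dE x s : a' <= s <= b' -> is_derive s 1 (fun s => f (x, s)) (d_t f (x, s)).
  by move=> /sub/(cf x)[_ d _]; exact: is_derive_time.
have cs s : a' <= s <= b' -> continuous (fun x => f (x, s)).
  by move=> sab; apply: slice_continuous => x; have [] := cf x s (sub s sab).
have ta' : a' <= t <= b' by rewrite !ltW.
have H : h^-1 *: (Tint (fun x => f (x, h + t)) - Tint (fun x => f (x, t)))
    @[h --> 0^'] --> Tint (fun x => d_t f (x, t)).
  rewrite (_ : Tint (fun x => d_t f (x, t)) =
    (\int[cell_measure]_(y in (`[0, 1] `*` `[0, 1]) `*` `[0, 1])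
      partial1of2 (fun s y => f (vec3 y, s)) t y)%R); last first.
    apply: eq_Rintegral => y _; rewrite partial1of2E.
    by rewrite (derive_val (is_derive := dE (vec3 y) t ta')).
  apply: (@cvg_differentiation_under_integral R _ _ cell_measure (fun s y => f (vec3 y, s)) _
    (@measurable_Q3 R) t a' b' _ _ _ (fun=> L)) => //.
  - by rewrite /= in_itv/= a't.
  - move=> s /=; rewrite in_itv/= => /andP[/ltW h1 /ltW h2].
    by apply: (@integrable_vec3 R (fun x => f (x, s))); apply: cs; rewrite h1.
  - move=> s y /=; rewrite in_itv/= => /andP[/ltW h1 /ltW h2] _.
    by have [|//] := dE (vec3 y) s; rewrite h1.
  - exact: (@integrable_vec3 R (fun=> L) (@cst_continuous _ _ L)).
  - move=> s y /=; rewrite in_itv/= => /andP[/ltW h1 /ltW h2] Qy.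
    have sab : a' <= s <= b' by rewrite h1.
    rewrite partial1of2E (derive_val (is_derive := dE (vec3 y) s sab)).
    by apply: HL => //; exists y.
have H' : h^-1 *: (((fun t => Tint (fun x => f (x, t))) \o shift t) (h *: 1) -
    Tint (fun x => f (x, t))) @[h --> 0^'] --> Tint (fun x => d_t f (x, t)).
  by under eq_fun do rewrite /= [_ *: 1]mulr1.
by apply: DeriveDef; [apply/cvg_ex; eexists; exact: H'|exact/cvg_lim].
Qed.

Lemma gronwall_interior (E dE D : R -> R) (C T s t : R) : 0 <= C -> 0 < s -> s < t -> t < T ->
  (forall u, 0 < u < T -> is_derive u 1 E (dE u)) ->
  (forall u, 0 < u < T -> {for u, continuous D}) ->
  (forall u, 0 < u < T -> 0 <= D u /\ 0 <= E u) ->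
  (forall u, 0 < u < T -> dE u <= C * E u + D u) ->
  E t <= expR (C * T) * (E s + (\int[lebesgue_measure]_(u in `[s, t]) D u)%R).
Proof.
move=> C0 s0 st tT dEP cD pos ineq.
(* Room to the right of [t]: [D] is integrable on the compact interval [[s, t']], and [F] is
   differentiable at every interior point, including [t]. *)
pose t' := (t + T) / 2.
have tt' : t < t' by rewrite /t'; lra.
have t'T : t' < T by rewrite /t'; lra.
have inn (u : R) : s <= u <= t' -> 0 < u < T.
  by move=> /andP[su ut]; rewrite (lt_le_trans s0 su) (le_lt_trans ut t'T).
have cD' : {within `[s, t'], continuous D}.
  by apply: continuous_in_subspaceT => u /[!inE]; rewrite /= in_itv/= => /inn/cD.
have iD : lebesgue_measure.-integrable `[s, t'] (EFin \o D).
  by apply: continuous_compact_integrable => //; exact: segment_compact.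
pose F (u : R) := (\int[lebesgue_measure]_(v in `[s, u]) D v)%R.
have dF u : s < u -> u < t' -> is_derive u 1 F (D u).
  move=> su ut; have Du : {for u, continuous D} by apply: cD; apply: inn; rewrite !ltW.
  have [d1 d2] := continuous_FTC1_closed ut iD su Du.
  by apply: DeriveDef; [exact: d1|rewrite -derive1E; exact: d2].
have cF : {within `[s, t'], continuous F}.
  by apply: parameterized_integral_continuous => //; rewrite ltW// (lt_trans st).
(* Nonincreasing, which is the whole argument. The integral of [D] is subtracted without the factor
   [expR (- C * u)], as this factor is at most [1] and [D] is nonnegative. *)
pose G (u : R) := expR (- C * u) * E u - F u.
have dexp (u : R) : is_derive u 1 (fun u => expR (- C * u)) (- C * expR (- C * u)).
  have := @is_derive1_comp R expR (fun u => - C * u) u (expR (- C * u)) (- C).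
  rewrite [- C * expR _]mulrC; apply.
  have := @is_deriveM _ _ (cst (- C)) (@id R) u 1 _ _ (is_derive_cst (- C) u 1) (is_derive_id u 1).
  by move/is_derive_eq; apply; rewrite /GRing.scale/= mulr1 mulr0 addr0.
have dG u : s < u -> u < t' -> is_derive u 1 G (expR (- C * u) * (dE u - C * E u) - D u).
  move=> su ut; have u0T : 0 < u < T by apply: inn; rewrite !ltW.
  have := is_deriveB (is_deriveM (dexp u) (dEP u u0T)) (dF u su ut).
  move/is_derive_eq; apply; rewrite /GRing.scale/=; ring.
have dG0 u : s < u -> u < t' -> expR (- C * u) * (dE u - C * E u) - D u <= 0.
  move=> su ut; have u0T : 0 < u < T by apply: inn; rewrite !ltW.
  have [D0 E0] := pos u u0T; have := ineq u u0T => h.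
  have e1 : expR (- C * u) <= 1.
    by rewrite -expR0 ler_expR mulNr oppr_le0 mulr_ge0// ltW//; case/andP: u0T.
  have e0 := expR_ge0 (- C * u).
  rewrite subr_le0 (@le_trans _ _ (expR (- C * u) * D u))//.
    by rewrite ler_wpM2l// lerBlDl.
  by rewrite ler_piMl.
have cG : {within `[s, t], continuous G}.
  have h1 : {within `[s, t], continuous F}.
    by apply: continuous_subspaceW cF; apply: subset_itvl; rewrite bnd_simp ltW.
  have h2 : {within `[s, t], continuous (fun u => expR (- C * u) * E u)}.
    apply: continuous_in_subspaceT => v /[!inE]; rewrite /= in_itv/= => /andP[sv vt].
    have v0T : 0 < v < T by apply: inn; rewrite sv (le_trans vt)// ltW.
    apply/differentiable_continuous/derivable1_diffP.
    by have [] := is_deriveM (dexp v) (dEP v v0T).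
  move=> u; exact: (cvgB (h2 u) (h1 u)).
have GG : G t <= G s.
  apply: (@ler0_derive1_le_cc R G s t _ _ cG); rewrite ?in_itv/= ?lexx ?(ltW st)//.
    move=> u; rewrite in_itv/= => /andP[su ut].
    by have [] := dG u su (lt_trans ut tt').
  move=> u; rewrite in_itv/= => /andP[su ut]; rewrite derive1E.
  rewrite (derive_val (is_derive := dG u su (lt_trans ut tt'))).
  exact: dG0 su (lt_trans ut tt').
have Fs : F s = 0 by rewrite /F set_itv1 Rintegral_set1.
have F0 : 0 <= F t.
  apply: Rintegral_ge0 => u /=; rewrite in_itv/= => /andP[su ut].
  by have [] := pos u (inn u _) => //; rewrite su (le_trans ut)// ltW.
have s0T : 0 < s < T by rewrite s0 (lt_trans st).
have Es := (pos s s0T).2.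
have es1 : expR (- C * s) * E s <= E s.
  by rewrite ler_piMl// -expR0 ler_expR mulNr oppr_le0 mulr_ge0// ltW.
have H1 : expR (- C * t) * E t <= E s + F t by move: GG; rewrite /G Fs; lra.
have -> : E t = expR (C * t) * (expR (- C * t) * E t).
  by rewrite mulrA -expRD mulNr subrr expR0 mul1r.
apply: ler_pM => //.
- by rewrite mulr_ge0 ?expR_ge0//; apply: (pos t _).2; rewrite (lt_trans s0 st).
- by rewrite ler_expR ler_wpM2l// ltW.
Qed.

Lemma continuous_ge_left (g : R -> R) (a b m : R) : a < b -> {for a, continuous g} ->
  (forall u, a < u < b -> m <= g u) -> m <= g a.
Proof.
move=> ab cg H; have cvg : g @ a^'+ --> g a by exact: cvg_at_right_filter.
apply: (@closed_cvg R R (a^'+) (at_right_proper_filter a) g (fun y => m <= y)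
  (@closed_ge R m) _ (g a) cvg).
near=> u; apply: H.
by apply/andP; split; near: u; [exact: nbhs_right_gt|exact: nbhs_right_lt].
Unshelve. all: by end_near. Qed.

Lemma continuous_le_right (g : R -> R) (a b m : R) : a < b -> {for b, continuous g} ->
  (forall u, a < u < b -> g u <= m) -> g b <= m.
Proof.
move=> ab cg H; have cvg : g @ b^'- --> g b by exact: cvg_at_left_filter.
apply: (@closed_cvg R R (b^'-) (at_left_proper_filter b) g (fun y => y <= m)
  (@closed_le R m) _ (g b) cvg).
near=> u; apply: H.
by apply/andP; split; near: u; [exact: nbhs_left_gt|exact: nbhs_left_lt].
Unshelve. all: by end_near. Qed.

(** The differential inequality is known in the open interval, for [E0]; [E] is a continuous
    function that agrees with it there. The interior estimate is extended by letting the initial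
    time tend to [0] and the final time to [T]. An infinite integral of [D] makes the claim
    trivial. *)
Lemma gronwall (E0 E dE D : R -> R) (C T : R) : 0 <= C -> 0 < T ->
  continuous E -> (forall u, 0 < u < T -> E u = E0 u) ->
  (forall u, 0 < u < T -> is_derive u 1 E0 (dE u)) ->
  (forall u, 0 < u < T -> {for u, continuous D}) ->
  (forall u, 0 < u < T -> 0 <= D u /\ 0 <= E0 u) ->
  (forall u, 0 < u < T -> dE u <= C * E0 u + D u) ->
  forall t, 0 <= t <= T -> ((E t)%:E <= (expR (C * T))%:E *
     ((E 0)%:E + \int[lebesgue_measure]_(s in `]0%R, T[) (D s)%:E))%E.
Proof.
move=> C0 T0 cE EE0 dEP cD pos ineq t tT.
have mD : measurable_fun `]0, T[ D.
  apply: open_continuous_measurable_fun; first exact: interval_open.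
  by move=> u /[!inE]; rewrite /= in_itv/= => /cD.
have mDE : measurable_fun `]0, T[ (EFin \o D) by exact/measurable_EFinP.
have D0 u : (`]0, T[)%classic u -> (0 <= (D u)%:E)%E.
  by rewrite /= in_itv/= lee_fin => /pos[].
have I0 := @integral_ge0 _ _ R (@lebesgue_measure R) `]0, T[ (EFin \o D) D0.
have ex0 := expR_gt0 (C * T).
case J: (\int[lebesgue_measure]_(s in `]0%R, T[) (D s)%:E)%E I0 => [m| |] // I0; last first.
  by rewrite addey// mulry gtr0_sg// mul1e leey.
rewrite -EFinD -EFinM lee_fin.
have H s u : 0 < s -> s < u -> u < T -> E u <= expR (C * T) * (E s + m).
  move=> s0 su uT; have sT := lt_trans su uT; have u0 := lt_trans s0 su.
  have h := gronwall_interior C0 s0 su uT dEP cD pos ineq.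
  rewrite !EE0 ?s0 ?u0 ?sT ?uT//; apply: (le_trans h); rewrite ler_wpM2l ?expR_ge0// lerD2l.
  have sub : `[s, u]%classic `<=` `]0, T[%classic.
    move=> v; rewrite /= !in_itv/= => /andP[h1 h2].
    by rewrite (lt_le_trans s0 h1) (le_lt_trans h2 uT).
  have := @ge0_subset_integral _ _ R (@lebesgue_measure R) `[s, u] `]0, T[ (measurable_itv _)
    (measurable_itv _) (EFin \o D) mDE D0 sub.
  have I1 : (0 <= \int[lebesgue_measure]_(x in `[s, u]) (EFin \o D) x)%E.
    by apply: integral_ge0 => v /sub/D0.
  rewrite /= J /Rintegral; move: I1; case: (integral _ _ _) => [y| |]//= _.
have H0 u : 0 < u -> u < T -> E u <= expR (C * T) * (E 0 + m).
  move=> u0 uT; have cg : continuous (fun s => expR (C * T) * (E s + m)).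
    move=> s; apply: cvgM; first exact: cvg_cst.
    by apply: cvgD; [exact: cE|exact: cvg_cst].
  apply: (@continuous_ge_left (fun s => expR (C * T) * (E s + m)) 0 u _ u0 (cg 0)).
  by move=> s /andP[s0 su]; exact: H.
have H1 u : 0 < u -> u <= T -> E u <= expR (C * T) * (E 0 + m).
  move=> u0 uT; apply: (@continuous_le_right E 0 u _ u0 (cE u)) => s /andP[s0 su].
  by apply: H0 => //; exact: lt_le_trans uT.
move: tT => /andP[t0 tT'].
(* At [t = 0] the estimate reduces to [1 <= expR (C * T)]. *)
move: t0; rewrite le_eqVlt => /predU1P[<-|t0]; last exact: H1.
have E00 : 0 <= E 0.
  apply: (@continuous_ge_left E 0 T 0 T0 (cE 0)) => u uT.
  by rewrite EE0//; exact: (pos u uT).2.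
have m0 : 0 <= m by rewrite -lee_fin.
rewrite (@le_trans _ _ (1 * (E 0 + m)))//; first by rewrite mul1r lerDl.
by rewrite ler_wpM2r ?addr_ge0// -expR0 ler_expR mulr_ge0// ltW.
Qed.

End TimeIntegral.

(** * Fields of class C^1 and null Lagrangians *)

Lemma Cn1_sub_dir (R : realType) (V : normedModType R) (I J : Type) (e : I -> V)
    (h : J -> I) (D : set V) (f : V -> R) :
  Cn e D 1 f -> Cn (e \o h) D 1 f.
Proof. by move=> [cf df]; split=> // j; exact: df. Qed.

Lemma Cn1_subset (R : realType) (V : normedModType R) (I : Type) (e : I -> V)
    (D D' : set V) (f : V -> R) : D' `<=` D -> Cn e D 1 f -> Cn e D' 1 f.
Proof.
move=> sD [cf df]; split=> [z /sD/cf//|i]; have [di [ci _]] := df i.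
by split=> [z /sD/di//|]; split=> // z /sD/ci.
Qed.

Lemma open_open_cyl (R : realType) (T : R) : open (@open_cyl R T%:E).
Proof.
rewrite (_ : open_cyl _ = snd @^-1` `]0, T[%classic); last first.
  apply/seteqP; split => z; rewrite /open_cyl/= in_itv/= lte_fin; last by move=> /andP[].
  by move=> [-> ->].
apply: open_comp; last exact: interval_open.
by move=> z _; exact: cvg_snd.
Qed.

Lemma sum3 (R : nmodType) (f : 'I_3 -> R) : \sum_i f i = f 0 + f 1 + f 2.
Proof.
rewrite !big_ord_recl big_ord0 addr0 addrA.
by congr (f _ + f _ + f _); apply/val_inj.
Qed.

(* Piola's identity, for a gradient [P al i j = d_al F i j]. *)
Lemma dminor3_delta_curl (R : comNzRingType) (P : 'I_3 -> 'M[R]_3) (i a b : 'I_3) :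
  (forall i al be, P al i be = P be i al) ->
  \sum_al dminor3 (P al) (delta_mx i al) a b = 0.
Proof.
move=> PC; have H x y (X : 'I_3 -> R) : \sum_al delta_mx i al x y * X al = (x == i)%:R * X y.
  rewrite (bigD1 y)//= big1 ?addr0; first by rewrite mxE eqxx andbT.
  by move=> al aly; rewrite mxE [y == al]eq_sym (negPf aly) andbF mul0r.
rewrite /dminor3 sumrB !big_split/= !H.
under eq_bigr do rewrite mulrC; rewrite H.
under eq_bigr do rewrite mulrC; rewrite H.
by rewrite (PC (a + 2) (b + 1)) (PC (a + 1) (b + 1)); ring.
Qed.

(** For [P al] the derivative of [F] in direction [al], the sum is the divergence of row [i] of the
    cofactor matrix; its terms cancel in pairs by the symmetry of [P]. *)
Lemma dminor3_curl (R : comNzRingType) (P : 'I_3 -> 'M[R]_3) (F : 'M[R]_3) (i : 'I_3) :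
  (forall i al be, P al i be = P be i al) ->
  \sum_al dminor3 F (P al) i al = 0.
Proof.
move=> PC; rewrite sum3 /dminor3.
have [e11 e12 e21 e22] : [/\ 1 + 1 = 2 :> 'I_3, 1 + 2 = 0 :> 'I_3, 2 + 1 = 0 :> 'I_3
    & 2 + 2 = 1 :> 'I_3] by split; exact/val_inj.
rewrite !e11 !e12 !e21 !e22 !add0r.
rewrite !(PC _ 1 0) !(PC _ 2 0) !(PC _ 2 1); ring.
Qed.

Section Fields.
Context (R : realType) (T : R).
Local Notation D := (@open_cyl R T%:E).
Local Notation e := (@st_dir R).
Local Notation ex := (fun al : 'I_3 => @st_dir R (Some al)).
Local Notation c1 := (Cn e D 1).
Local Notation cx := (Cn ex D 1).
Local Notation pos := (@pos_temp R).
Implicit Types (U : spacetime R -> state R) (z : spacetime R).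
Let oD := @open_open_cyl R T.

(** The regularity shared by the viscous and the reference solution; only interior times are
    concerned. *)
Definition regular U : Prop :=
  [/\ forall o, c1 (fun z => co o (xt (U z))), forall i, c1 (fun z => vel (U z) 0 i) &
      forall z, D z -> 0 < temp (U z)].

Definition curl_free U : Prop := forall z i al be, D z ->
  d_x al (fun y => defgrad (U y) i be) z = d_x be (fun y => defgrad (U y) i al) z.

Lemma c1_is_derive f o z : c1 f -> D z -> is_derive z (e o) f ('D_(e o) f z).
Proof. by move=> cf Dz; have [_ /(_ o)[]] := Cn1E cf Dz. Qed.

Lemma cx_is_derive f al z : cx f -> D z ->
  is_derive z (e (Some al)) f ('D_(e (Some al)) f z).
Proof. by move=> cf Dz; have [_ /(_ al)[]] := Cn1E cf Dz. Qed.

(** The diffusive fluxes are known to be C^1 in space only, so the total flux is handled in this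
    weaker class. *)
Lemma c1_cx f : c1 f -> cx f.
Proof. by move=> cf; exact: (Cn1_sub_dir Some cf). Qed.

Lemma c1_state U f : regular U -> Cn (@xt_dir R) pos 1 f -> c1 (fun z => f (xt (U z))).
Proof.
move=> [cU _ tU] cf.
apply: (@Cn1_comp _ _ _ _ _ oD _ _ _ _ _ (fun z => xt (U z))
  (fun o z => co o (xt (U z))) (@open_pos_temp R) _ _ cU cf) => [z Dz|z].
  exact: tU.
exact: xt_decomp.
Qed.

Lemma derive_state U f o z : regular U -> Cn (@xt_dir R) pos 1 f -> D z ->
  'D_(e o) (fun z => f (xt (U z))) z =
  \sum_o' 'D_(e o) (fun z => co o' (xt (U z))) z * 'D_(xt_dir R o') f (xt (U z)).
Proof.
move=> [cU _ tU] cf Dz; have pz : pos (xt (U z)) := tU z Dz; have [cfz dfz] := Cn1E cf pz.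
apply: (derive_val (is_derive := _)).
apply: (@is_derive_chain R _ _ _ (@xt_dir R) f (fun z => xt (U z))
  (fun o z => co o (xt (U z)))) => [y||o'|o'].
- exact: xt_decomp.
- have := open_nbhs_nbhs (conj (@open_pos_temp R) pz); apply: filterS => y py o'.
  exact: (cf.2 o').1.
- exact: (dfz o').2.
- exact: c1_is_derive.
Qed.

Lemma c1_defgrad U i j : regular U -> c1 (fun z => defgrad (U z) i j).
Proof. by move=> [cU _ _]; exact: (cU (Some (inl (inl (i, j))))). Qed.

Lemma c1_dPhi U B i al : regular U -> c1 (fun z => dPhi B i al (defgrad (U z))).
Proof.
move=> rU; have cF a b := @c1_defgrad U a b rU.
case: B => [[[a b]|[a b]]|[]].
- by under eq_fun do rewrite dPhi_F; exact: Cn1_cst.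
- under eq_fun do rewrite dPhi_zeta /dminor3.
  have k x y : c1 (fun=> delta_mx i al x y : R) by exact: Cn1_cst.
  exact: (Cn1_sub oD
    (Cn1_add oD (Cn1_mul oD (k _ _) (cF _ _)) (Cn1_mul oD (cF _ _) (k _ _)))
    (Cn1_add oD (Cn1_mul oD (k _ _) (cF _ _)) (Cn1_mul oD (cF _ _) (k _ _)))).
- under eq_fun do rewrite dPhi_w /minor3.
  exact: (Cn1_sub oD (Cn1_mul oD (cF _ _) (cF _ _)) (Cn1_mul oD (cF _ _) (cF _ _))).
Qed.

(** The derivative of [Phi^B] is constant, a polarized minor or a minor of [F]. In the last two
    cases the curl condition makes the matrices [P al] symmetric as the two preceding identities
    require. *)
Lemma null_lagrangian U B i z : regular U -> curl_free U -> D z ->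
  \sum_al d_x al (fun z => dPhi B i al (defgrad (U z))) z = 0.
Proof.
move=> rU cU Dz.
pose P al := \matrix_(a, b) d_x al (fun z => defgrad (U z) a b) z.
have dP al a b : is_derive z (e (Some al)) (fun z => defgrad (U z) a b) (P al a b).
  by rewrite mxE; apply: c1_is_derive => //; exact: c1_defgrad.
have PC a al be : P al a be = P be a al by rewrite !mxE; exact: (cU z a al be Dz).
case: B => [[[a b]|[a b]]|[]].
- rewrite big1// => al _; rewrite (_ : (fun z => _) = cst (delta_mx i al a b)).
    exact: derive_cst.
  by apply/funext => y; rewrite dPhi_F.
- rewrite -[RHS](dminor3_delta_curl i a b PC); apply: eq_bigr => al _.
  rewrite (_ : (fun z => _) = (fun z => dminor3 (defgrad (U z)) (delta_mx i al) a b)).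
    apply: (derive_val (is_derive := _)).
    have d x y := dP al x y.
    have k (x y : 'I_3) := is_derive_cst (@delta_mx R 3 3 i al x y) z (e (Some al)).
    have := is_deriveB (is_deriveD (is_deriveM (k (a + 1) (b + 1)) (d (a + 2) (b + 2)))
      (is_deriveM (d (a + 1) (b + 1)) (k (a + 2) (b + 2))))
      (is_deriveD (is_deriveM (k (a + 1) (b + 2)) (d (a + 2) (b + 1)))
      (is_deriveM (d (a + 1) (b + 2)) (k (a + 2) (b + 1)))).
    move/is_derive_eq; apply; rewrite /dminor3 /GRing.scale/=; ring.
  by apply/funext => y; rewrite dPhi_zeta.
- rewrite -[RHS](dminor3_curl (defgrad (U z)) i PC); apply: eq_bigr => al _.
  rewrite (_ : (fun z => _) = (fun z => minor3 (defgrad (U z)) i al)).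
    apply: (derive_val (is_derive := _)).
    have d x y := dP al x y.
    have := is_deriveB (is_deriveM (d (i + 1) (al + 1)) (d (i + 2) (al + 2)))
      (is_deriveM (d (i + 1) (al + 2)) (d (i + 2) (al + 1))).
    move/is_derive_eq; apply; rewrite /dminor3 /GRing.scale/=; ring.
  by apply/funext => y; rewrite dPhi_w.
Qed.

End Fields.

(** * The balance of relative entropy *)

(* Values at one point: [b] marks quantities of [Ubar], a final [t] or [x] a derivative in time
   or space, and an initial [D] the derivative of a flux; the index [a] is the direction. *)
Lemma entropy_flux_algebra (R : comPzRingType) (I B : finType)
    (v vb vt vbt Dte Dh hq Dhq thbx : I -> R) (S DS visc Dvisc ubx : I -> I -> R)
    (p pb pbt xib xi xibt xit : B -> R) (pbx Dphv : B -> I -> R)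
    (dph ph : B -> I -> I -> R) (TEt thb thbt etat eta psibt prod : R) :
  TEt = \sum_a (Dte a + Dh a) ->
  (forall i, vt i = \sum_a (DS i a + Dvisc i a)) ->
  etat = \sum_a Dhq a + prod ->
  (forall b, xit b = \sum_a Dphv b a) ->
  (forall b i, \sum_a dph b i a = 0) ->
  (forall i a, S i a = \sum_b p b * ph b i a) ->
  TEt - \sum_i (v i * vbt i + vb i * vt i) + \sum_i vb i * vbt i
    - (thb * etat + eta * thbt) - psibt
    - \sum_b (pb b * (xit b - xibt b) + (xi b - xib b) * pbt b)
  - \sum_a (Dte a + Dh a - \sum_i (vb i * DS i a + S i a * ubx i a)
      - \sum_i (vb i * Dvisc i a + visc i a * ubx i a)
      - (thb * Dhq a + hq a * thbx a)
      - \sum_b (pb b * Dphv b a + (\sum_i ph b i a * v i) * pbx b a)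
      + \sum_b (pb b * (\sum_i (ph b i a * ubx i a + vb i * dph b i a))
                + (\sum_i ph b i a * vb i) * pbx b a))
  = - (\sum_i (v i - vb i) * vbt i) - thbt * eta - psibt + \sum_b pb b * xibt b
    - \sum_b (xi b - xib b) * pbt b
    + \sum_a \sum_b (p b - pb b) * (\sum_i ph b i a * ubx i a)
    + \sum_a \sum_i visc i a * ubx i a + \sum_a hq a * thbx a
    + \sum_a \sum_b (\sum_i ph b i a * (v i - vb i)) * pbx b a - thb * prod.
Proof.
move=> hT hv he hx null hS.
have A1 : \sum_i vb i * vt i = \sum_a \sum_i vb i * DS i a + \sum_a \sum_i vb i * Dvisc i a.
  rewrite [in RHS]exchange_big [X in _ = _ + X]exchange_big -big_split; apply: eq_bigr => i _.
  by rewrite hv mulr_sumr -big_split/=; apply: eq_bigr => a _; rewrite mulrDr.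
have A3 : thb * etat = \sum_a thb * Dhq a + thb * prod by rewrite he mulrDr mulr_sumr.
have A4 : \sum_b pb b * xit b = \sum_a \sum_b pb b * Dphv b a.
  by rewrite exchange_big; apply: eq_bigr => b _; rewrite hx mulr_sumr.
(* The null Lagrangian identity removes the derivatives of [ph]. *)
have A5 : \sum_a \sum_b pb b * (\sum_i (ph b i a * ubx i a + vb i * dph b i a))
    = \sum_a \sum_b pb b * (\sum_i ph b i a * ubx i a).
  rewrite exchange_big [RHS]exchange_big; apply: eq_bigr => b _.
  rewrite -!mulr_sumr; congr (_ * _).
  under eq_bigr do rewrite big_split/=.
  rewrite big_split/= [X in _ + X]exchange_big/= [X in _ + X]big1 ?addr0// => i _.
  by rewrite -mulr_sumr null mulr0.
have A6 : \sum_a \sum_i S i a * ubx i a = \sum_a \sum_b p b * (\sum_i ph b i a * ubx i a).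
  apply: eq_bigr => a _; under [RHS]eq_bigr do rewrite mulr_sumr.
  rewrite [RHS]exchange_big; apply: eq_bigr => i _; rewrite hS mulr_suml.
  by apply: eq_bigr => b _; rewrite mulrA.
have A7 : \sum_a \sum_b (p b - pb b) * (\sum_i ph b i a * ubx i a) =
    \sum_a \sum_b p b * (\sum_i ph b i a * ubx i a)
    - \sum_a \sum_b pb b * (\sum_i ph b i a * ubx i a).
  rewrite -sumrB; apply: eq_bigr => a _; rewrite -sumrB; apply: eq_bigr => b _.
  by rewrite mulrBl.
have A8 : \sum_a \sum_b (\sum_i ph b i a * (v i - vb i)) * pbx b a =
    \sum_a \sum_b (\sum_i ph b i a * v i) * pbx b a
    - \sum_a \sum_b (\sum_i ph b i a * vb i) * pbx b a.
  rewrite -sumrB; apply: eq_bigr => a _; rewrite -sumrB; apply: eq_bigr => b _.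
  by rewrite -mulrBl -sumrB; congr (_ * _); apply: eq_bigr => i _; rewrite mulrBr.
have A9 : \sum_b (pb b * (xit b - xibt b) + (xi b - xib b) * pbt b) =
    \sum_b pb b * xit b - \sum_b pb b * xibt b + \sum_b (xi b - xib b) * pbt b.
  by rewrite -sumrB -big_split; apply: eq_bigr => b _; rewrite mulrBr.
have A10 : \sum_i (v i - vb i) * vbt i = \sum_i v i * vbt i - \sum_i vb i * vbt i.
  by rewrite -sumrB; apply: eq_bigr => i _; rewrite mulrBl.
have A11 : \sum_a (Dte a + Dh a - \sum_i (vb i * DS i a + S i a * ubx i a)
      - \sum_i (vb i * Dvisc i a + visc i a * ubx i a)
      - (thb * Dhq a + hq a * thbx a)
      - \sum_b (pb b * Dphv b a + (\sum_i ph b i a * v i) * pbx b a)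
      + \sum_b (pb b * (\sum_i (ph b i a * ubx i a + vb i * dph b i a))
                + (\sum_i ph b i a * vb i) * pbx b a)) =
  TEt - (\sum_a \sum_i vb i * DS i a + \sum_a \sum_i S i a * ubx i a)
  - (\sum_a \sum_i vb i * Dvisc i a + \sum_a \sum_i visc i a * ubx i a)
  - (\sum_a thb * Dhq a + \sum_a hq a * thbx a)
  - (\sum_a \sum_b pb b * Dphv b a + \sum_a \sum_b (\sum_i ph b i a * v i) * pbx b a)
  + (\sum_a \sum_b pb b * (\sum_i (ph b i a * ubx i a + vb i * dph b i a))
    + \sum_a \sum_b (\sum_i ph b i a * vb i) * pbx b a).
  rewrite hT -!big_split/= -!sumrB -big_split/=; apply: eq_bigr => a _.
  by rewrite !big_split/=; ring.
rewrite A11 A9 A10 A8 A7 A5 A6 A4 big_split/= A1 A3; ring.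
Qed.

(** The time derivatives of [Ubar] are replaced by their equations, which turns linear terms into
    differences [ph - phb]. What is left is completed to Taylor remainders: [H] is the Hessian of
    the potential at [Ubar], [abt] the time derivative of the state, [rel] the remainders of the
    first derivatives. *)
Lemma entropy_production_algebra (R : comPzRingType) (I B : finType)
    (v vb vbt : I -> R) (ubx : I -> I -> R) (p pb pbt xi xib xibt : B -> R)
    (pbx : B -> I -> R) (ph phb : B -> I -> I -> R) (thbt eta etab psibt dth : R)
    (rel abt : option B -> R) (H : option B -> option B -> R) :
  (forall i, vbt i = \sum_a \sum_b phb b i a * pbx b a) ->
  (forall b, xibt b = \sum_a \sum_i phb b i a * ubx i a) ->
  psibt = \sum_b pb b * xibt b - etab * thbt ->
  (forall b, abt (Some b) = xibt b) -> abt None = thbt ->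
  (forall o o', H o o' = H o' o) ->
  (forall b, pbt b = \sum_o abt o * H (Some b) o) ->
  \sum_o abt o * H None o = 0 ->
  (forall b, rel (Some b) = p b - pb b
     - (\sum_b' (xi b' - xib b') * H (Some b) (Some b') + dth * H (Some b) None)) ->
  rel None = - (eta - etab)
     - (\sum_b' (xi b' - xib b') * H None (Some b') + dth * H None None) ->
  - (\sum_i (v i - vb i) * vbt i) - thbt * eta - psibt + \sum_b pb b * xibt b
    - \sum_b (xi b - xib b) * pbt b
    + \sum_a \sum_b (p b - pb b) * (\sum_i ph b i a * ubx i a)
    + \sum_a \sum_b (\sum_i ph b i a * (v i - vb i)) * pbx b a
  = \sum_a \sum_b (p b - pb b) * (\sum_i (ph b i a - phb b i a) * ubx i a)
    + \sum_a \sum_b (\sum_i (ph b i a - phb b i a) * (v i - vb i)) * pbx b a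
    + \sum_o abt o * rel o.
Proof.
move=> hv hx hpsi aS aN Hs hp heta rS rN.
have A1 : \sum_i (v i - vb i) * vbt i =
    \sum_a \sum_b (\sum_i phb b i a * (v i - vb i)) * pbx b a.
  under eq_bigr do rewrite hv mulr_sumr.
  rewrite exchange_big; apply: eq_bigr => a _.
  under eq_bigr do rewrite mulr_sumr.
  rewrite exchange_big; apply: eq_bigr => b _; rewrite mulr_suml.
  by apply: eq_bigr => i _; rewrite mulrCA mulrA.
have A2 : \sum_b xibt b * (p b - pb b) =
    \sum_a \sum_b (p b - pb b) * (\sum_i phb b i a * ubx i a).
  rewrite exchange_big; apply: eq_bigr => b _.
  by rewrite hx -mulr_sumr mulrC.
have A3 : \sum_a \sum_b (p b - pb b) * (\sum_i (ph b i a - phb b i a) * ubx i a) =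
    \sum_a \sum_b (p b - pb b) * (\sum_i ph b i a * ubx i a)
    - \sum_a \sum_b (p b - pb b) * (\sum_i phb b i a * ubx i a).
  rewrite -sumrB; apply: eq_bigr => a _; rewrite -sumrB; apply: eq_bigr => b _.
  by rewrite -mulrBr -sumrB; congr (_ * _); apply: eq_bigr => i _; rewrite mulrBl.
have A4 : \sum_a \sum_b (\sum_i (ph b i a - phb b i a) * (v i - vb i)) * pbx b a =
    \sum_a \sum_b (\sum_i ph b i a * (v i - vb i)) * pbx b a
    - \sum_a \sum_b (\sum_i phb b i a * (v i - vb i)) * pbx b a.
  rewrite -sumrB; apply: eq_bigr => a _; rewrite -sumrB; apply: eq_bigr => b _.
  by rewrite -mulrBl -sumrB; congr (_ * _); apply: eq_bigr => i _; rewrite mulrBl.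
(* Symmetry of [H] moves the time derivative onto the other index. The terms in [dth] may be added
   freely: their sum is a multiple of the time derivative of the entropy of [Ubar], which is
   zero. *)
have A5 : \sum_b (xi b - xib b) * pbt b = \sum_o abt o *
    (\sum_b' (xi b' - xib b') * H o (Some b') + dth * H o None).
  under [RHS]eq_bigr do rewrite mulrDr.
  rewrite big_split/= [X in _ + X](_ : _ = 0) ?addr0; last first.
    transitivity (dth * \sum_o abt o * H None o); last by rewrite heta mulr0.
    rewrite mulr_sumr; apply: eq_bigr => o _.
    by rewrite mulrCA Hs.
  under [RHS]eq_bigr do rewrite mulr_sumr.
  rewrite [RHS]exchange_big; apply: eq_bigr => b _; rewrite hp mulr_sumr.
  by apply: eq_bigr => o _; rewrite mulrCA Hs.
have A6 : \sum_o abt o * rel o = \sum_b xibt b * (p b - pb b) - thbt * (eta - etab)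
    - \sum_b (xi b - xib b) * pbt b.
  rewrite A5 (_ : \sum_b xibt b * (p b - pb b) - thbt * (eta - etab)
    = \sum_o abt o * (if o is Some b then p b - pb b else - (eta - etab))).
    rewrite -sumrB; apply: eq_bigr => -[b|] _; rewrite ?rS ?rN; ring.
  rewrite sum_option aN addrC mulrN; congr (_ + _).
  by apply: eq_bigr => b _; rewrite aS.
rewrite A6 A4 A3 A2 A1 hpsi; ring.
Qed.

(** * Differentiating the relative entropy and its fluxes *)

Section DeriveRules.
Context (R : realType) (V : normedModType R).
Implicit Types (f g : V -> R) (x v : V).

Lemma is_derive_add f g x v (df dg : R) : is_derive x v f df -> is_derive x v g dg ->
  is_derive x v (fun y => f y + g y) (df + dg).
Proof. by move=> h1 h2; exact: is_deriveD. Qed.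

Lemma is_derive_sub f g x v (df dg : R) : is_derive x v f df -> is_derive x v g dg ->
  is_derive x v (fun y => f y - g y) (df - dg).
Proof. by move=> h1 h2; exact: is_deriveB. Qed.

Lemma is_derive_mul f g x v (df dg : R) : is_derive x v f df -> is_derive x v g dg ->
  is_derive x v (fun y => f y * g y) (f x * dg + g x * df).
Proof. by move=> h1 h2; exact: is_deriveM. Qed.

End DeriveRules.

Lemma mxnorm2_sqr (R : realType) (v : 'rV[R]_3) : mxnorm2 v ^+ 2 = \sum_i v 0 i ^+ 2.
Proof.
rewrite sqr_sqrtr; last by do 2 (apply: sumr_ge0 => ? _); exact: sqr_ge0.
by rewrite big_ord1.
Qed.

(** Apart from the terms in [Ub] alone, each term is the total energy of [U] or a product of a
    velocity, entropy or [xi] of [U], whose evolution is prescribed, with a function of [Ub]. This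
    form can be differentiated term by term. *)
Lemma rel_entropyE (R : realType) (psi : xi_space R * R -> R) (U Ub : state R) :
  rel_entropy psi U Ub = total_energy psi U - \sum_i vel U 0 i * vel Ub 0 i
    + \sum_i 2^-1 * (vel Ub 0 i * vel Ub 0 i)
    - temp Ub * eta psi (xt U) - psi (xt Ub)
    - \sum_B psi_xi psi B (xt Ub) * (comp (xi U) B - comp (xi Ub) B).
Proof.
have -> : rel_entropy psi U Ub =
    rel_pot psi (xt U) (xt Ub) + 2^-1 * mxnorm2 (vel U - vel Ub) ^+ 2.
  by rewrite /rel_entropy /rel_pot addrAC.
rewrite rel_pot_energyE /total_energy !mxnorm2_sqr.
have -> : 2^-1 * \sum_i (vel U - vel Ub) 0 i ^+ 2 = 2^-1 * \sum_i vel U 0 i ^+ 2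
    - \sum_i vel U 0 i * vel Ub 0 i + \sum_i 2^-1 * (vel Ub 0 i * vel Ub 0 i).
  rewrite !mulr_sumr -sumrB -big_split/=; apply: eq_bigr => i _; rewrite !mxE.
  by field.
by rewrite /=; ring.
Qed.

Lemma sum_add_null (R : pzRingType) (I : finType) (c : R) (f g : I -> R) :
  \sum_i g i = 0 -> \sum_i (c * g i + f i) = \sum_i f i.
Proof. by move=> g0; rewrite big_split/= -mulr_sumr g0 mulr0 add0r. Qed.

Lemma rel2_sum (R : realType) (f : xi_space R * R -> R) z zb :
  rel2 f z zb = f z - f zb - (\sum_B (comp z.1 B - comp zb.1 B) * 'D_(xt_dir R (Some B)) f zb
    + (z.2 - zb.2) * 'D_(xt_dir R None) f zb).
Proof.
rewrite /rel2 sum_option coB; congr (_ - _).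
rewrite [LHS]addrC; congr (_ + _).
by apply: eq_bigr => B _; rewrite coB.
Qed.

Section Balance.
Context (R : realType) (psi : xi_space R * R -> R) (T : R).
Context (mu k : 'M[R]_3 * R -> R) (U Ub : spacetime R -> state R).
Local Notation D := (@open_cyl R T%:E).
Local Notation e := (@st_dir R).
Local Notation ex := (fun al : 'I_3 => @st_dir R (Some al)).
Local Notation c1 := (Cn e D 1).
Local Notation cx := (Cn ex D 1).
Local Notation pos := (@pos_temp R).
Hypothesis psi_C3 : is_C3 psi.
Hypothesis rU : regular T U.
Hypothesis rUb : regular T Ub.
Hypothesis sysU : forall z, D z -> viscous_system psi mu k U z.
Hypothesis sysUb : forall z, D z -> adiabatic_system psi Ub z.
Hypothesis entU : entropy_production psi mu k T%:E U.
Hypothesis entUb : forall z, D z -> d_t (fun y => eta psi (xt (Ub y))) z = 0.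
Hypothesis cx_visc : forall i al, cx (visc_flux mu i al U).
Hypothesis cx_heat : forall al, cx (heat_flux k al U).
Let oD := @open_open_cyl R T.
Implicit Types z : spacetime R.

(* The fluxes of the energy, minus [vbar], [thetabar] and [psi_B(Ubar)] times those of the
   momentum, the entropy and [xi^B]; the last sum turns [v dpsi_B(Ubar)] into the difference
   [(v - vbar) dpsi_B(Ubar)]. *)
Definition entropy_flux (al : 'I_3) z : R :=
  \sum_i stress psi i al (U z) * vel (U z) 0 i
  + \sum_i vel (U z) 0 i * visc_flux mu i al U z + heat_flux k al U z
  - \sum_i vel (Ub z) 0 i * stress psi i al (U z)
  - \sum_i vel (Ub z) 0 i * visc_flux mu i al U z
  - temp (Ub z) * (heat_flux k al U z / temp (U z))
  - \sum_B psi_xi psi B (xt (Ub z)) * (\sum_i dPhi B i al (defgrad (U z)) * vel (U z) 0 i)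
  + \sum_B psi_xi psi B (xt (Ub z)) * (\sum_i dPhi B i al (defgrad (U z)) * vel (Ub z) 0 i).

Definition entropy_source z : R :=
  \sum_(al < 3) \sum_B (psi_xi psi B (xt (U z)) - psi_xi psi B (xt (Ub z))) *
    (\sum_i (dPhi B i al (defgrad (U z)) - dPhi B i al (defgrad (Ub z))) *
      d_x al (fun y => vel (Ub y) 0 i) z)
  + \sum_(al < 3) \sum_B
    (\sum_i (dPhi B i al (defgrad (U z)) - dPhi B i al (defgrad (Ub z))) *
      (vel (U z) 0 i - vel (Ub z) 0 i)) * d_x al (fun y => psi_xi psi B (xt (Ub y))) z
  + \sum_o d_t (fun y => co o (xt (Ub y))) z *
      rel2 ('D_(xt_dir R o) psi) (xt (U z)) (xt (Ub z)).

(** The negative term is the entropy production of [U] weighted by [thetabar]; it pays for the two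
    cross terms. *)
Definition entropy_diffusion z : R :=
  \sum_(al < 3) \sum_i visc_flux mu i al U z * d_x al (fun y => vel (Ub y) 0 i) z
  + \sum_(al < 3) heat_flux k al U z / temp (U z) * d_x al (fun y => temp (Ub y)) z
  - temp (Ub z) * (k (Ft (U z)) * grad_temp_sq U z / temp (U z) ^+ 2
      + mu (Ft (U z)) * grad_vel_sq U z / temp (U z)).

Lemma c1_vel (W : spacetime R -> state R) i : regular T W -> c1 (fun z => vel (W z) 0 i).
Proof. by case=> _ /(_ i). Qed.

Lemma c1_temp (W : spacetime R -> state R) : regular T W -> c1 (fun z => temp (W z)).
Proof. by case=> /(_ None). Qed.

Lemma c1_comp_xi (W : spacetime R -> state R) B :
  regular T W -> c1 (fun z => comp (xi (W z)) B).
Proof. by case=> /(_ (Some B)). Qed.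

Lemma c1_psi_xi (W : spacetime R -> state R) B :
  regular T W -> c1 (fun z => psi_xi psi B (xt (W z))).
Proof. move=> rW; apply: c1_state => //; exact: CnW (dpsi_Cn2 psi_C3 (Some B)). Qed.

Lemma c1_eta (W : spacetime R -> state R) : regular T W -> c1 (fun z => eta psi (xt (W z))).
Proof.
move=> rW; apply: (c1_state rW); apply: Cn1_opp; first exact: open_pos_temp.
exact: CnW (dpsi_Cn2 psi_C3 None).
Qed.

Lemma c1_psi (W : spacetime R -> state R) : regular T W -> c1 (fun z => psi (xt (W z))).
Proof. by move=> rW; apply: (c1_state rW); exact: CnW (CnW (psi_Cn3 psi_C3)). Qed.

Lemma c1_total_energy (W : spacetime R -> state R) :
  regular T W -> c1 (fun z => total_energy psi (W z)).
Proof.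
move=> rW; under eq_fun do rewrite /total_energy mxnorm2_sqr /energy.
have v2 : c1 (fun z => \sum_i vel (W z) 0 i ^+ 2).
  exact: (Cn1_sum oD (index_enum 'I_3) (fun i => Cn1_mul oD (c1_vel i rW) (c1_vel i rW))).
have dpsi : c1 (fun z => psi_theta psi (xt (W z))).
  exact: (c1_state rW (CnW (dpsi_Cn2 psi_C3 None))).
have half : c1 (fun=> 2^-1) by exact: Cn1_cst.
have h1 : c1 (fun z => 2^-1 * \sum_i vel (W z) 0 i ^+ 2) by exact: (Cn1_mul oD half v2).
have h2 : c1 (fun z => psi (xt (W z)) - temp (W z) * psi_theta psi (xt (W z))).
  exact: (Cn1_sub oD (c1_psi rW) (Cn1_mul oD (c1_temp rW) dpsi)).
exact: (Cn1_add oD h1 h2).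
Qed.

Lemma c1_stress (W : spacetime R -> state R) i al :
  regular T W -> c1 (fun z => stress psi i al (W z)).
Proof.
move=> rW; exact: (Cn1_sum oD (index_enum Bidx)
  (fun B => Cn1_mul oD (c1_psi_xi B rW) (c1_dPhi B i al rW))).
Qed.

Lemma regular_curl_free (W : spacetime R -> state R) :
  (forall z, D z -> forall i al be : 'I_3,
    d_x al (fun y => defgrad (W y) i be) z - d_x be (fun y => defgrad (W y) i al) z = 0) ->
  curl_free T W.
Proof. by move=> H z i al be Dz; apply/eqP; rewrite -subr_eq0 H. Qed.

Lemma cx_heat_temp al : cx (fun z => heat_flux k al U z / temp (U z)).
Proof.
apply: Cn1_mul => //; apply: Cn1_inv => //; first exact/c1_cx/c1_temp.
by move=> z Dz; rewrite gt_eqF//; case: rU => _ _; exact.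
Qed.

Lemma cx_entropy_flux al : cx (entropy_flux al).
Proof.
have vU i := c1_cx (c1_vel i rU); have vUb i := c1_cx (c1_vel i rUb).
have sU i := c1_cx (c1_stress i al rU).
have pB B := c1_cx (c1_psi_xi B rUb).
have ph B i := c1_cx (c1_dPhi B i al rU).
have tb := c1_cx (c1_temp rUb); have hq := cx_heat_temp al.
have sum3 (f : 'I_3 -> spacetime R -> R) : (forall i, cx (f i)) -> cx (fun z => \sum_i f i z).
  by move=> cf; exact: (Cn1_sum oD (index_enum 'I_3) cf).
have sumB (f : Bidx -> spacetime R -> R) : (forall B, cx (f B)) -> cx (fun z => \sum_B f B z).
  by move=> cf; exact: (Cn1_sum oD (index_enum Bidx) cf).
have F (w : 'I_3 -> spacetime R -> R) : (forall i, cx (w i)) -> cx (fun z =>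
    \sum_B psi_xi psi B (xt (Ub z)) * (\sum_i dPhi B i al (defgrad (U z)) * w i z)).
  move=> cw; apply: sumB => B; apply: (Cn1_mul oD (pB B)).
  by apply: sum3 => i; exact: (Cn1_mul oD (ph B i) (cw i)).
have t1 := sum3 _ (fun i => Cn1_mul oD (sU i) (vU i)).
have t2 := sum3 _ (fun i => Cn1_mul oD (vU i) (cx_visc i al)).
have t3 := sum3 _ (fun i => Cn1_mul oD (vUb i) (sU i)).
have t4 := sum3 _ (fun i => Cn1_mul oD (vUb i) (cx_visc i al)).
exact: (Cn1_add oD (Cn1_sub oD (Cn1_sub oD (Cn1_sub oD (Cn1_sub oD
  (Cn1_add oD (Cn1_add oD t1 t2) (cx_heat al)) t3) t4) (Cn1_mul oD tb hq)) (F _ vU)) (F _ vUb)).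
Qed.

Local Notation phi B i al := (fun y : spacetime R => dPhi B i al (defgrad (U y))).
Local Notation phiv B al :=
  (fun y : spacetime R => \sum_i dPhi B i al (defgrad (U y)) * vel (U y) 0 i).
Local Notation pbar B := (fun y : spacetime R => psi_xi psi B (xt (Ub y))).

Lemma derive_entropy_flux al z : D z -> d_x al (entropy_flux al) z =
  d_x al (fun y => \sum_i stress psi i al (U y) * vel (U y) 0 i) z
  + d_x al (fun y => \sum_i vel (U y) 0 i * visc_flux mu i al U y) z
  + d_x al (heat_flux k al U) z
  - \sum_i (vel (Ub z) 0 i * d_x al (fun y => stress psi i al (U y)) z
            + stress psi i al (U z) * d_x al (fun y => vel (Ub y) 0 i) z)
  - \sum_i (vel (Ub z) 0 i * d_x al (visc_flux mu i al U) z
            + visc_flux mu i al U z * d_x al (fun y => vel (Ub y) 0 i) z)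
  - (temp (Ub z) * d_x al (fun y => heat_flux k al U y / temp (U y)) z
     + heat_flux k al U z / temp (U z) * d_x al (fun y => temp (Ub y)) z)
  - \sum_B (psi_xi psi B (xt (Ub z)) * d_x al (phiv B al) z
     + (\sum_i dPhi B i al (defgrad (U z)) * vel (U z) 0 i) * d_x al (pbar B) z)
  + \sum_B (psi_xi psi B (xt (Ub z)) *
       (\sum_i (dPhi B i al (defgrad (U z)) * d_x al (fun y => vel (Ub y) 0 i) z
               + vel (Ub z) 0 i * d_x al (phi B i al) z))
     + (\sum_i dPhi B i al (defgrad (U z)) * vel (Ub z) 0 i) * d_x al (pbar B) z).
Proof.
move=> Dz; pose a := e (Some al).
have vU i := c1_is_derive (Some al) (c1_vel i rU) Dz.
have vUb i := c1_is_derive (Some al) (c1_vel i rUb) Dz.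
have sU i := c1_is_derive (Some al) (c1_stress i al rU) Dz.
have pB B := c1_is_derive (Some al) (c1_psi_xi B rUb) Dz.
have ph B i : is_derive z a (phi B i al) (d_x al (phi B i al) z).
  exact: (c1_is_derive (Some al) (c1_dPhi B i al rU) Dz).
have tb := c1_is_derive (Some al) (c1_temp rUb) Dz.
have vi i := cx_is_derive al (cx_visc i al) Dz.
have he := cx_is_derive al (cx_heat al) Dz.
have hq := cx_is_derive al (cx_heat_temp al) Dz.
have phv B : is_derive z a (phiv B al) (d_x al (phiv B al) z).
  exact/derivableP/ex_derive/(is_derive_bigsum (index_enum 'I_3)
    (fun i => is_derive_mul (ph B i) (vU i))).
have sv : is_derive z a (fun y => \sum_i stress psi i al (U y) * vel (U y) 0 i)
    (d_x al (fun y => \sum_i stress psi i al (U y) * vel (U y) 0 i) z).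
  exact/derivableP/ex_derive/(is_derive_bigsum (index_enum 'I_3)
    (fun i => is_derive_mul (sU i) (vU i))).
have vv : is_derive z a (fun y => \sum_i vel (U y) 0 i * visc_flux mu i al U y)
    (d_x al (fun y => \sum_i vel (U y) 0 i * visc_flux mu i al U y) z).
  exact/derivableP/ex_derive/(is_derive_bigsum (index_enum 'I_3)
    (fun i => is_derive_mul (vU i) (vi i))).
have t3 := is_derive_bigsum (index_enum 'I_3) (fun i => is_derive_mul (vUb i) (sU i)).
have t4 := is_derive_bigsum (index_enum 'I_3) (fun i => is_derive_mul (vUb i) (vi i)).
have t6 := is_derive_bigsum (index_enum Bidx) (fun B => is_derive_mul (pB B) (phv B)).
have t7 := is_derive_bigsum (index_enum Bidx) (fun B => is_derive_mul (pB B)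
  (is_derive_bigsum (index_enum 'I_3) (fun i => is_derive_mul (ph B i) (vUb i)))).
exact: (derive_val (is_derive := is_derive_add (is_derive_sub (is_derive_sub (is_derive_sub
  (is_derive_sub (is_derive_add (is_derive_add sv vv) he) t3) t4)
  (is_derive_mul tb hq)) t6) t7)).
Qed.

Lemma c1_rel_entropy : c1 (fun z => rel_entropy psi (U z) (Ub z)).
Proof.
under eq_fun do rewrite rel_entropyE.
have half : c1 (fun=> 2^-1) by exact: Cn1_cst.
have t1 := Cn1_sum oD (index_enum 'I_3) (fun i => Cn1_mul oD (c1_vel i rU) (c1_vel i rUb)).
have t2 := Cn1_sum oD (index_enum 'I_3) (fun i => Cn1_mul oD half
  (Cn1_mul oD (c1_vel i rUb) (c1_vel i rUb))).
have t3 := Cn1_mul oD (c1_temp rUb) (c1_eta rU).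
have t4 := Cn1_sum oD (index_enum Bidx) (fun B => Cn1_mul oD (c1_psi_xi B rUb)
  (Cn1_sub oD (c1_comp_xi B rU) (c1_comp_xi B rUb))).
exact: (Cn1_sub oD (Cn1_sub oD (Cn1_sub oD (Cn1_add oD (Cn1_sub oD
  (c1_total_energy rU) t1) t2) t3) (c1_psi rUb)) t4).
Qed.

Lemma derive_rel_entropy z : D z -> d_t (fun y => rel_entropy psi (U y) (Ub y)) z =
  d_t (fun y => total_energy psi (U y)) z
  - \sum_i (vel (U z) 0 i * d_t (fun y => vel (Ub y) 0 i) z
            + vel (Ub z) 0 i * d_t (fun y => vel (U y) 0 i) z)
  + \sum_i vel (Ub z) 0 i * d_t (fun y => vel (Ub y) 0 i) z
  - (temp (Ub z) * d_t (fun y => eta psi (xt (U y))) z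
     + eta psi (xt (U z)) * d_t (fun y => temp (Ub y)) z)
  - d_t (fun y => psi (xt (Ub y))) z
  - \sum_B (psi_xi psi B (xt (Ub z)) *
        (d_t (fun y => comp (xi (U y)) B) z - d_t (fun y => comp (xi (Ub y)) B) z)
      + (comp (xi (U z)) B - comp (xi (Ub z)) B) * d_t (pbar B) z).
Proof.
move=> Dz; pose a := e None.
under eq_fun do rewrite rel_entropyE.
have vU i := c1_is_derive None (c1_vel i rU) Dz.
have vUb i := c1_is_derive None (c1_vel i rUb) Dz.
have tE := c1_is_derive None (c1_total_energy rU) Dz.
have tb := c1_is_derive None (c1_temp rUb) Dz.
have eU := c1_is_derive None (c1_eta rU) Dz.
have ps := c1_is_derive None (c1_psi rUb) Dz.
have pB B := c1_is_derive None (c1_psi_xi B rUb) Dz.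
have xU B := c1_is_derive None (c1_comp_xi B rU) Dz.
have xUb B := c1_is_derive None (c1_comp_xi B rUb) Dz.
have t1 := is_derive_bigsum (index_enum 'I_3) (fun i => is_derive_mul (vU i) (vUb i)).
have half2 (x : R) : 2^-1 * (x + x) = x by field.
have t2 : is_derive z a (fun y => \sum_i 2^-1 * (vel (Ub y) 0 i * vel (Ub y) 0 i))
    (\sum_i vel (Ub z) 0 i * d_t (fun y => vel (Ub y) 0 i) z).
  have := is_derive_bigsum (index_enum 'I_3) (fun i => is_derive_mul
    (is_derive_cst (2^-1 : R) z a) (is_derive_mul (vUb i) (vUb i))).
  move/is_derive_eq; apply; apply: eq_bigr => i _.
  by rewrite mulr0 addr0; exact: half2.
have t4 := is_derive_bigsum (index_enum Bidx) (fun B => is_derive_mul (pB B)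
  (is_derive_sub (xU B) (xUb B))).
exact: (derive_val (is_derive := is_derive_sub (is_derive_sub (is_derive_sub
  (is_derive_add (is_derive_sub tE t1) t2) (is_derive_mul tb eU)) ps) t4)).
Qed.

Lemma entropy_balance z : D z ->
  d_t (fun y => rel_entropy psi (U y) (Ub y)) z - \sum_al d_x al (entropy_flux al) z =
  entropy_source z + entropy_diffusion z.
Proof.
move=> Dz; have [xiE vE teE cU] := sysU Dz; have [xibE vbE _ cUb] := sysUb Dz.
have fU : curl_free T U by apply: regular_curl_free => y Dy; have [] := sysU Dy.
have fUb : curl_free T Ub by apply: regular_curl_free => y Dy; have [] := sysUb Dy.
have etE := entU Dz; have etbE := entUb Dz.
rewrite derive_rel_entropy// (eq_bigr _ (fun al _ => derive_entropy_flux al Dz)).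
pose v (i : 'I_3) : R := vel (U z) 0 i; pose vb (i : 'I_3) : R := vel (Ub z) 0 i.
pose vt i := d_t (fun y => vel (U y) 0 i) z; pose vbt i := d_t (fun y => vel (Ub y) 0 i) z.
pose vx i al := d_x al (fun y => vel (Ub y) 0 i) z.
pose Dte al := d_x al (fun y => \sum_i stress psi i al (U y) * vel (U y) 0 i) z
  + d_x al (fun y => \sum_i vel (U y) 0 i * visc_flux mu i al U y) z.
pose Dh al := d_x al (heat_flux k al U) z.
pose hq al := heat_flux k al U z / temp (U z).
pose Dhq al := d_x al (fun y => heat_flux k al U y / temp (U y)) z.
pose tx al := d_x al (fun y => temp (Ub y)) z.
pose S i al := stress psi i al (U z).
pose DS i al := d_x al (fun y => stress psi i al (U y)) z.
pose visc i al := visc_flux mu i al U z; pose Dvisc i al := d_x al (visc_flux mu i al U) z.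
pose p B : R := psi_xi psi B (xt (U z)); pose pb B : R := psi_xi psi B (xt (Ub z)).
pose pbt B := d_t (pbar B) z; pose px B al := d_x al (pbar B) z.
pose x B : R := comp (xi (U z)) B; pose xb B : R := comp (xi (Ub z)) B.
pose xbt B := d_t (fun y => comp (xi (Ub y)) B) z.
pose xt_ B := d_t (fun y => comp (xi (U y)) B) z.
pose Dphv B al := d_x al (phiv B al) z.
pose dph B i al := d_x al (phi B i al) z.
pose ph B i al : R := dPhi B i al (defgrad (U z)).
pose prod := k (Ft (U z)) * grad_temp_sq U z / temp (U z) ^+ 2
      + mu (Ft (U z)) * grad_vel_sq U z / temp (U z).
have h1 : d_t (fun y => total_energy psi (U y)) z = \sum_al (Dte al + Dh al).
  move: teE => /eqP; rewrite subr_eq => /eqP ->.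
  rewrite /Dte /Dh !big_split/=; exact: (etrans (addrC _ _) (addrA _ _ _)).
have h2 i : vt i = \sum_al (DS i al + Dvisc i al).
  have /eqP := vE i; rewrite subr_eq => /eqP E; rewrite /DS /Dvisc big_split/=.
  exact: (etrans E (addrC _ _)).
have h3 : d_t (fun y => eta psi (xt (U y))) z = \sum_al Dhq al + prod.
  by move: etE => /eqP; rewrite subr_eq => /eqP ->; rewrite addrC.
have h4 B : xt_ B = \sum_al Dphv B al.
  by apply/eqP; rewrite -subr_eq0; apply/eqP; exact: xiE.
have h5 B i : \sum_al dph B i al = 0 := null_lagrangian B i rU fU Dz.
have h6 i al : S i al = \sum_B p B * ph B i al by [].
have alg1 := (entropy_flux_algebra v vb vbt hq tx visc vx pb pbt xb x xbt px
  (temp (Ub z)) (d_t (fun y => temp (Ub y)) z) (eta psi (xt (U z)))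
  (d_t (fun y => psi (xt (Ub y))) z) h1 h2 h3 h4 h5 h6).
refine (etrans alg1 _).
(* So far only the equations of [U] have been used; [g1] to [g5] express those of [Ub]. *)
pose dphb B i al := d_x al (fun y => dPhi B i al (defgrad (Ub y))) z.
pose phb B i al : R := dPhi B i al (defgrad (Ub z)).
pose abt o := d_t (fun y => co o (xt (Ub y))) z.
pose H o o' := 'D_(xt_dir R o') ('D_(xt_dir R o) psi) (xt (Ub z)).
pose rel o := rel2 ('D_(xt_dir R o) psi) (xt (U z)) (xt (Ub z)).
have pz : pos (xt (Ub z)) by case: rUb => _ _; exact.
have dpb B al : is_derive z (e (Some al)) (pbar B) (px B al).
  exact: (c1_is_derive (Some al) (c1_psi_xi B rUb) Dz).
have dphib B i al : is_derive z (e (Some al)) (fun y => dPhi B i al (defgrad (Ub y))) (dphb B i al).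
  exact: (c1_is_derive (Some al) (c1_dPhi B i al rUb) Dz).
have dvb i al : is_derive z (e (Some al)) (fun y => vel (Ub y) 0 i) (vx i al).
  exact: (c1_is_derive (Some al) (c1_vel i rUb) Dz).
have nullb B i : \sum_al dphb B i al = 0 := null_lagrangian B i rUb fUb Dz.
(* By the null Lagrangian identity the divergence of the stress keeps only the derivatives of
   [psi_B]. The same identity reduces the flux of [xi] in [g2] to the gradient of the velocity. *)
have g1 i : vbt i = \sum_al \sum_B phb B i al * px B al.
  have /eqP := vbE i; rewrite subr_eq0 => /eqP E; rewrite /vbt E.
  transitivity (\sum_al \sum_B (pb B * dphb B i al + phb B i al * px B al)).
    apply: eq_bigr => al _.
    exact: (derive_val (is_derive := is_derive_bigsum (index_enum Bidx)
      (fun B => is_derive_mul (dpb B al) (dphib B i al)))).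
  rewrite exchange_big [RHS]exchange_big; apply: eq_bigr => B _.
  exact: (sum_add_null (pb B) _ (nullb B i)).
have g2 B : xbt B = \sum_al \sum_i phb B i al * vx i al.
  have /eqP := xibE B; rewrite subr_eq0 => /eqP E; rewrite /xbt E.
  transitivity (\sum_al \sum_i (phb B i al * vx i al + vb i * dphb B i al)).
    apply: eq_bigr => al _.
    exact: (derive_val (is_derive := is_derive_bigsum (index_enum 'I_3)
      (fun i => is_derive_mul (dphib B i al) (dvb i al)))).
  rewrite exchange_big [RHS]exchange_big; apply: eq_bigr => i _.
  under eq_bigr do rewrite addrC; exact: (sum_add_null (vb i) _ (nullb B i)).
have g3 : d_t (fun y => psi (xt (Ub y))) z = \sum_B pb B * xbt B
    - eta psi (xt (Ub z)) * d_t (fun y => temp (Ub y)) z.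
  have := derive_state None rUb (CnW (CnW (psi_Cn3 psi_C3))) Dz.
  rewrite sum_option /d_t => ->; rewrite addrC; congr (_ + _).
    by apply: eq_bigr => B _; rewrite mulrC.
  by rewrite /eta mulNr opprK mulrC.
have g4 B : pbt B = \sum_o abt o * H (Some B) o.
  exact: (derive_state None rUb (CnW (dpsi_Cn2 psi_C3 (Some B))) Dz).
have g5 : \sum_o abt o * H None o = 0.
  rewrite -(derive_state None rUb (CnW (dpsi_Cn2 psi_C3 None)) Dz).
  have d : is_derive z (e None) (fun y => 'D_(xt_dir R None) psi (xt (Ub y)))
      ('D_(e None) (fun y => 'D_(xt_dir R None) psi (xt (Ub y))) z).
    exact: (c1_is_derive None (c1_state rUb (CnW (dpsi_Cn2 psi_C3 None))) Dz).
  have := derive_val (is_derive := is_deriveN d).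
  by rewrite [X in X = _ -> _]etbE => /eqP; rewrite eq_sym oppr_eq0 => /eqP.
have Hs o o' : H o o' = H o' o by exact: dpsi_comm.
have g6 B : rel (Some B) = p B - pb B - (\sum_B' (x B' - xb B') * H (Some B) (Some B')
    + (temp (U z) - temp (Ub z)) * H (Some B) None).
  exact: rel2_sum.
have g7 : rel None = - (eta psi (xt (U z)) - eta psi (xt (Ub z)))
   - (\sum_B' (x B' - xb B') * H None (Some B') + (temp (U z) - temp (Ub z)) * H None None).
  rewrite /rel rel2_sum /eta opprB opprK; congr (_ - _); exact: addrC.
have alg2 := entropy_production_algebra v vb ph g1 g2 g3 (fun B => erefl (abt (Some B)))
  (erefl (abt None)) Hs g4 g5 g6 g7.
rewrite /entropy_source /entropy_diffusion -/prod.
move: alg2; rewrite /v /vb /p /pb /vx /px /ph /phb /abt /rel => <-.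
ring.
Qed.

End Balance.

(** * Evolution of the integrated relative entropy *)

Lemma sum_le_card (R : realType) (I : finType) (f : I -> R) (m : R) :
  (forall i, f i <= m) -> \sum_i f i <= #|I|%:R * m.
Proof.
move=> fm; apply: (le_trans (ler_sum _ (fun i _ => fm i))).
by rewrite sumr_const mulr_natl.
Qed.

(** With [x = th b] and [y = thb a], the right side minus the left is
    [m (x^2 - x y + y^2) / (th thb)], which is nonnegative. *)
Lemma young_visc (R : realType) (m th thb a b : R) : 0 <= m -> 0 < th -> 0 < thb ->
  m * a * b - thb * (m * a ^+ 2 / th) <= m * th * b ^+ 2 / thb.
Proof.
move=> m0 th0 thb0; rewrite -subr_ge0.
have -> : m * th * b ^+ 2 / thb - (m * a * b - thb * (m * a ^+ 2 / th)) =
    m * ((th * b - thb * a) ^+ 2 + (th * b) * (thb * a)) / (th * thb).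
  by field; rewrite !gt_eqF.
apply: divr_ge0; last by rewrite mulr_ge0// ltW.
apply: mulr_ge0 => //; have := sqr_ge0 (th * b - thb * a).
have := sqr_ge0 (th * b + thb * a); nra.
Qed.

(** The viscous inequality at temperature [1], for the gradient [a / th]. *)
Lemma young_heat (R : realType) (k th thb a b : R) : 0 <= k -> 0 < th -> 0 < thb ->
  k * a / th * b - thb * (k * a ^+ 2 / th ^+ 2) <= k * b ^+ 2 / thb.
Proof.
move=> k0 th0 thb0; have := @young_visc R k 1 thb (a / th) b k0 ltr01 thb0.
have -> : k * (a / th) * b - thb * (k * (a / th) ^+ 2 / 1)
    = k * a / th * b - thb * (k * a ^+ 2 / th ^+ 2) by field; rewrite gt_eqF.
by rewrite mulr1.
Qed.

Lemma d_x_shift (R : realType) (f : spacetime R -> R) (al : 'I_3) (a x : 'rV[R]_3) (t : R) :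
  (forall x, f (x + a, t) = f (x, t)) -> d_x al f (x + a, t) = d_x al f (x, t).
Proof.
move=> fa; rewrite /d_x /derive.
have E y h : h *: (delta_mx 0 al, 0) + (y, t) = (h *: delta_mx 0 al + y, t) :> spacetime R.
  by congr (_, _); rewrite /= scaler0 add0r.
suff -> : (fun h : R => h^-1 *: ((f \o shift (x + a, t)) (h *: st_dir R (Some al)) - f (x + a, t)))
  = (fun h : R => h^-1 *: ((f \o shift (x, t)) (h *: st_dir R (Some al)) - f (x, t))) by [].
by apply/funext => h; rewrite /= !E addrA !fa.
Qed.

Lemma is_derive_space (R : realType) (f : spacetime R -> R) (al : 'I_3) x t :
  derivable f (x, t) (st_dir R (Some al)) ->
  is_derive x (delta_mx 0 al) (fun x => f (x, t)) (d_x al f (x, t)).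
Proof.
have E : (fun h : R => h^-1 *: (((fun x => f (x, t)) \o shift x) (h *: delta_mx 0 al) - f (x, t)))
    = (fun h : R => h^-1 *: ((f \o shift (x, t)) (h *: st_dir R (Some al)) - f (x, t))).
  apply/funext => h; congr (_ *: (f _ - _)).
  by congr (_, _); rewrite /= scaler0 add0r.
by move=> df; apply: DeriveDef; rewrite ?/derivable ?/d_x ?/derive E.
Qed.

Lemma continuous_proj_Ft (R : realType) :
  continuous (fun w : xi_space R * R => (w.1.1.1, w.2)).
Proof.
move=> w; apply: (@cvg_pair _ _ _ (nbhs w) (nbhs w.1.1.1) (nbhs w.2) _ _ _
  (fun w : xi_space R * R => w.1.1.1) (fun w : xi_space R * R => w.2)); last exact: cvg_snd.
apply: (@continuous_comp _ _ _ (fun w : xi_space R * R => w.1.1) fst); last exact: cvg_fst.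
apply: (@continuous_comp _ _ _ (fun w : xi_space R * R => w.1) fst); exact: cvg_fst.
Qed.

Section Evolution.
Context (R : realType) (psi : xi_space R * R -> R) (T : R).
Context (mu k : 'M[R]_3 * R -> R) (U Ub : spacetime R -> state R).
Local Notation D := (@open_cyl R T%:E).
Local Notation e := (@st_dir R).
Local Notation ex := (fun al : 'I_3 => @st_dir R (Some al)).
Local Notation c1 := (Cn e D 1).
Local Notation cx := (Cn ex D 1).
Local Notation pos := (@pos_temp R).
Hypothesis psi_C3 : is_C3 psi.
Hypothesis rU : regular T U.
Hypothesis rUb : regular T Ub.
Hypothesis sysU : forall z, D z -> viscous_system psi mu k U z.
Hypothesis sysUb : forall z, D z -> adiabatic_system psi Ub z.
Hypothesis entU : entropy_production psi mu k T%:E U.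
Hypothesis entUb : forall z, D z -> d_t (fun y => eta psi (xt (Ub y))) z = 0.
Hypothesis cx_visc : forall i al, cx (visc_flux mu i al U).
Hypothesis cx_heat : forall al, cx (heat_flux k al U).
Hypothesis perU : periodic_on D U.
Hypothesis perUb : periodic_on D Ub.
Hypothesis mu_coef : transport_coef mu.
Hypothesis k_coef : transport_coef k.
Implicit Types z : spacetime R.

Definition dissipation z : R :=
  mu (Ft (U z)) * temp (U z) * grad_vel_sq Ub z / temp (Ub z)
  + k (Ft (U z)) * grad_temp_sq Ub z / temp (Ub z).

Lemma entropy_diffusion_le z : D z -> entropy_diffusion mu k U Ub z <= dissipation z.
Proof.
move=> Dz; have th0 : 0 < temp (U z) by case: rU => _ _; exact.
have thb0 : 0 < temp (Ub z) by case: rUb => _ _; exact.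
have m0 : 0 <= mu (Ft (U z)) by rewrite ltW//; exact: (mu_coef _).2.
have k0 : 0 <= k (Ft (U z)) by rewrite ltW//; exact: (k_coef _).2.
pose a i al := d_x al (fun y => vel (U y) 0 i) z.
pose b i al := d_x al (fun y => vel (Ub y) 0 i) z.
pose g al := d_x al (fun y => temp (U y)) z; pose h al := d_x al (fun y => temp (Ub y)) z.
have V : \sum_(al < 3) \sum_i visc_flux mu i al U z * b i al
    - temp (Ub z) * (mu (Ft (U z)) * grad_vel_sq U z / temp (U z)) <=
    mu (Ft (U z)) * temp (U z) * grad_vel_sq Ub z / temp (Ub z).
  rewrite exchange_big /grad_vel_sq !(mulr_sumr, mulr_suml) -sumrB.
  apply: ler_sum => i _; rewrite !(mulr_sumr, mulr_suml) -sumrB.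
  by apply: ler_sum => al _; exact: (young_visc (a i al) (b i al) m0 th0 thb0).
have H : \sum_(al < 3) heat_flux k al U z / temp (U z) * h al
    - temp (Ub z) * (k (Ft (U z)) * grad_temp_sq U z / temp (U z) ^+ 2) <=
    k (Ft (U z)) * grad_temp_sq Ub z / temp (Ub z).
  rewrite /grad_temp_sq !(mulr_sumr, mulr_suml) -sumrB.
  by apply: ler_sum => al _; exact: (young_heat (g al) (h al) k0 th0 thb0).
move: (lerD V H); rewrite /dissipation /entropy_diffusion; lra.
Qed.

(** The factor 19 is [9 + 9 + 1]: nine pairs [(i, al)] in each of the two double sums, and one term
    per coordinate in the sum of remainders. *)
Lemma entropy_source_le (C L : R) z : 0 <= C -> 0 <= L ->
  relative_bounds psi C (xt (U z)) (xt (Ub z)) ->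
  (forall i al, `|d_x al (fun y => vel (Ub y) 0 i) z| <= L) ->
  (forall B al, `|d_x al (fun y => psi_xi psi B (xt (Ub y))) z| <= L) ->
  (forall o, `|d_t (fun y => co o (xt (Ub y))) z| <= L) ->
  entropy_source psi U Ub z <= 19 * #|{: option Bidx}|%:R * L * (C + 2)
     * rel_entropy psi (U z) (Ub z).
Proof.
move=> C0 L0 [P0 b1 b2 b3 _] hv hp ht.
have IE : rel_entropy psi (U z) (Ub z) = rel_pot psi (xt (U z)) (xt (Ub z))
    + 2^-1 * mxnorm2 (vel (U z) - vel (Ub z)) ^+ 2.
  by rewrite /rel_entropy /rel_pot addrAC.
set I := rel_entropy _ _ _ in IE *; set P := rel_pot _ _ _ in IE P0 b1 b2 b3.
have v2 i : (vel (U z) 0 i - vel (Ub z) 0 i) ^+ 2 <= mxnorm2 (vel (U z) - vel (Ub z)) ^+ 2.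
  rewrite mxnorm2_sqr (bigD1 i)//= !mxE lerDl.
  by apply: sumr_ge0 => j _; exact: sqr_ge0.
have K0 : 0 <= mxnorm2 (vel (U z) - vel (Ub z)) ^+ 2 by exact: sqr_ge0.
move: IE v2 K0; set K := mxnorm2 _ ^+ 2 => IE v2 K0.
(* [X] dominates [C * P] and, because [|v - vbar|^2 <= 2 (I - P)], also the products of a difference
   of [dPhi] with a velocity difference. *)
pose X := (C + 2) * I.
have CPX : C * P <= X by rewrite /X IE; nra.
have X0 : 0 <= X by apply: le_trans CPX; rewrite mulr_ge0.
have s1 (x y u m : R) : `|x| * `|y| <= m -> `|u| <= L -> x * y * u <= m * L.
  move=> xy uL; rewrite (le_trans (ler_norm _))// !normrM; exact: ler_pM.
have n1 : (1 : R) <= #|{: option Bidx}|%:R.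
  by rewrite ler1n; apply/card_gt0P; exists None.
have nB : #|{: Bidx}|%:R <= #|{: option Bidx}|%:R :> R by rewrite ler_nat card_option.
set N := #|{: option Bidx}|%:R in n1 nB *.
have LX : 0 <= L * X by rewrite mulr_ge0.
have T1 : \sum_(al < 3) \sum_B (psi_xi psi B (xt (U z)) - psi_xi psi B (xt (Ub z))) *
    (\sum_i (dPhi B i al (defgrad (U z)) - dPhi B i al (defgrad (Ub z))) *
      d_x al (fun y => vel (Ub y) 0 i) z) <= 9 * N * (L * X).
  apply: (@le_trans _ _ (#|'I_3|%:R * (#|{: Bidx}|%:R * (#|'I_3|%:R * (L * X))))).
    apply: sum_le_card => al; apply: sum_le_card => B; rewrite mulr_sumr.
    apply: sum_le_card => i; rewrite mulrA [L * X]mulrC; apply: s1 => //.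
    by rewrite mulrC; exact: le_trans (b3 B i al) CPX.
  by rewrite card_ord; nra.
have T2 : \sum_(al < 3) \sum_B
    (\sum_i (dPhi B i al (defgrad (U z)) - dPhi B i al (defgrad (Ub z))) *
      (vel (U z) 0 i - vel (Ub z) 0 i)) * d_x al (fun y => psi_xi psi B (xt (Ub y))) z
    <= 9 * N * (L * X).
  apply: (@le_trans _ _ (#|'I_3|%:R * (#|{: Bidx}|%:R * (#|'I_3|%:R * (L * X))))).
    apply: sum_le_card => al; apply: sum_le_card => B; rewrite mulr_suml.
    apply: sum_le_card => i; rewrite [L * X]mulrC; apply: s1 => //.
    move: (b2 B i al) (v2 i); set x := dPhi _ _ _ _ - _; set y := vel _ _ _ - _ => hx hy.
    have := sqr_ge0 (`|x| - `|y|); rewrite sqrrB !real_normK ?num_real//.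
    rewrite /X IE; nra.
  by rewrite card_ord; nra.
have T3 : \sum_o d_t (fun y => co o (xt (Ub y))) z *
    rel2 ('D_(xt_dir R o) psi) (xt (U z)) (xt (Ub z)) <= N * (L * X).
  apply: sum_le_card => o; rewrite (le_trans (ler_norm _))// normrM.
  by apply: ler_pM => //; exact: le_trans (b1 o) CPX.
have := lerD (lerD T1 T2) T3; rewrite /entropy_source => /le_trans; apply.
rewrite /X; lra.
Qed.

Let oD := @open_open_cyl R T.

Lemma c1_continuous f z : c1 f -> D z -> {for z, continuous f}.
Proof. by move=> [cf _] /cf. Qed.

Lemma c1_continuous_d f o z : c1 f -> D z -> {for z, continuous ('D_(e o) f)}.
Proof. by move=> cf Dz; have [_ /(_ o)[]] := Cn1E cf Dz. Qed.

Lemma cx_continuous_d f al z : cx f -> D z -> {for z, continuous (d_x al f)}.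
Proof. by move=> cf Dz; have [_ /(_ al)[]] := Cn1E cf Dz. Qed.

Lemma continuous_coef (m : 'M[R]_3 * R -> R) z : transport_coef m -> D z ->
  {for z, continuous (fun z => m (Ft (U z)))}.
Proof.
move=> cm Dz; have th0 : 0 < temp (U z) by case: rU => _ _; exact.
have cxt : {for z, continuous (fun z => xt (U z))}.
  apply: (continuous_coords (c := fun o z => co o (xt (U z)))) => [y|o].
    exact: xt_decomp.
  by apply: c1_continuous => //; case: rU.
have cFt : {for z, continuous (fun z => Ft (U z))}.
  exact: (continuous_comp cxt (@continuous_proj_Ft R (xt (U z)))).
exact: (continuous_comp cFt (cm (Ft (U z)) th0).1).
Qed.

Lemma continuous_dissipation z : D z -> {for z, continuous dissipation}.
Proof.
move=> Dz; have thb0 : 0 < temp (Ub z) by case: rUb => _ _; exact.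
have cm := continuous_coef mu_coef Dz; have ck := continuous_coef k_coef Dz.
have ct := c1_continuous (c1_temp rU) Dz; have ctb := c1_continuous (c1_temp rUb) Dz.
have sq f al : c1 f -> {for z, continuous (fun z => d_x al f z ^+ 2)}.
  move=> cf; have cd : {for z, continuous (d_x al f)}  by exact: c1_continuous_d.
  exact: (continuous_comp cd (@exprn_continuous R 2 _)).
have cgv : {for z, continuous (grad_vel_sq Ub)}.
  by apply: continuous_bigsum => i; apply: continuous_bigsum => al; exact: (sq _ al (c1_vel i rUb)).
have cgt : {for z, continuous (grad_temp_sq Ub)}.
  by apply: continuous_bigsum => al; exact: (sq _ al (c1_temp rUb)).
have cVb : {for z, continuous (fun z => (temp (Ub z))^-1)}.
  by apply: (continuousV _ ctb); rewrite gt_eqF.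
exact: (continuousD (continuousM (continuousM (continuousM cm ct) cgv) cVb)
  (continuousM (continuousM ck cgt) cVb)).
Qed.

Lemma in_cyl (x : 'rV[R]_3) (t : R) : 0 < t < T -> D (x, t).
Proof. by move=> /andP[t0 tT]; split=> //; rewrite lte_fin. Qed.

Lemma entropy_flux_period al be x t : 0 < t < T ->
  entropy_flux psi mu k U Ub al (x + delta_mx 0 be, t) = entropy_flux psi mu k U Ub al (x, t).
Proof.
move=> tT; have uE y : U (y + delta_mx 0 be, t) = U (y, t) by apply: perU; exact: in_cyl.
have ubE y : Ub (y + delta_mx 0 be, t) = Ub (y, t) by apply: perUb; exact: in_cyl.
have vE i : visc_flux mu i al U (x + delta_mx 0 be, t) = visc_flux mu i al U (x, t).
  by rewrite /visc_flux uE d_x_shift// => y; rewrite uE.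
have hE : heat_flux k al U (x + delta_mx 0 be, t) = heat_flux k al U (x, t).
  by rewrite /heat_flux uE d_x_shift// => y; rewrite uE.
rewrite /entropy_flux uE ubE hE.
have sE (w : 'I_3 -> R) : \sum_i w i * visc_flux mu i al U (x + delta_mx 0 be, t)
    = \sum_i w i * visc_flux mu i al U (x, t) by apply: eq_bigr => i _; rewrite vE.
by rewrite !sE.
Qed.

Lemma Tint_entropy_flux al t : 0 < t < T ->
  Tint (fun x => d_x al (entropy_flux psi mu k U Ub al) (x, t)) = 0.
Proof.
move=> tT; have cf := cx_entropy_flux psi_C3 rU rUb cx_visc cx_heat al.
pose f x := entropy_flux psi mu k U Ub al (x, t).
have df x : is_derive x (delta_mx 0 al) f (d_x al (entropy_flux psi mu k U Ub al) (x, t)).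
  by apply: is_derive_space; have [] := cx_is_derive al cf (in_cyl x tT).
have E : 'D_(delta_mx 0 al) f = (fun x => d_x al (entropy_flux psi mu k U Ub al) (x, t)).
  by apply/funext => x; rewrite (derive_val (is_derive := df x)).
rewrite -E; apply: Tint_period => [x||x].
- by have [] := df x.
- rewrite E; apply: (@slice_continuous R (d_x al (entropy_flux psi mu k U Ub al))) => y.
  by apply: cx_continuous_d => //; exact: in_cyl.
- exact: entropy_flux_period.
Qed.

Local Notation I := (fun z => rel_entropy psi (U z) (Ub z)).

Lemma derive_Tint_entropy t : 0 < t < T ->
  is_derive t 1 (fun t => Tint (fun x => I (x, t))) (Tint (fun x => d_t I (x, t))).
Proof.
move=> tT; apply: (@Tint_derive R I 0 T) => // x s sT.
have cI := c1_rel_entropy psi_C3 rU rUb; have Dz := in_cyl x sT.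
split; first exact: c1_continuous.
  by have [] := c1_is_derive None cI Dz.
exact: c1_continuous_d.
Qed.

Lemma Tint_sum3 (f : 'I_3 -> 'rV[R]_3 -> R) : (forall i, continuous (f i)) ->
  Tint (fun x => \sum_i f i x) = \sum_i Tint (f i).
Proof.
move=> cf; under eq_fun do rewrite sum3; rewrite sum3.
have c01 : continuous (fun x => f 0 x + f 1 x) by move=> x; exact: (continuousD (cf 0 x) (cf 1 x)).
by rewrite (TintD c01 (cf 2)) (TintD (cf 0) (cf 1)).
Qed.

Lemma derive_Tint_entropy_le (C : R) t : 0 < t < T ->
  (forall x, in_cell x -> entropy_source psi U Ub (x, t) <= C * I (x, t)) ->
  Tint (fun x => d_t I (x, t)) <=
    C * Tint (fun x => I (x, t)) + Tint (fun x => dissipation (x, t)).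
Proof.
move=> tT HC; have cI := c1_rel_entropy psi_C3 rU rUb.
have cflux al := cx_entropy_flux psi_C3 rU rUb cx_visc cx_heat al.
pose F al x := d_x al (entropy_flux psi mu k U Ub al) (x, t).
have cF al : continuous (F al).
  apply: (@slice_continuous R (d_x al (entropy_flux psi mu k U Ub al))) => y.
  by apply: cx_continuous_d => //; exact: in_cyl.
have cI0 : continuous (fun x => I (x, t)).
  by apply: (@slice_continuous R I) => y; apply: c1_continuous => //; exact: in_cyl.
have cIt : continuous (fun x => d_t I (x, t)).
  by apply: (@slice_continuous R (d_t I)) => y; apply: c1_continuous_d => //; exact: in_cyl.
have cd : continuous (fun x => dissipation (x, t)).
  by apply: (@slice_continuous R dissipation) => y; apply: continuous_dissipation; exact: in_cyl.
have cS : continuous (fun x => \sum_al F al x).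
  by move=> x; apply: continuous_bigsum => al; exact: cF.
have cCI : continuous (fun x => C * I (x, t)).
  by move=> x; exact: (continuousM (@cst_continuous _ _ C x) (cI0 x)).
have cR : continuous (fun x => C * I (x, t) + dissipation (x, t)).
  by move=> x; exact: (continuousD (cCI x) (cd x)).
have cRS : continuous (fun x => (C * I (x, t) + dissipation (x, t)) + \sum_al F al x).
  by move=> x; exact: (continuousD (cR x) (cS x)).
have := @le_Tint R _ _ cIt cRS; rewrite (TintD cR cS) (TintD cCI cd) (TintZ _ cI0).
rewrite (Tint_sum3 cF) big1 => [|al _]; last exact: Tint_entropy_flux.
rewrite addr0; apply=> x cx; have Dz := in_cyl x tT.
rewrite -lerBlDr (entropy_balance psi_C3 rU rUb sysU sysUb entU entUb cx_visc cx_heat Dz).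
apply: lerD; first exact: HC.
exact: entropy_diffusion_le.
Qed.

Lemma Tint_dissipation_continuous t : 0 < t < T ->
  {for t, continuous (fun t => Tint (fun x => dissipation (x, t)))}.
Proof.
apply: (@Tint_continuous R dissipation 0 T) => x s sT.
by apply: continuous_dissipation; exact: in_cyl.
Qed.

Lemma dissipation_ge0 z : D z -> 0 <= dissipation z.
Proof.
move=> Dz; have th0 : 0 < temp (U z) by case: rU => _ _; exact.
have thb0 : 0 < temp (Ub z) by case: rUb => _ _; exact.
have m0 : 0 <= mu (Ft (U z)) by rewrite ltW//; exact: (mu_coef _).2.
have k0 : 0 <= k (Ft (U z)) by rewrite ltW//; exact: (k_coef _).2.
have g0 : 0 <= grad_vel_sq Ub z by do 2 (apply: sumr_ge0 => ? _); exact: sqr_ge0.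
have h0 : 0 <= grad_temp_sq Ub z by apply: sumr_ge0 => ? _; exact: sqr_ge0.
apply: addr_ge0; apply: divr_ge0; try exact: ltW; apply: mulr_ge0 => //.
by apply: mulr_ge0 => //; exact: ltW.
Qed.

End Evolution.

(** * Fields on the closed time interval *)

Section Retraction.
Context (R : realType) (T : R).
Hypothesis T_ge0 : 0 <= T.

Definition clamp (t : R) : R := Num.max 0 (Num.min t T).

Lemma clamp_in t : 0 <= clamp t <= T.
Proof. by rewrite /clamp le_max lexx ge_max T_ge0 ge_min lexx orbT. Qed.

Lemma clampE t : 0 <= t <= T -> clamp t = t.
Proof. by move=> /andP[t0 tT]; rewrite /clamp min_l// max_r. Qed.

Lemma clamp_continuous : continuous clamp.
Proof.
move=> t; apply: (@continuous_max _ _ (fun=> 0) (fun t => Num.min t T)); first exact: cvg_cst.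
by apply: (@continuous_min _ _ id (fun=> T)); [exact: cvg_id|exact: cvg_cst].
Qed.

(* Nothing is known outside [0, T]: composing with this retraction makes the fields continuous
   everywhere without changing them on [0, T]. *)
Definition retract (z : spacetime R) : spacetime R := (z.1, clamp z.2).

Lemma retract_in z : closed_cyl T (retract z).
Proof. exact: clamp_in. Qed.

Lemma retractE x t : 0 <= t <= T -> retract (x, t) = (x, t).
Proof. by move=> /clampE tT; rewrite /retract/= tT. Qed.

Lemma retract_continuous : continuous retract.
Proof.
move=> z; have c2 : {for z, continuous (fun z : spacetime R => clamp z.2)}.
  apply: (@continuous_comp _ _ _ (fun z : spacetime R => z.2) clamp); first exact: cvg_snd.
  exact: clamp_continuous.
by apply: (@cvg_pair _ _ _ (nbhs z) (nbhs z.1) (nbhs (clamp z.2)) _ _ _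
  fst (fun z => clamp z.2)); [exact: cvg_fst|exact: c2].
Qed.

Lemma comp_retract_continuous (f : spacetime R -> R) : {within closed_cyl T, continuous f} ->
  continuous (f \o retract).
Proof.
move=> /subspace_continuousP cf z.
apply: (cvg_comp _ f _ (cf _ (retract_in z))) => W WA.
have H : nbhs z (retract @^-1` [set y | closed_cyl T y -> W y]).
  exact: (@retract_continuous z _ WA).
suff : nbhs z (retract @^-1` W) by [].
apply: (filterS _ H) => y Hy.
exact: (Hy (retract_in y)).
Qed.

Lemma bounded_on_cell (f : spacetime R -> R) : {within closed_cyl T, continuous f} ->
  exists2 L, 0 <= L & forall x t, in_cell x -> 0 <= t <= T -> `|f (x, t)| <= L.
Proof.
move=> /comp_retract_continuous cf.
have [L L0 HL] := slice_bounded (fun x t (_ : 0 <= t <= T) => cf (x, t)).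
by exists L => // x t cx tT; have := HL x t cx tT; rewrite /= retractE.
Qed.

(** The derivatives are bounded up to [t = 0] and [t = T] through their continuous extensions,
    evaluated on a compact set. *)
Lemma C1_closed_bounded f : C1_closed T f ->
  exists2 L, 0 <= L & forall o x t, in_cell x -> 0 < t < T ->
    `|'D_(st_dir R o) f (x, t)| <= L.
Proof.
move=> [_ _ ext].
have /choice[L HL] : forall o, exists L, 0 <= L /\ forall x t, in_cell x -> 0 < t < T ->
    `|'D_(st_dir R o) f (x, t)| <= L.
  move=> o; have [g [cg gE]] := ext o; have [L L0 HL] := bounded_on_cell cg.
  exists L; split=> // x t cx tT; rewrite -gE; last exact: in_cyl.
  by apply: HL => //; case/andP: tT => t0 tT; rewrite !ltW.
exists (\sum_o L o) => [|o x t cx tT]; first by apply: sumr_ge0 => o _; exact: (HL o).1.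
rewrite (le_trans ((HL o).2 x t cx tT))// (bigD1 o)//= lerDl.
by apply: sumr_ge0 => o' _; exact: (HL o').1.
Qed.

End Retraction.

(** * Continuity of the relative entropy *)

Lemma continuous_for_ext (S V : topologicalType) (f g : S -> V) s : f =1 g ->
  {for s, continuous f} -> {for s, continuous g}.
Proof. by move=> /funext ->. Qed.

Section Continuity.
Context (R : realType) (psi : xi_space R * R -> R) (S : topologicalType).
Hypothesis psi_C3 : is_C3 psi.
Implicit Types (W : S -> state R).

Lemma continuous_state W (g : xi_space R * R -> R) s :
  (forall o, continuous (fun s => co o (xt (W s)))) -> 0 < temp (W s) ->
  (forall z, pos_temp z -> {for z, continuous g}) ->
  {for s, continuous (fun s => g (xt (W s)))}.
Proof.
move=> cW t0 cg.
have cxt : {for s, continuous (fun s => xt (W s))}.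
  apply: (continuous_coords (c := fun o s => co o (xt (W s)))) => [y|o].
    exact: xt_decomp.
  exact: cW.
exact: (continuous_comp cxt (cg (xt (W s)) t0)).
Qed.

Lemma continuous_rel_entropy W Wb :
  (forall o, continuous (fun s => co o (xt (W s)))) ->
  (forall o, continuous (fun s => co o (xt (Wb s)))) ->
  (forall i, continuous (fun s => vel (W s) 0 i)) ->
  (forall i, continuous (fun s => vel (Wb s) 0 i)) ->
  (forall s, 0 < temp (W s)) -> (forall s, 0 < temp (Wb s)) ->
  continuous (fun s => rel_entropy psi (W s) (Wb s)).
Proof.
move=> cW cWb cv cvb t0 tb0 s.
have cpsi z : pos_temp z -> {for z, continuous psi} by move=> pz; exact: (psi_Cn3 psi_C3).1.
have cd o z : pos_temp z -> {for z, continuous ('D_(xt_dir R o) psi)}.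
  by move=> pz; exact: (dpsi_Cn2 psi_C3 o).1.
have c2 (a : R) (f : S -> R) : {for s, continuous f} -> {for s, continuous (fun s => a * f s)}.
  by move=> cf; exact: (continuousM (@cst_continuous _ _ a s) cf).
have sq : {for s, continuous (fun s => \sum_i vel (W s) 0 i ^+ 2)}.
  apply: continuous_bigsum => i.
  exact: (continuous_comp (cv i s) (@exprn_continuous R 2 _)).
have c_psi := continuous_state cW (t0 s) cpsi.
have c_th := continuous_state cW (t0 s) (cd None).
have c_thN : {for s, continuous (fun s => eta psi (xt (W s)))} by exact: (continuousN c_th).
have c_psib := continuous_state cWb (tb0 s) cpsi.
have c_TE : {for s, continuous (fun s => total_energy psi (W s))}.
  apply: (continuous_for_ext (f := fun s => 2^-1 * \sum_i vel (W s) 0 i ^+ 2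
    + energy psi (xt (W s)))).
    by move=> y; rewrite /total_energy mxnorm2_sqr.
  exact: (continuousD (c2 _ _ sq) (continuousB c_psi (continuousM (cW None s) c_th))).
have t1 : {for s, continuous (fun s => \sum_i vel (W s) 0 i * vel (Wb s) 0 i)}.
  by apply: continuous_bigsum => i; exact: (continuousM (cv i s) (cvb i s)).
have t2 : {for s, continuous (fun s => \sum_i 2^-1 * (vel (Wb s) 0 i * vel (Wb s) 0 i))}.
  by apply: continuous_bigsum => i; exact: (c2 _ _ (continuousM (cvb i s) (cvb i s))).
have t4 : {for s, continuous (fun s => \sum_B psi_xi psi B (xt (Wb s)) *
    (comp (xi (W s)) B - comp (xi (Wb s)) B))}.
  apply: continuous_bigsum => B.
  exact: (continuousM (continuous_state cWb (tb0 s) (cd (Some B)))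
    (continuousB (cW (Some B) s) (cWb (Some B) s))).
apply: (continuous_for_ext (fun y => esym (rel_entropyE psi (W y) (Wb y)))).
exact: (continuousB (continuousB (continuousB (continuousD (continuousB c_TE t1) t2)
  (continuousM (cWb None s) c_thN)) c_psib) t4).
Qed.

End Continuity.

(** * Comparison of the two solutions *)

Lemma Gamma_box (R : realType) (M delta : R) (U : state R) :
  Gamma M delta U -> box M delta (xt U).
Proof.
move=> [hF hZ hw _ [_ ht]]; split=> // -[[[i j]|[i j]]|[]]//=.
- exact: le_trans (ler_mxnorm2 _ _ _) hF.
- exact: le_trans (ler_mxnorm2 _ _ _) hZ.
Qed.

Lemma regular_C1 (R : realType) (T : R) (U : spacetime R -> state R) :
  componentwise (C1_open T%:E) U -> (forall z, open_cyl T%:E z -> 0 < temp (U z)) ->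
  regular T U.
Proof.
move=> [cx cv ct] t0; split; [|exact: cv|exact: t0].
by case=> [B|]; [exact: cx|exact: ct].
Qed.

Lemma open_closed_cyl (R : realType) (T : R) (z : spacetime R) :
  open_cyl T%:E z -> closed_cyl T z.
Proof. by rewrite /open_cyl/closed_cyl/= lte_fin => -[/ltW -> /ltW ->]. Qed.

Lemma closed_init_cyl (R : realType) (T : R) (Ts : \bar R) : (T%:E < Ts)%E ->
  closed_cyl T `<=` init_cyl Ts.
Proof.
by move=> TTs z /andP[z0 zT]; split=> //; rewrite (le_lt_trans _ TTs)// lee_fin.
Qed.

Lemma open_cyl_sub (R : realType) (T : R) (Ts : \bar R) : (T%:E < Ts)%E ->
  open_cyl T%:E `<=` open_cyl Ts.
Proof. by move=> TTs z [z0 zT]; split=> //; exact: lt_trans TTs. Qed.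

(** * Uniform bounds on the reference solution *)

Section Reference.
Context (R : realType) (psi : xi_space R * R -> R) (T M delta : R).
Context (Ub0 : 'rV[R]_3 -> state R) (Ub : spacetime R -> state R).
Hypothesis psi_C3 : is_C3 psi.
Hypothesis T_gt0 : 0 < T.
Hypothesis delta_gt0 : 0 < delta.
Hypothesis Ub_sol : smooth_adiabatic_solution psi T Ub0 Ub.
Hypothesis Ub_Gamma : forall z, closed_cyl T z -> Gamma M delta (Ub z).

Lemma reference_regular : regular T Ub.
Proof.
case: Ub_sol => -[_ t0] _ [cB cv ct] _ _; apply: regular_C1.
  by split=> [B|i|]; [case: (cB B)|case: (cv i)|case: ct].
by move=> z /open_closed_cyl/t0.
Qed.

Lemma reference_bounds : exists2 L, 0 <= L & forall x t, in_cell x -> 0 < t < T ->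
  [/\ forall i al, `|d_x al (fun y => vel (Ub y) 0 i) (x, t)| <= L,
      forall al, `|d_x al (fun y => temp (Ub y)) (x, t)| <= L,
      forall B al, `|d_x al (fun y => psi_xi psi B (xt (Ub y))) (x, t)| <= L &
      forall o, `|d_t (fun y => co o (xt (Ub y))) (x, t)| <= L].
Proof.
have T0 := ltW T_gt0; have rUb := reference_regular.
case: (Ub_sol) => -[_ t0] _ [cB cv ct] _ _.
have cco o : C1_closed T (fun z => co o (xt (Ub z))) by case: o => [B|]; [exact: cB|exact: ct].
have /choice[Lo HLo] : forall o, exists L, 0 <= L /\ forall a x t, in_cell x -> 0 < t < T ->
    `|'D_(st_dir R a) (fun z => co o (xt (Ub z))) (x, t)| <= L.
  by move=> o; have [L L0 HL] := C1_closed_bounded T0 (cco o); exists L.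
have /choice[Lv HLv] : forall i, exists L, 0 <= L /\ forall a x t, in_cell x -> 0 < t < T ->
    `|'D_(st_dir R a) (fun z => vel (Ub z) 0 i) (x, t)| <= L.
  by move=> i; have [L L0 HL] := C1_closed_bounded T0 (cv i); exists L.
have [J J0 HJ] := @jet_bound R psi psi_C3 M delta delta_gt0.
have So0 : 0 <= \sum_o Lo o by apply: sumr_ge0 => o _; exact: (HLo o).1.
have Sv0 : 0 <= \sum_i Lv i by apply: sumr_ge0 => i _; exact: (HLv i).1.
have leo o : Lo o <= \sum_o Lo o.
  by rewrite (bigD1 o)//= lerDl; apply: sumr_ge0 => o' _; exact: (HLo o').1.
have lev i : Lv i <= \sum_i Lv i.
  by rewrite (bigD1 i)//= lerDl; apply: sumr_ge0 => j _; exact: (HLv j).1.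
have SJ0 : 0 <= (\sum_o Lo o) * J by rewrite mulr_ge0.
exists (\sum_o Lo o + \sum_i Lv i + (\sum_o Lo o) * J) => [|x t cx tT].
  by rewrite !addr_ge0.
split=> [i al|al|B al|o].
- by have := (HLv i).2 (Some al) x t cx tT; rewrite -/(d_x al _ _); have := lev i; lra.
- by have := (HLo None).2 (Some al) x t cx tT; rewrite -/(d_x al _ _); have := leo None; lra.
- have dE : d_x al (fun y => psi_xi psi B (xt (Ub y))) (x, t) = _ :=
    derive_state (Some al) rUb (CnW (dpsi_Cn2 psi_C3 (Some B))) (in_cyl x tT).
  rewrite dE.
  have H : `|\sum_o 'D_(st_dir R (Some al)) (fun z => co o (xt (Ub z))) (x, t) *
      'D_(xt_dir R o) ('D_(xt_dir R (Some B)) psi) (xt (Ub (x, t)))| <= (\sum_o Lo o) * J.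
    rewrite mulr_suml (le_trans (ler_norm_sum _ _ _))//; apply: ler_sum => o _.
    rewrite normrM; apply: ler_pM => //; first exact: (HLo o).2.
    have [_ _ h _] := HJ _ (Gamma_box (Ub_Gamma (open_closed_cyl (in_cyl x tT)))).
    exact: h.
  by apply: (le_trans H); rewrite lerDr addr_ge0.
- by have := (HLo o).2 None x t cx tT; rewrite -/(d_t _ _); have := leo o; lra.
Qed.

End Reference.

Section Comparison.
Context (R : realType) (psi : xi_space R * R -> R) (T M delta : R).
Context (Ub0 : 'rV[R]_3 -> state R) (Ub : spacetime R -> state R).
Context (mu k : 'M[R]_3 * R -> R) (Ts : \bar R).
Context (U0 : 'rV[R]_3 -> state R) (U : spacetime R -> state R).
Context (C L : R).
Local Notation D := (@open_cyl R T%:E).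
Local Notation ex := (fun al : 'I_3 => @st_dir R (Some al)).
Local Notation cx := (Cn ex D 1).
Hypothesis psi_C3 : is_C3 psi.
Hypothesis T_gt0 : 0 < T.
Hypothesis delta_gt0 : 0 < delta.
Hypothesis Ub_sol : smooth_adiabatic_solution psi T Ub0 Ub.
Hypothesis Ub_Gamma : forall z, closed_cyl T z -> Gamma M delta (Ub z).
Hypothesis C_ge0 : 0 <= C.
Hypothesis L_ge0 : 0 <= L.
Hypothesis C_bounds : forall z zb, 0 < z.2 -> box M delta zb -> relative_bounds psi C z zb.
Hypothesis L_bounds : forall x t, in_cell x -> 0 < t < T ->
  [/\ forall i al, `|d_x al (fun y => vel (Ub y) 0 i) (x, t)| <= L,
      forall al, `|d_x al (fun y => temp (Ub y)) (x, t)| <= L,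
      forall B al, `|d_x al (fun y => psi_xi psi B (xt (Ub y))) (x, t)| <= L &
      forall o, `|d_t (fun y => co o (xt (Ub y))) (x, t)| <= L].
Hypothesis mu_coef : transport_coef mu.
Hypothesis k_coef : transport_coef k.
Hypothesis T_lt : (T%:E < Ts)%E.
Hypothesis U_sol : strong_solution psi mu k Ts U0 U.
Hypothesis U_ent : entropy_production psi mu k Ts U.
Let T_ge0 := ltW T_gt0.
Let rUb := reference_regular Ub_sol.

Lemma strong_regular : regular T U.
Proof.
case: U_sol => -[_ t0] _ [_ [cB cv ct]] _ _; have sub := open_cyl_sub T_lt.
apply: regular_C1.
  by split=> [B|i|]; apply: (Cn1_subset sub); [exact: cB|exact: cv|exact: ct].
by move=> z /open_closed_cyl/(closed_init_cyl T_lt)/t0.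
Qed.
Let rU := strong_regular.

(** [C1_in_x] concerns the space derivatives of the flux; the continuity of the flux itself comes
    from the coefficient and from the gradient of a C^1 field. *)
Lemma cx_of_C1_in_x (f : spacetime R -> R) :
  (forall z, D z -> {for z, continuous f}) -> C1_in_x Ts f -> cx f.
Proof.
move=> cf df; split=> // al; have sub := open_cyl_sub T_lt.
by split=> [z /sub/(df al)[]//|]; split=> // z /sub/(df al)[].
Qed.

Lemma strong_cx_visc i al : cx (visc_flux mu i al U).
Proof.
case: U_sol => _ _ _ [cv _] _; apply: cx_of_C1_in_x (cv i al) => z Dz.
apply: (continuousM (continuous_coef rU mu_coef Dz)).
exact: c1_continuous_d (c1_vel i rU) Dz.
Qed.

Lemma strong_cx_heat al : cx (heat_flux k al U).
Proof.
case: U_sol => _ _ _ [_ ch] _; apply: cx_of_C1_in_x (ch al) => z Dz.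
apply: (continuousM (continuous_coef rU k_coef Dz)).
exact: c1_continuous_d (c1_temp rU) Dz.
Qed.

Definition ent_density z := rel_entropy psi (U (retract T z)) (Ub (retract T z)).
Definition ent t := Tint (fun x => ent_density (x, t)).
Definition diss t := Tint (fun x => dissipation mu k U Ub (x, t)).

Lemma temp_retract z : 0 < temp (U (retract T z)).
Proof.
by case: U_sol => -[_ t0] _ _ _ _; apply/t0/(closed_init_cyl T_lt)/retract_in.
Qed.

Lemma tempb_retract z : 0 < temp (Ub (retract T z)).
Proof. by case: Ub_sol => -[_ t0] _ _ _ _; apply/t0/retract_in. Qed.

Lemma ent_density_continuous : continuous ent_density.
Proof.
case: U_sol => _ _ [[cB cv ct] _] _ _; case: Ub_sol => _ _ [cbB cbv cbt] _ _.
have sub := closed_init_cyl T_lt.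
have r f : {within init_cyl Ts, continuous f} -> continuous (fun z => f (retract T z) : R).
  by move=> cf; exact: (comp_retract_continuous T_ge0 (continuous_subspaceW sub cf)).
have rb f : C1_closed T f -> continuous (fun z => f (retract T z) : R).
  by case=> cf _ _; exact: (comp_retract_continuous T_ge0 cf).
apply: (continuous_rel_entropy psi_C3 (W := fun z => U (retract T z))
  (Wb := fun z => Ub (retract T z))).
- by case=> [B|]; [exact: (r _ (cB B))|exact: (r _ ct)].
- by case=> [B|]; [exact: (rb _ (cbB B))|exact: (rb _ cbt)].
- by move=> i; exact: (r _ (cv i)).
- by move=> i; exact: (rb _ (cbv i)).
- exact: temp_retract.
- exact: tempb_retract.
Qed.

Lemma ent_slice_continuous t : continuous (fun x => ent_density (x, t)).
Proof. by apply: slice_continuous => x; exact: ent_density_continuous. Qed.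

Lemma ent_continuous : continuous ent.
Proof.
move=> t; apply: (@Tint_continuous R ent_density (t - 1) (t + 1)).
  by move=> x s _; exact: ent_density_continuous.
by rewrite ltrBlDr ltrDl ltr01.
Qed.

Lemma rel_entropy_intE t : 0 <= t <= T ->
  rel_entropy_int psi (fun x => U (x, t)) (fun x => Ub (x, t)) = (ent t)%:E.
Proof.
move=> tT; rewrite /ent -(torus_intE (@ent_slice_continuous t)) /rel_entropy_int.
by congr torus_int; apply/funext => x; rewrite /ent_density retractE.
Qed.

Lemma rel_entropy_int0 : rel_entropy_int psi U0 Ub0 = (ent 0)%:E.
Proof.
rewrite -rel_entropy_intE; last by rewrite lexx ltW.
case: U_sol => _ u0 _ _ _; case: Ub_sol => _ ub0 _ _ _.
have -> : U0 = fun x => U (x, 0) by apply/funext.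
by have -> : Ub0 = fun x => Ub (x, 0) by apply/funext.
Qed.

Lemma diss_continuous t : 0 < t < T -> {for t, continuous diss}.
Proof. exact: Tint_dissipation_continuous. Qed.

(** The integrand is controlled for [0 < s < T] only; the endpoints form a null set, and
    measurability comes from continuity in the open interval. *)
Lemma dissipation_intE : dissipation_int mu k T U Ub =
  (\int[lebesgue_measure]_(s in `]0%R, T[) (diss s)%:E)%E.
Proof.
have E s : 0 < s < T -> torus_int (fun x => dissipation mu k U Ub (x, s)) = (diss s)%:E.
  move=> sT; apply: torus_intE; apply: (@slice_continuous R (dissipation mu k U Ub)) => x.
  exact: (continuous_dissipation rU rUb mu_coef k_coef (in_cyl x sT)).
rewrite /dissipation_int integral_itv_bndoo.
  by apply: eq_integral => s /[!inE]; rewrite /= in_itv/= => /E.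
apply: (@eq_measurable_fun _ _ _ _ _ (EFin \o diss)).
  by move=> s /[!inE]; rewrite /= in_itv/= => /E.
apply/measurable_EFinP; apply: open_continuous_measurable_fun; first exact: interval_open.
by move=> s /[!inE]; rewrite /= in_itv/= => /diss_continuous.
Qed.

Lemma ent_density_bounds x t : 0 <= t <= T ->
  relative_bounds psi C (xt (U (x, t))) (xt (Ub (x, t))).
Proof.
move=> tT; apply: C_bounds; last exact/Gamma_box/Ub_Gamma.
by have := temp_retract (x, t); rewrite retractE.
Qed.

Lemma rel_pot_le_entropy (V Vb : state R) :
  rel_pot psi (xt V) (xt Vb) <= rel_entropy psi V Vb.
Proof.
have -> : rel_entropy psi V Vb = rel_pot psi (xt V) (xt Vb)
    + 2^-1 * mxnorm2 (vel V - vel Vb) ^+ 2 by rewrite /rel_entropy /rel_pot addrAC.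
by rewrite lerDl mulr_ge0// sqr_ge0.
Qed.

Lemma ent_density_ge0 z : 0 <= ent_density z.
Proof.
have tT := clamp_in T_ge0 z.2.
have [P0 _ _ _ _] := @ent_density_bounds z.1 (clamp T z.2) tT.
exact: le_trans P0 (rel_pot_le_entropy _ _).
Qed.

Lemma ent_ge0 t : 0 <= ent t.
Proof.
rewrite -(Tint_cst (0 : R)); apply: le_Tint => [x||x _]; first exact: cst_continuous.
  exact: ent_slice_continuous.
exact: ent_density_ge0.
Qed.

Lemma diss_ge0 t : 0 < t < T -> 0 <= diss t.
Proof.
move=> tT; rewrite -(Tint_cst (0 : R)); apply: le_Tint => [x||x _]; first exact: cst_continuous.
  apply: (@slice_continuous R (dissipation mu k U Ub)) => y.
  exact: (continuous_dissipation rU rUb mu_coef k_coef (in_cyl y tT)).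
by apply: (@dissipation_ge0 R T) => //; exact: in_cyl.
Qed.

(** It depends on [C] and [L] only, that is on [psi] and the reference solution, which makes the
    final constant uniform in [mu], [k] and [U]. *)
Definition rate : R := 19 * #|{: option Bidx}|%:R * L * (C + 2).

Lemma rate_ge0 : 0 <= rate.
Proof. by rewrite /rate !mulr_ge0// addr_ge0. Qed.

Lemma ent_gronwall t : 0 <= t <= T -> ((ent t)%:E <= (expR (rate * T))%:E *
  ((ent 0)%:E + \int[lebesgue_measure]_(s in `]0%R, T[) (diss s)%:E))%E.
Proof.
pose E0 t := Tint (fun x => rel_entropy psi (U (x, t)) (Ub (x, t))).
have entE u : 0 < u < T -> ent u = E0 u.
  move=> /andP[u0 uT]; congr Tint; apply/funext => x.
  by rewrite /ent_density retractE// !ltW.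
case: (U_sol) => -[perU _] _ _ _ sysU; case: (Ub_sol) => -[perUb _] _ _ sysUb entUb.
have sub := open_cyl_sub T_lt; have subc := closed_init_cyl T_lt.
apply: (@gronwall R E0 ent (fun t => Tint (fun x =>
  d_t (fun z => rel_entropy psi (U z) (Ub z)) (x, t))) diss rate T) => //.
- exact: rate_ge0.
- exact: ent_continuous.
- by move=> u uT; exact: (derive_Tint_entropy psi_C3 rU rUb).
- exact: diss_continuous.
- by move=> u uT; split; [exact: diss_ge0|rewrite -entE//; exact: ent_ge0].
move=> u uT; apply: (derive_Tint_entropy_le psi_C3 rU rUb) => //.
- by move=> z /sub/sysU.
- by move=> z /sub/U_ent.
- exact: strong_cx_visc.
- exact: strong_cx_heat.
- by move=> y s al /open_closed_cyl/subc; exact: perU.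
- by move=> y s al /open_closed_cyl; exact: perUb.
move=> x cx; have [h1 h2 h3 h4] := L_bounds cx uT.
apply: entropy_source_le => //.
by apply: ent_density_bounds; case/andP: uT => u0 uT; rewrite !ltW.
Qed.

(** [C] turns the energy into [1 + I], [9 * L ^+ 2] bounds both squared gradients of the reference
    solution, and [1 / delta] bounds the inverse of its temperature. *)
Definition amp : R := C * (9 * L ^+ 2) / delta.

Lemma amp_ge0 : 0 <= amp.
Proof. by rewrite /amp divr_ge0 ?(ltW delta_gt0)// mulr_ge0// mulr_ge0// sqr_ge0. Qed.

(** * Absorbing the dissipation for small amplitudes *)

Section SmallViscosity.
Context (m1 m2 : R).
Hypothesis m1_ge0 : 0 <= m1.
Hypothesis m2_ge0 : 0 <= m2.
Hypothesis mu_small : forall (x : xi_space R) (theta : R), 0 < theta ->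
  `|mu (x.1.1, theta) * theta| <= m1 * `|energy psi (x, theta)|.
Hypothesis k_small : forall (x : xi_space R) (theta : R), 0 < theta ->
  `|k (x.1.1, theta)| <= m2 * `|energy psi (x, theta)|.

Lemma dissipation_small x t : in_cell x -> 0 < t < T ->
  dissipation mu k U Ub (x, t) <= (m1 + m2) * amp * (1 + ent_density (x, t)).
Proof.
move=> cx tT; have tT' : 0 <= t <= T by case/andP: tT => t0 tT; rewrite !ltW.
have [h1 h2 _ _] := L_bounds cx tT.
have [P0 _ _ _ eP] := ent_density_bounds x tT'.
have th0 : 0 < temp (U (x, t)) by have := temp_retract (x, t); rewrite retractE.
have [_ _ _ _ [_ /andP[thb _]]] := Ub_Gamma (open_closed_cyl (in_cyl x tT)).
have sq (y : R) : `|y| <= L -> y ^+ 2 <= L ^+ 2.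
  by move=> yL; rewrite -[y ^+ 2]real_normK ?num_real// lerXn2r.
have gv : grad_vel_sq Ub (x, t) <= 9 * L ^+ 2.
  have -> : 9 * L ^+ 2 = #|'I_3|%:R * (#|'I_3|%:R * L ^+ 2) by rewrite card_ord; ring.
  apply: sum_le_card => i; apply: sum_le_card => al; apply: sq; exact: h1.
have gt : grad_temp_sq Ub (x, t) <= 9 * L ^+ 2.
  apply: (@le_trans _ _ (#|'I_3|%:R * L ^+ 2)).
    by apply: sum_le_card => al; apply: sq; exact: h2.
  by rewrite card_ord ler_wpM2r ?sqr_ge0// ler_nat.
have gv0 : 0 <= grad_vel_sq Ub (x, t) by do 2 (apply: sumr_ge0 => ? _); exact: sqr_ge0.
have gt0 : 0 <= grad_temp_sq Ub (x, t) by apply: sumr_ge0 => ? _; exact: sqr_ge0.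
have hm := mu_small (xi (U (x, t))) th0; have hk := k_small (xi (U (x, t))) th0.
have eE : `|energy psi (xt (U (x, t)))| <= C * (1 + ent_density (x, t)).
  rewrite (le_trans eP)// ler_wpM2l// lerD2l /ent_density retractE//.
  exact: rel_pot_le_entropy.
have bound (m a g : R) : 0 <= m -> `|a| <= m * `|energy psi (xt (U (x, t)))| ->
    0 <= g -> g <= 9 * L ^+ 2 ->
    a * g / temp (Ub (x, t)) <= m * amp * (1 + ent_density (x, t)).
  move=> m0 am g0 gL; have tb0 : 0 < temp (Ub (x, t)) by exact: lt_le_trans thb.
  have -> : m * amp * (1 + ent_density (x, t))
      = m * (C * (1 + ent_density (x, t))) * (9 * L ^+ 2) / delta by rewrite /amp; ring.
  rewrite (le_trans (ler_norm _))// !normrM; apply: ler_pM => //.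
    apply: ler_pM => //; last by rewrite ger0_norm.
    by apply: (le_trans am); rewrite ler_wpM2l.
  by rewrite gtr0_norm ?invr_gt0// lef_pV2 ?posrE.
rewrite [X in X * (1 + _)]mulrDl mulrDl.
exact: (lerD (bound _ _ _ m1_ge0 hm gv0 gv) (bound _ _ _ m2_ge0 hk gt0 gt)).
Qed.

Lemma diss_small t : 0 < t < T -> diss t <= (m1 + m2) * amp * (1 + ent t).
Proof.
move=> tT; have ce := @ent_slice_continuous t.
have c1 := @cst_continuous 'rV[R]_3 R 1.
have cS : continuous (fun x => 1 + ent_density (x, t)).
  by move=> x; exact: (continuousD (c1 x) (ce x)).
have cR : continuous (fun x => (m1 + m2) * amp * (1 + ent_density (x, t))).
  by move=> x; exact: (continuousM (@cst_continuous _ _ ((m1 + m2) * amp) x) (cS x)).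
rewrite /diss /ent -(Tint_cst (1 : R)) -(TintD c1 ce).
rewrite -(TintZ _ cS); apply: (le_Tint _ cR) => [|x cx]; last exact: dissipation_small.
apply: (@slice_continuous R (dissipation mu k U Ub)) => y.
exact: (continuous_dissipation rU rUb mu_coef k_coef (in_cyl y tT)).
Qed.

(** Let [S] be the maximum of [ent] and [q = amp * T * (m1 + m2)]. Gronwall's inequality gives
    [S <= K (ent 0 + q (1 + S))] with [K = expR (rate * T)]; smallness means [K q <= 1 / 2], so half
    of [S] is absorbed, whence the factor 2. *)
Lemma ent_small t : 2 * expR (rate * T) * (amp * T) * (m1 + m2) <= 1 -> 0 <= t <= T ->
  ent t <= 2 * expR (rate * T) * (ent 0 + amp * T * (m1 + m2)).
Proof.
move=> small tT; have cE : {within `[0, T], continuous ent}.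
  by apply: continuous_subspaceT; exact: ent_continuous.
have [tm tmT maxE] := EVT_max T_ge0 cE.
have {}maxE s : 0 <= s <= T -> ent s <= ent tm by move=> sT; apply: maxE; rewrite in_itv.
have m0 : 0 <= m1 + m2 by rewrite addr_ge0.
pose c := (m1 + m2) * amp * (1 + ent tm).
have c0 : 0 <= c.
  by rewrite /c mulr_ge0 ?addr_ge0 ?ent_ge0// mulr_ge0 ?amp_ge0.
have mD : measurable_fun `]0, T[ diss.
  apply: open_continuous_measurable_fun; first exact: interval_open.
  by move=> s /[!inE]; rewrite /= in_itv/= => /diss_continuous.
have HI : (\int[lebesgue_measure]_(s in `]0%R, T[) (diss s)%:E <= (c * T)%:E)%E.
  have -> : ((c * T)%:E = \int[lebesgue_measure]_(s in `]0%R, T[) (cst c%:E) s)%E.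
    have lT : @lebesgue_measure R `]0, T[%classic = T%:E.
      by rewrite lebesgue_measure_itv/= lte_fin T_gt0 oppr0 adde0.
    have I := @integral_cst _ _ R (@lebesgue_measure R) _ (measurable_itv `]0, T[) c%:E.
    by rewrite I [X in (_ = _ * X)%E]lT EFinM.
  apply: ge0_le_integral => //=.
  - by move=> s; rewrite in_itv/= lee_fin => /diss_ge0.
  - exact/measurable_EFinP.
  - move=> s; rewrite in_itv/= lee_fin => sT; apply: (le_trans (diss_small sT)).
    rewrite /c ler_wpM2l//; first by rewrite mulr_ge0 ?amp_ge0.
    rewrite lerD2l; apply: maxE.
    by case/andP: sT => s0 sT; rewrite !ltW.
have tm0T : 0 <= tm <= T by move: tmT; rewrite in_itv.
have G : ent tm <= expR (rate * T) * (ent 0 + c * T).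
  rewrite -lee_fin EFinM EFinD; apply: (le_trans (ent_gronwall tm0T)).
  by rewrite lee_wpmul2l ?lee_fin ?expR_ge0// leeD2l.
apply: (le_trans (maxE t tT)).
have S0 := ent_ge0 tm; have K0 := expR_ge0 (rate * T).
move: small G S0 K0; rewrite /c.
set K := expR _; set S := ent tm; set e := ent 0; set m := m1 + m2 => small G S0 K0.
have : 2 * K * (amp * T) * m * S <= S by rewrite -[leRHS]mul1r ler_wpM2r.
move: G; set q := amp * T * m; rewrite (_ : m * amp * (1 + S) * T = q * (1 + S)) ?/q; last by ring.
rewrite (_ : 2 * K * (amp * T) * m * S = 2 * (K * (amp * T * m) * S)); last by ring.
rewrite !mulrDr mulr1; nra.
Qed.

End SmallViscosity.

End Comparison.

(** * Vanishing viscosity and conductivity *)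

Lemma near_at_right2 (R : realType) (b : R) (P : R * R -> Prop) : 0 < b ->
  (forall x y, 0 < x < b -> 0 < y < b -> P (x, y)) ->
  \forall m \near ((0 : R)^'+, (0 : R)^'+), P m.
Proof.
move=> b0 HP.
have nb : \forall x \near (0 : R)^'+, 0 < x < b.
  near=> x; apply/andP; split; near: x; [exact: nbhs_right_gt|exact: nbhs_right_lt].
exists ([set x | 0 < x < b], [set x | 0 < x < b]); first by split.
by move=> [x y] [/= hx hy]; exact: HP.
Unshelve. all: by end_near. Qed.

Lemma cvg_at_right_sum (R : realType) (A : R) :
  A * (m.1 + m.2) @[m --> ((0 : R)^'+, (0 : R)^'+)] --> (0 : R).
Proof.
have h1 : m.1 @[m --> ((0 : R)^'+, (0 : R)^'+)] --> (0 : R).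
  apply: (@cvg_trans _ ((0 : R)^'+)); first exact: cvg_fst.
  exact: cvg_within.
have h2 : m.2 @[m --> ((0 : R)^'+, (0 : R)^'+)] --> (0 : R).
  apply: (@cvg_trans _ ((0 : R)^'+)); first exact: cvg_snd.
  exact: cvg_within.
rewrite -[X in _ --> X](mulr0 A) -[X in A * X](addr0 0).
by apply: cvgM; [exact: cvg_cst|exact: cvgD].
Qed.

Theorem theorem4p1 (R : realType)
    (psi : xi_space R * R -> R) (c p q r l : R)
    (psi_C3 : is_C3 psi)
    (psi_convex : hessian_xi_pos psi)
    (eta_incr : eta_theta_pos psi)
    (c_gt0 : 0 < c) (p_ge4 : 4 <= p)
    (q_gt1 : 1 < q) (r_gt1 : 1 < r) (l_gt1 : 1 < l)
    (growth1 : G1 c p q r l psi)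
    (growth2 : G2 p q r l psi)
    (growth3 : G3 p q r l psi)
    (T M delta : R) (T_gt0 : 0 < T) (M_gt0 : 0 < M) (delta_gt0 : 0 < delta)
    (Ub0 : 'rV[R]_3 -> state R) (Ub : spacetime R -> state R)
    (Ub_sol : smooth_adiabatic_solution psi T Ub0 Ub)
    (Ub_Gamma : forall z, closed_cyl T z -> Gamma M delta (Ub z)) :
  (exists C : R, 0 < C /\
    forall (mu k : 'M[R]_3 * R -> R) (Ts : \bar R)
      (U0 : 'rV[R]_3 -> state R) (U : spacetime R -> state R),
      transport_coef mu -> transport_coef k -> (T%:E < Ts)%E ->
      strong_solution psi mu k Ts U0 U ->
      maximal_domain psi mu k Ts U0 U ->
      entropy_production psi mu k Ts U ->
      forall t : R, 0 <= t <= T ->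
        (rel_entropy_int psi (fun x => U (x, t)) (fun x => Ub (x, t))
         <= C%:E * (rel_entropy_int psi U0 Ub0
                    + dissipation_int mu k T U Ub))%E)
  /\
  (forall (a K : R) (mu k : R -> 'M[R]_3 * R -> R) (Ts : R -> R -> \bar R)
      (U0 : R -> R -> 'rV[R]_3 -> state R)
      (U : R -> R -> spacetime R -> state R),
      0 < a -> 0 < K ->
      (forall mu0 : R, 0 < mu0 < a -> transport_coef (mu mu0)) ->
      (forall k0 : R, 0 < k0 < a -> transport_coef (k k0)) ->
      (forall z : 'M[R]_3 * R, 0 < z.2 -> mu mu0 z @[mu0 --> 0^'+] --> 0) ->
      (forall z : 'M[R]_3 * R, 0 < z.2 -> k k0 z @[k0 --> 0^'+] --> 0) ->
      (forall (mu0 : R) (x : xi_space R) (theta : R), 0 < mu0 < a -> 0 < theta ->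
        `|mu mu0 (x.1.1, theta) * theta| <= K * mu0 * `|energy psi (x, theta)|) ->
      (forall (k0 : R) (x : xi_space R) (theta : R), 0 < k0 < a -> 0 < theta ->
        `|k k0 (x.1.1, theta)| <= K * k0 * `|energy psi (x, theta)|) ->
      (forall mu0 k0 : R, 0 < mu0 < a -> 0 < k0 < a ->
        [/\ (T%:E < Ts mu0 k0)%E,
            strong_solution psi (mu mu0) (k k0) (Ts mu0 k0)
              (U0 mu0 k0) (U mu0 k0),
            maximal_domain psi (mu mu0) (k k0) (Ts mu0 k0)
              (U0 mu0 k0) (U mu0 k0) &
            entropy_production psi (mu mu0) (k k0) (Ts mu0 k0) (U mu0 k0)]) ->
      rel_entropy_int psi (U0 m.1 m.2) Ub0
        @[m --> (0^'+, 0^'+)] --> 0%E ->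
      ereal_sup [set rel_entropy_int psi (fun x => U m.1 m.2 (x, t))
                       (fun x => Ub (x, t)) | t in `[0, T[]
        @[m --> (0^'+, 0^'+)] --> 0%E).
Proof.
have [C C0 C_bounds] := relative_bounds_uniform psi_C3 psi_convex eta_incr c_gt0 p_ge4
  q_gt1 r_gt1 l_gt1 growth1 growth2 growth3 M_gt0 delta_gt0.
have [L L0 L_bounds] := reference_bounds psi_C3 T_gt0 delta_gt0 Ub_sol Ub_Gamma.
pose K := expR (rate C L * T); have K0 : 0 < K by exact: expR_gt0.
have in0 : 0 <= (0 : R) <= T by rewrite lexx ltW.
split.
  exists K; split=> // mu k Ts U0 U mu_coef k_coef T_lt U_sol _ U_ent t tT.
  rewrite (rel_entropy_intE psi_C3 T_gt0 Ub_sol T_lt U_sol tT).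
  rewrite (rel_entropy_int0 psi_C3 T_gt0 Ub_sol T_lt U_sol).
  rewrite (dissipation_intE Ub_sol mu_coef k_coef T_lt U_sol).
  exact: (ent_gronwall psi_C3 T_gt0 Ub_sol Ub_Gamma C0 L0 C_bounds L_bounds
    mu_coef k_coef T_lt U_sol U_ent tT).
move=> a N mu k Ts U0 U a0 N0 mu_coef k_coef _ _ mu_small k_small sols lim0.
pose A := amp delta C L * T; have A0 : 0 <= A by rewrite mulr_ge0 ?amp_ge0// ltW.
pose g := 2 * K * A * N.
have g0 : 0 <= g := mulr_ge0 (mulr_ge0 (mulr_ge0 (ler0n R 2) (ltW K0)) A0) (ltW N0).
(* Two amplitudes below [b] add up to at most [1 / (g + 1)], so [g] times their sum is at most [1],
   the smallness that absorption requires; the [+ 1] covers [g = 0]. *)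
pose b := Num.min a (2 * (g + 1))^-1.
have b0 : 0 < b by rewrite lt_min a0 invr_gt0 mulr_gt0// ltr_wpDl.
pose h (m : R * R) : \bar R :=
  ((2 * K)%:E * (rel_entropy_int psi (U0 m.1 m.2) Ub0 + (A * N * (m.1 + m.2))%:E))%E.
apply: (@squeeze_cvge _ _ _ _ (cst 0%E) _ h).
- apply: (near_at_right2 b0) => x y /andP[x0 xb] /andP[y0 yb].
  have xa : 0 < x < a by rewrite x0 (lt_le_trans xb)// /b ge_min lexx.
  have ya : 0 < y < a by rewrite y0 (lt_le_trans yb)// /b ge_min lexx.
  have [T_lt U_sol _ U_ent] := sols x y xa ya.
  have entE := rel_entropy_intE psi_C3 T_gt0 Ub_sol T_lt U_sol.
  pose E t := ent psi T Ub (U x y) t.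
  have small : 2 * K * A * (N * x + N * y) <= 1.
    have xy : x + y <= (g + 1)^-1.
      have xb' : x <= (2 * (g + 1))^-1 by rewrite ltW// (lt_le_trans xb)// /b ge_min lexx orbT.
      have yb' : y <= (2 * (g + 1))^-1 by rewrite ltW// (lt_le_trans yb)// /b ge_min lexx orbT.
      have -> : (g + 1)^-1 = (2 * (g + 1))^-1 + (2 * (g + 1))^-1.
        by field; rewrite gt_eqF// ltr_wpDl.
      exact: lerD.
    rewrite -mulrDr mulrA -/g (@le_trans _ _ (g * (g + 1)^-1))// ?ler_wpM2l//.
    by rewrite ler_pdivrMr ?mul1r ?lerDl// ltr_wpDl.
  apply/andP; split.
    (* The supremum is at least the value at [t = 0], which is nonnegative. *)
    apply: (@le_trans _ _ (E 0)%:E).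
      by rewrite lee_fin; exact: (ent_ge0 psi_C3 T_gt0 Ub_sol Ub_Gamma C_bounds T_lt U_sol).
    apply: ereal_sup_ubound; exists 0; first by rewrite /= in_itv/= lexx.
    exact: entE.
  apply: ge_ereal_sup; move=> w [t /=]; rewrite in_itv/= => /andP[t0 tT] {w}<-.
  have tT' : 0 <= t <= T by rewrite t0 ltW.
  rewrite (entE _ tT') /h (rel_entropy_int0 psi_C3 T_gt0 Ub_sol T_lt U_sol).
  rewrite -EFinD -EFinM lee_fin -/(E 0) -[A * N * _]mulrA [N * (_ + _)]mulrDr.
  apply: (ent_small psi_C3 T_gt0 delta_gt0 Ub_sol Ub_Gamma C0 L0 C_bounds L_bounds
    (mu_coef x xa) (k_coef y ya) T_lt U_sol U_ent _ _ _ _ small tT').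
  + by rewrite mulr_ge0// ltW.
  + by rewrite mulr_ge0// ltW.
  + by move=> z th; exact: mu_small.
  + by move=> z th; exact: k_small.
- exact: cvg_cst.
- rewrite -[X in _ --> X](mule0 (2 * K)%:E) /h.
  apply: cvgeZl => //; rewrite -[X in _ --> X](adde0 0%E).
  apply: cvgeD => //; apply: cvg_EFin; first exact: nearW.
  exact: cvg_at_right_sum.
Qed.
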